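(* The functions $\psi_0^c(x)=x^4-2x^2+1$, $\psi_m^c$, $\psi_m^s$ ($m\ge1$), which are eigenfunctions of $$-\psi^{(6)}=\lambda^6\psi\ \text{ on }[-1,1],\qquad \psi(\pm1)=\psi'(\pm1)=\psi^{(5)}(\pm1)=0,$$ together with the functions $\phi_0^c(x)=1$, $\phi_m^c$, $\phi_m^s$ ($m\ge1$), which are eigenfunctions of the adjoint problem $$-\phi^{(6)}=\lambda^6\phi\ \text{ on }[-1,1],\qquad \phi'(\pm1)=\phi''(\pm1)=\phi'''(\pm1)=0$$ (all given explicitly in the context), form a complete biorthogonal set of functions on $L^2[-1,1]$. Therefore any function $u\in L^2[-1,1]$ can be expanded as $$u(x)=u_0^c\,\psi_0^c(x)+\sum_{m=1}^{\infty}\big(u_m^c\,\psi_m^c(x)+u_m^s\,\psi_m^s(x)\big),$$ $$u_0^c:=\frac{1}{c_0}\int_{-1}^{1}u(x)\,\mathrm{d}x,\qquad u_m^c:=\frac{1}{c_m}\int_{-1}^{1}u(x)\phi_m^c(x)\,\mathrm{d}x,\qquad u_m^s:=\frac{1}{s_m}\int_{-1}^{1}u(x)\phi_m^s(x)\,\mathrm{d}x\quad(m\ge1),$$ where the constants $c_0,c_m,s_m$ are given explicitly in the context, and the series converges to $u$ in $L^2[-1,1]$.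
   Context: $L^2[-1,1]$ is the space of real-valued square-integrable functions with $\langle f,g\rangle=\int_{-1}^{1}f(x)g(x)\,\mathrm{d}x$. Two families $\{\psi_i\},\{\phi_i\}$ are biorthogonal if $\langle\psi_i,\phi_j\rangle=0$ for $i\ne j$ and $\langle\psi_i,\phi_i\rangle\ne0$; completeness of the biorthogonal set is meant in the sense that every $u\in L^2[-1,1]$ admits the stated expansion, convergent in $L^2[-1,1]$. Eigenvalues. $\lambda_0^c=0$ and, for $m\ge1$, $\lambda_m^c$ is the $m$-th positive root (in increasing order) of $$\cos(2\lambda)+2\cos\lambda\cosh(\sqrt3\lambda)-3=0.$$ For $m\ge1$, $\lambda_m^s=m\pi$. These are common to both eigenvalue problems: $\mu_m^c=\lambda_m^c$, $\mu_m^s=\lambda_m^s$. Eigenfunctions of the first problem. For $m\ge1$, with $\lambda=\lambda_m^c$, $$\begin{aligned}\psi_m^c(x)={}&\cos\lambda x+\frac{\cos\frac{\lambda}{2}\cosh\frac{\sqrt3\lambda}{2}}{\sqrt3\sin\lambda-\sinh(\sqrt3\lambda)}\Big[\Big(-2\sqrt3\cos\lambda\tan\tfrac{\lambda}{2}-2(\cos\lambda-2)\tanh\tfrac{\sqrt3\lambda}{2}\Big)\cos\tfrac{\lambda x}{2}\cosh\tfrac{\sqrt3\lambda x}{2}\\ &+\Big(-3\tan\tfrac{\lambda}{2}+\sin^2\tfrac{\lambda}{2}\tan\tfrac{\lambda}{2}-\tfrac32\sin\lambda+2\sqrt3\cos\lambda\tanh\tfrac{\sqrt3\lambda}{2}\Big)\sin\tfrac{\lambda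 x}{2}\sinh\tfrac{\sqrt3\lambda x}{2}\Big].\end{aligned}$$ For $m\ge1$, with $\lambda=\lambda_m^s$, $$\psi_m^s(x)=\sin\lambda x-\frac{4}{\sinh(\sqrt3\lambda)}\Big[\cos^3\tfrac{\lambda}{2}\sinh\tfrac{\sqrt3\lambda}{2}\,\sin\tfrac{\lambda x}{2}\cosh\tfrac{\sqrt3\lambda x}{2}+\sin^3\tfrac{\lambda}{2}\cosh\tfrac{\sqrt3\lambda}{2}\,\cos\tfrac{\lambda x}{2}\sinh\tfrac{\sqrt3\lambda x}{2}\Big].$$ Eigenfunctions of the adjoint problem. For $m\ge1$, with $\mu=\mu_m^c$, $$\begin{aligned}\phi_m^c(x)={}&\cos\mu x+\frac{2\sin\mu\left(\cos\frac{\mu}{2}\sinh\frac{\sqrt3\mu}{2}-\sqrt3\sin\frac{\mu}{2}\cosh\frac{\sqrt3\mu}{2}\right)}{\cos\mu-\cosh(\sqrt3\mu)}\sin\tfrac{\mu x}{2}\sinh\tfrac{\sqrt3\mu x}{2}\\ &+\frac{\csc\frac{\mu}{2}\operatorname{sech}\frac{\sqrt3\mu}{2}\sin\mu\left(\sqrt3\cot\frac{\mu}{2}\tanh\frac{\sqrt3\mu}{2}+1\right)}{1+\cot^2\frac{\mu}{2}\tanh^2\frac{\sqrt3\mu}{2}}\cos\tfrac{\mu x}{2}\cosh\tfrac{\sqrt3\mu x}{2}.\end{aligned}$$ For $m\ge1$, with $\mu=\mu_m^s$, $$\begin{aligned}\phi_m^s(x)={}&\sin\mu x+\frac{2\cos\mu\left(\cos\frac{\mu}{2}\cosh\frac{\sqrt3\mu}{2}-\sqrt3\sin\frac{\mu}{2}\sinh\frac{\sqrt3\mu}{2}\right)}{\cos\mu+\cosh(\sqrt3\mu)}\sin\tfrac{\mu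 x}{2}\cosh\tfrac{\sqrt3\mu x}{2}\\ &-\frac{\cos\mu\,\operatorname{csch}\frac{\sqrt3\mu}{2}\left(\sin\frac{\mu}{2}+\sqrt3\cos\frac{\mu}{2}\coth\frac{\sqrt3\mu}{2}\right)}{\sin^2\frac{\mu}{2}+\cos^2\frac{\mu}{2}\coth^2\frac{\sqrt3\mu}{2}}\cos\tfrac{\mu x}{2}\sinh\tfrac{\sqrt3\mu x}{2}.\end{aligned}$$ Constants. $c_0=\langle\psi_0^c,\phi_0^c\rangle=16/15$. For $m\ge1$, with $\lambda=\lambda_m^c$, $$\begin{aligned}c_m={}&\frac{\csc^2\frac{\lambda}{2}\,\operatorname{sech}^2\frac{\sqrt3\lambda}{2}}{24\lambda\left(\sqrt3\sin\lambda-\sinh(\sqrt3\lambda)\right)\left(1+\cot^2\frac{\lambda}{2}\tanh^2\frac{\sqrt3\lambda}{2}\right)}\\ &\times\Big[4\sqrt3\cos^2\lambda\,\cosh(2\sqrt3\lambda)-2\sqrt3\cosh(\sqrt3\lambda)\big(-18\lambda\sin\lambda+7\cos\lambda+\cos3\lambda\big)\\ &\quad-2\sqrt3\big(9\lambda\sin2\lambda-7\cos2\lambda+\cos4\lambda\big)+6\sinh(\sqrt3\lambda)\big(7\sin\lambda-\sin3\lambda+2\lambda\cos3\lambda\big)\\ &\quad-6\big(\lambda+\sin2\lambda\big)\sinh(2\sqrt3\lambda)\Big].\end{aligned}$$ For $m\ge1$, with $\lambda=\lambda_m^s$, $$\begin{aligned}s_m={}&-\frac{\operatorname{csch}\frac{\sqrt3\lambda}{2}\,\operatorname{sech}\frac{\sqrt3\lambda}{2}}{12\lambda\left(\cos\lambda+\cosh(\sqrt3\lambda)\right)}\\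 &\times\Big[-2\sqrt3\cos2\lambda\,\cosh^2(\sqrt3\lambda)+\sqrt3\sin2\lambda\,\cosh(\sqrt3\lambda)\big(2\sin\lambda-3\lambda\cos\lambda\big)\\ &\quad+\sqrt3\big(3\lambda\sin2\lambda+\cos4\lambda+\cosh(2\sqrt3\lambda)\big)+6\lambda\cos^3\lambda\,\sinh(\sqrt3\lambda)-3\lambda\sinh(2\sqrt3\lambda)\Big].\end{aligned}$$ These constants are the values $c_m=\langle\psi_m^c,\phi_m^c\rangle$ and $s_m=\langle\psi_m^s,\phi_m^s\rangle$. *)

(* Defs.v *)
From HB Require Import structures.
From mathcomp Require Export all_boot all_order all_algebra.
From mathcomp Require Export all_classical all_reals all_analysis.
Export Order.TTheory GRing.Theory Num.Theory numFieldNormedType.Exports.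

Set Implicit Arguments.
Unset Strict Implicit.
Unset Printing Implicit Defensive.

Local Open Scope ring_scope.
Local Open Scope classical_set_scope.

Section Defs.
Context {R : realType}.
Implicit Types (f g u : R -> R) (l x a : R) (m : nat).

Definition sinh x : R := (expR x - expR (- x)) / 2.
Definition cosh x : R := (expR x + expR (- x)) / 2.
Definition tanh x : R := sinh x / cosh x.
Definition coth x : R := cosh x / sinh x.
Definition sech x : R := (cosh x)^-1.
Definition csch x : R := (sinh x)^-1.
Definition cot x : R := cos x / sin x.
Definition csc x : R := (sin x)^-1.

Local Notation s3 := (Num.sqrt (3 : R)).

(* Functions on [-1, 1] are represented by functions R -> R, of which only the
   values on [-1, 1] matter; f \_ I is the extension by 0 of f restricted
   to I. *)
Definition I11 : set R := `[-1, 1]%classic.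

Definition inL2 f : Prop :=
  (f \_ I11 : R -> R) \in Lfun (@lebesgue_measure R) 2%:E.

Definition normL2 f : \bar R :=
  ('N[@lebesgue_measure R]_2%:E[EFin \o (f \_ I11)])%E.

Definition inner f g : R :=
  \int[@lebesgue_measure R]_(x in I11) (f x * g x).

Definition biorthogonal (I : Type) (psi phi : I -> R -> R) : Prop :=
  [/\ forall i, inL2 (psi i) /\ inL2 (phi i),
      forall i j, i <> j -> inner (psi i) (phi j) = 0
    & forall i, inner (psi i) (phi i) <> 0].

(* The derivatives at the end points are two-sided: the eigenfunctions below
   are given by formulas valid on the whole line. *)
Definition eigenfunction (bc : (R -> R) -> R -> Prop) l f : Prop :=
  [/\ exists2 x, I11 x & f x <> 0,
      forall n x, (n < 6)%N -> I11 x -> derivable (derive1n n f) x 1,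
      forall x, I11 x -> - derive1n 6 f x = l ^+ 6 * f x
    & bc f (-1) /\ bc f 1].

Definition bc_direct f x : Prop :=
  [/\ f x = 0, derive1 f x = 0 & derive1n 5 f x = 0].

Definition bc_adjoint f x : Prop :=
  [/\ derive1 f x = 0, derive1n 2 f x = 0 & derive1n 3 f x = 0].

Definition char_c l : R :=
  cos (2 * l) + 2 * cos l * cosh (s3 * l) - 3.

(* The default value 0 of xget is never used at lambda_c: char_c has infinitely
   many positive roots, and they do not accumulate. *)
Definition next_root a : R :=
  let roots := [set x | a < x /\ char_c x = 0] in
  xget 0 (roots `&` lbound roots).

(* lambda_c m is the m-th positive root of char_c for m >= 1. *)
Fixpoint lambda_c m : R := if m is k.+1 then next_root (lambda_c k) else 0.

Definition lambda_s m : R := m%:R * pi.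

Definition psi_c_form l x : R :=
  cos (l * x)
  + cos (l / 2) * cosh (s3 * l / 2) / (s3 * sin l - sinh (s3 * l))
    * ((- 2 * s3 * cos l * tan (l / 2)
          - 2 * (cos l - 2) * tanh (s3 * l / 2))
         * (cos (l * x / 2) * cosh (s3 * l * x / 2))
       + (- 3 * tan (l / 2) + sin (l / 2) ^+ 2 * tan (l / 2)
          - 3 / 2 * sin l + 2 * s3 * cos l * tanh (s3 * l / 2))
         * (sin (l * x / 2) * sinh (s3 * l * x / 2))).

Definition psi_s_form l x : R :=
  sin (l * x)
  - 4 / sinh (s3 * l)
    * (cos (l / 2) ^+ 3 * sinh (s3 * l / 2)
         * (sin (l * x / 2) * cosh (s3 * l * x / 2))
       + sin (l / 2) ^+ 3 * cosh (s3 * l / 2)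
         * (cos (l * x / 2) * sinh (s3 * l * x / 2))).

Definition phi_c_form l x : R :=
  cos (l * x)
  + 2 * sin l * (cos (l / 2) * sinh (s3 * l / 2)
                 - s3 * sin (l / 2) * cosh (s3 * l / 2))
      / (cos l - cosh (s3 * l))
    * (sin (l * x / 2) * sinh (s3 * l * x / 2))
  + csc (l / 2) * sech (s3 * l / 2) * sin l
      * (s3 * cot (l / 2) * tanh (s3 * l / 2) + 1)
      / (1 + cot (l / 2) ^+ 2 * tanh (s3 * l / 2) ^+ 2)
    * (cos (l * x / 2) * cosh (s3 * l * x / 2)).

Definition phi_s_form l x : R :=
  sin (l * x)
  + 2 * cos l * (cos (l / 2) * cosh (s3 * l / 2)
                 - s3 * sin (l / 2) * sinh (s3 * l / 2))
      / (cos l + cosh (s3 * l))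
    * (sin (l * x / 2) * cosh (s3 * l * x / 2))
  - cos l * csch (s3 * l / 2)
      * (sin (l / 2) + s3 * cos (l / 2) * coth (s3 * l / 2))
      / (sin (l / 2) ^+ 2 + cos (l / 2) ^+ 2 * coth (s3 * l / 2) ^+ 2)
    * (cos (l * x / 2) * sinh (s3 * l * x / 2)).

Definition c_form l : R :=
  csc (l / 2) ^+ 2 * sech (s3 * l / 2) ^+ 2
    / (24 * l * (s3 * sin l - sinh (s3 * l))
       * (1 + cot (l / 2) ^+ 2 * tanh (s3 * l / 2) ^+ 2))
  * (4 * s3 * cos l ^+ 2 * cosh (2 * s3 * l)
     - 2 * s3 * cosh (s3 * l)
         * (- 18 * l * sin l + 7 * cos l + cos (3 * l))
     - 2 * s3 * (9 * l * sin (2 * l) - 7 * cos (2 * l) + cos (4 * l))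
     + 6 * sinh (s3 * l) * (7 * sin l - sin (3 * l) + 2 * l * cos (3 * l))
     - 6 * (l + sin (2 * l)) * sinh (2 * s3 * l)).

Definition s_form l : R :=
  - (csch (s3 * l / 2) * sech (s3 * l / 2)
       / (12 * l * (cos l + cosh (s3 * l))))
  * (- 2 * s3 * cos (2 * l) * cosh (s3 * l) ^+ 2
     + s3 * sin (2 * l) * cosh (s3 * l) * (2 * sin l - 3 * l * cos l)
     + s3 * (3 * l * sin (2 * l) + cos (4 * l) + cosh (2 * s3 * l))
     + 6 * l * cos l ^+ 3 * sinh (s3 * l)
     - 3 * l * sinh (2 * s3 * l)).

Definition psi_c m x : R :=
  if m is 0 then x ^+ 4 - 2 * x ^+ 2 + 1 else psi_c_form (lambda_c m) x.
Definition phi_c m x : R :=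
  if m is 0 then 1 else phi_c_form (lambda_c m) x.
Definition c_const m : R :=
  if m is 0 then 16 / 15 else c_form (lambda_c m).

(* The sine families are only meant for m >= 1. *)
Definition psi_s m x : R := psi_s_form (lambda_s m) x.
Definition phi_s m x : R := phi_s_form (lambda_s m) x.
Definition s_const m : R := s_form (lambda_s m).

(* Cmode m indexes psi_c m (m >= 0); Smode k indexes psi_s k.+1. *)
Inductive mode := Cmode of nat | Smode of nat.

Definition eigval (i : mode) : R :=
  match i with Cmode m => lambda_c m | Smode k => lambda_s k.+1 end.
Definition psi (i : mode) : R -> R :=
  match i with Cmode m => psi_c m | Smode k => psi_s k.+1 end.
Definition phi (i : mode) : R -> R :=
  match i with Cmode m => phi_c m | Smode k => phi_s k.+1 end.

Definition coef_c u m : R := (c_const m)^-1 * inner u (phi_c m).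
Definition coef_s u m : R := (s_const m)^-1 * inner u (phi_s m).

Definition partial_sum u (N : nat) x : R :=
  coef_c u 0 * psi_c 0 x
  + \sum_(1 <= m < N.+1) (coef_c u m * psi_c m x + coef_s u m * psi_s m x).

End Defs.

(* Main.v *)
(* For an eigenvalue l the antiderivative Y of psi that vanishes at -1 is an
   eigenfunction of - D^6 with the clamped conditions Y = Y' = Y'' = 0 at -1 and
   1, and phi = Y^(5) / l^4, so that phi' = - l^2 Y. Hence <psi_i, phi_j> =
   l_j^2 <Y_i, Y_j>, which vanishes for i <> j by self-adjointness, and
   <psi_i, phi_i> = psi_i''(1)^2 / (3 l^4) by a Pohozaev identity.

   The clamped problem has no eigenfunctions besides the Y_i, and its
   eigenfunctions are complete: otherwise the normalized iterates of the
   solution operator on a function orthogonal to all of them would cluster at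
   another eigenfunction.

   The functions psi_i and phi_i differ from orthonormal trigonometric systems
   by boundary layers, and Hilbert's inequality turns this into Bessel and
   synthesis bounds. Hence the partial sums are uniformly bounded operators and
   the remainders r_N of u form a Cauchy sequence. For continuously
   differentiable u the primitives of the r_N converge uniformly, to a function
   orthogonal to all Y_i, that is to 0; so r_N tends weakly, hence strongly, to
   0. A density argument concludes. *)

From mathcomp Require Import ring lra measurable_realfun.
Require Import Defs.

Set Implicit Arguments.
Unset Strict Implicit.
Unset Printing Implicit Defensive.

Local Open Scope ring_scope.
Local Open Scope classical_set_scope.

(** Neither boundary value problem is self-adjoint. Integrating psi repairs this: psi = psi' = 0 at
    the ends become Y' = Y'' = 0, and psi^(5) = Y^(6) = - l^6 Y turns the odd-looking condition of
    order five into Y = 0, provided that l is nonzero. The eigenvalue 0 escapes, since (1 - x^2)^2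
    has a nonzero mean. It is treated apart, and orthogonality to phi_0 = 1 is what makes the
    primitives of the remainders vanish at both ends.

    Completeness of the Y_i alone does not give the expansion: psi_i = Y_i', and differentiating an
    L^2-convergent series term by term loses convergence. The missing control is quantitative. The
    roots of z^6 = - l^6 are +- i l and l (+- sqrt 3 +- i) / 2, so beside a pure sine or cosine
    there are only hyperbolic terms living in layers of width about 1 / l at the ends. Two layers
    with rates h and k overlap by O(1 / (h + k)). Within each of the two families the eigenvalues
    are spaced by about pi, so these overlaps are dominated by Hilbert's kernel. *)

Section PointwiseDerivatives.
Context {R : realType}.
Implicit Types (f g : R -> R) (x a b c : R).

Lemma dD f g x a b : is_derive x 1 f a -> is_derive x 1 g b ->
  is_derive x 1 (fun t => f t + g t) (a + b).
Proof. exact: is_deriveD. Qed.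

Lemma dN f x a : is_derive x 1 f a -> is_derive x 1 (fun t => - f t) (- a).
Proof. exact: is_deriveN. Qed.

Lemma dM f g x a b : is_derive x 1 f a -> is_derive x 1 g b ->
  is_derive x 1 (fun t => f t * g t) (a * g x + f x * b).
Proof.
move=> df dg; apply: is_derive_eq (is_deriveM df dg) _.
by rewrite /GRing.scale /= addrC (mulrC (g x)).
Qed.

Lemma dcst c x : is_derive x 1 (fun=> c) 0.
Proof. exact: is_derive_cst. Qed.

Lemma did x : is_derive x 1 (fun t => t) 1.
Proof. exact: is_derive_id. Qed.

Lemma deq f x a b : is_derive x 1 f a -> a = b -> is_derive x 1 f b.
Proof. by move=> df <-. Qed.

Lemma dX f n x a : is_derive x 1 f a ->
  is_derive x 1 (fun t => f t ^+ n) (n%:R * f x ^+ n.-1 * a).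
Proof. move=> df; have -> : (fun t => f t ^+ n) = f ^+ n by apply/funext => t; rewrite exprfctE.
by apply: deq (is_deriveX n df) _. Qed.

Lemma dcomp f g x a b : is_derive (g x) 1 f a -> is_derive x 1 g b ->
  is_derive x 1 (fun t => f (g t)) (a * b).
Proof.
move=> df dg; apply: is_derive_eq (is_derive1_comp df dg) _.
by rewrite /GRing.scale /= mulrC.
Qed.

Lemma dexp f x a : is_derive x 1 f a ->
  is_derive x 1 (fun t => expR (f t)) (expR (f x) * a).
Proof. exact: dcomp (is_derive_expR _). Qed.

Lemma dcos f x a : is_derive x 1 f a ->
  is_derive x 1 (fun t => cos (f t)) (- sin (f x) * a).
Proof. exact: dcomp (is_derive_cos _). Qed.

Lemma dsin f x a : is_derive x 1 f a ->
  is_derive x 1 (fun t => sin (f t)) (cos (f x) * a).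
Proof. exact: dcomp (is_derive_sin _). Qed.

Lemma dcosh f x a : is_derive x 1 f a ->
  is_derive x 1 (fun t => cosh (f t)) (sinh (f x) * a).
Proof.
move=> df; have d1 := dexp df; have d2 := dexp (dN df).
apply: deq (dM (dD d1 d2) (dcst 2^-1 x)) _.
by rewrite mulr0 addr0 /sinh; ring.
Qed.

Lemma dsinh f x a : is_derive x 1 f a ->
  is_derive x 1 (fun t => sinh (f t)) (cosh (f x) * a).
Proof.
move=> df; have d1 := dexp df; have d2 := dexp (dN df).
apply: deq (dM (dD d1 (dN d2)) (dcst 2^-1 x)) _.
by rewrite mulr0 addr0 /cosh; ring.
Qed.

End PointwiseDerivatives.

(* deriv reads off a derivative from the syntax of the function, taking those of
   unknown functions from the context, and leaves the equation between values. *)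
Ltac der := repeat lazymatch goal with
  | |- is_derive _ _ (fun t => _) _ => lazymatch goal with
    | |- is_derive _ _ (fun=> ?c) _ => exact: dcst
    | |- is_derive _ _ (fun t => t) _ => exact: did
    | |- is_derive _ _ (fun t => @?f t + @?g t) _ => notypeclasses refine (@dD _ f g _ _ _ _ _)
    | |- is_derive _ _ (fun t => - @?f t) _ => notypeclasses refine (@dN _ f _ _ _)
    | |- is_derive _ _ (fun t => @?f t * @?g t) _ => notypeclasses refine (@dM _ f g _ _ _ _ _)
    | |- is_derive _ _ (fun t => @?f t ^+ ?n) _ => notypeclasses refine (@dX _ f n _ _ _)
    | |- is_derive _ _ (fun t => cos (@?f t)) _ => notypeclasses refine (@dcos _ f _ _ _)
    | |- is_derive _ _ (fun t => sin (@?f t)) _ => notypeclasses refine (@dsin _ f _ _ _)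
    | |- is_derive _ _ (fun t => cosh (@?f t)) _ => notypeclasses refine (@dcosh _ f _ _ _)
    | |- is_derive _ _ (fun t => sinh (@?f t)) _ => notypeclasses refine (@dsinh _ f _ _ _)
    | |- is_derive _ _ (fun t => expR (@?f t)) _ => notypeclasses refine (@dexp _ f _ _ _)
    | |- is_derive _ _ (fun t => ?f t) _ => change (fun t => f t) with f
    | |- is_derive _ _ (fun t => ?f (@?g t)) _ => notypeclasses refine (@dcomp _ f g _ _ _ _ _)
    end
  end; try eassumption.
Ltac deriv := notypeclasses refine (@deq _ _ _ _ _ _ _); [der|cbv beta].

(** * The inner product of L^2[-1, 1] *)

Section Calculus.
Context {R : realType}.
Implicit Types (f g h u : R -> R) (x : R).
Notation mu := (@lebesgue_measure R).

(** Both notions are two-sided even at the end points, which avoids subspace topologies and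
    one-sided derivatives. *)
Definition contI f := forall x, I11 x -> {for x, continuous f}.
Definition derI f g := forall x, I11 x -> is_derive x 1 f (g x).

Lemma I11P x : I11 x <-> -1 <= x <= 1.
Proof. by rewrite /I11 /= in_itv. Qed.

Lemma I11_1 : I11 (1 : R). Proof. by apply/I11P; apply/andP; split; lra. Qed.
Lemma I11_N1 : I11 (-1 : R). Proof. by apply/I11P; apply/andP; split; lra. Qed.

Lemma measurable_I11 : measurable (I11 : set R).
Proof. exact: measurable_itv. Qed.

Lemma derI_cont f g : derI f g -> contI f.
Proof.
move=> fg x Ix; apply/differentiable_continuous/derivable1_diffP.
by case: (fg x Ix).
Qed.

Lemma contI_within f : contI f -> {within `[-1, 1], continuous f}.
Proof. by move=> cf; apply: continuous_in_subspaceT => x; rewrite inE => /cf. Qed.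

Lemma contI_cst (c : R) : contI (fun=> c).
Proof. by move=> x _; exact: cst_continuous. Qed.

Lemma contID f g : contI f -> contI g -> contI (fun x => f x + g x).
Proof. by move=> cf cg x Ix; apply: continuousD; [exact: cf|exact: cg]. Qed.

Lemma contIN f : contI f -> contI (fun x => - f x).
Proof. by move=> cf x Ix; apply: continuousN; exact: cf. Qed.

Lemma contIB f g : contI f -> contI g -> contI (fun x => f x - g x).
Proof. by move=> cf cg; apply: contID => //; exact: contIN. Qed.

Lemma contIM f g : contI f -> contI g -> contI (fun x => f x * g x).
Proof. by move=> cf cg x Ix; apply: continuousM; [exact: cf|exact: cg]. Qed.

Lemma contIZ (c : R) f : contI f -> contI (fun x => c * f x).
Proof. by apply: contIM; exact: contI_cst. Qed.

Lemma contI_integrable f : contI f -> mu.-integrable I11 (EFin \o f).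
Proof.
move=> /contI_within cf; apply: continuous_compact_integrable => //.
exact: segment_compact.
Qed.

Lemma integrable_restrict f : mu.-integrable setT (EFin \o (f \_ I11)) <->
  mu.-integrable I11 (EFin \o f).
Proof.
have -> : EFin \o f \_ I11 = (EFin \o f) \_ I11.
  by apply/funext => x; rewrite restrict_EFin.
exact: iff_sym (@integrable_mkcond _ _ R mu I11 (EFin \o f) measurable_I11).
Qed.

Lemma inL2E f : inL2 f <->
  measurable_fun I11 f /\ mu.-integrable I11 (EFin \o (fun x => f x ^+ 2)).
Proof.
split=> [L|[mf sf]].
  split.
    have /andP[] := L; rewrite inE /= => /(measurable_restrictT _ measurable_I11).
    by [].
  have h := Lfun2_integrable_sqr L.
  apply/integrable_restrict; apply: eq_integrable h => //.
  move=> x _ /=; rewrite /patch; case: ifP => // _.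
  by rewrite expr0n.
have {}mf : measurable_fun setT (f \_ I11).
  by apply/(measurable_restrictT _ _).1 => //; exact: measurable_I11.
apply/andP; split; rewrite inE //=.
rewrite /finite_norm unlock poweR_lty//.
have /integrableP[_] := (integrable_restrict _).2 sf.
apply: le_lt_trans; rewrite le_eqVlt; apply/orP; left; apply/eqP.
apply: eq_integral => x _ /=.
rewrite /patch; case: ifP => _; rewrite /= ?normr0.
  by rewrite powR_mulrn// real_normK ?num_real// ger0_norm// sqr_ge0.
by rewrite powR0.
Qed.

Lemma contI_inL2 f : contI f -> inL2 f.
Proof.
move=> cf; apply/inL2E; split.
  apply: subspace_continuous_measurable_fun; first exact: measurable_I11.
  exact: contI_within.
exact: (contI_integrable (contIM cf cf)).
Qed.

Lemma inL2M_integrable f g : inL2 f -> inL2 g ->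
  mu.-integrable I11 (EFin \o (fun x => f x * g x)).
Proof.
move=> Lf Lg; have /Lfun1_integrable := Lfun2_mul_Lfun1 Lf Lg.
move=> h; apply/integrable_restrict; apply: eq_integrable h => //.
move=> x _ /=; rewrite /patch; case: ifP => // _.
by rewrite mul0r.
Qed.

Lemma inL2Z (c : R) f : inL2 f -> inL2 (fun x => c * f x).
Proof.
move=> /inL2E[mf sf]; apply/inL2E; split.
  exact: measurable_funM.
under eq_fun do rewrite exprMn.
rewrite (_ : EFin \o _ = fun x => ((c ^+ 2)%:E * (EFin \o (fun x => (f x ^+ 2)%R)) x)%E) //.
by apply: integrableZl => //; exact: measurable_I11.
Qed.

Lemma inL2D f g : inL2 f -> inL2 g -> inL2 (fun x => f x + g x).
Proof.
move=> Lf Lg; have /inL2E[mf sf] := Lf; have /inL2E[mg sg] := Lg.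
apply/inL2E; split; first exact: measurable_funD.
rewrite (_ : _ \o _ = ((EFin \o (fun x => (f x ^+ 2)%R)) \+
   ((EFin \o (fun x => (g x ^+ 2)%R)) \+ ((EFin \o (fun x => (f x * g x)%R))
   \+ (EFin \o (fun x => (f x * g x)%R)))))%E); last first.
  by apply/funext => x /=; rewrite -!EFinD; congr EFin; ring.
have I := inL2M_integrable Lf Lg; have m := measurable_I11.
do 3 (apply: integrableD => //).
Qed.

Lemma inL2B f g : inL2 f -> inL2 g -> inL2 (fun x => f x - g x).
Proof.
move=> Lf Lg; have := inL2D Lf (inL2Z (-1) Lg).
by under eq_fun do rewrite mulN1r.
Qed.

Lemma inL2_cst (c : R) : inL2 (fun=> c).
Proof. exact/contI_inL2/contI_cst. Qed.

Lemma inL2_sum (I : Type) (r : seq I) (P : pred I) (F : I -> R -> R) :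
  (forall i, inL2 (F i)) -> inL2 (fun x => \sum_(i <- r | P i) F i x).
Proof.
move=> cF; elim: r => [|i r IH].
  by under eq_fun do rewrite big_nil; exact: inL2_cst.
under eq_fun do rewrite big_cons; case: (P i) => //.
exact: inL2D.
Qed.

Lemma eq_inner f f' g g' : (forall x, I11 x -> f x = f' x) ->
  (forall x, I11 x -> g x = g' x) -> inner f g = inner f' g'.
Proof.
move=> ff gg; apply: eq_Rintegral => x; rewrite inE => Ix.
by rewrite ff ?gg.
Qed.

Lemma innerC f g : inner f g = inner g f.
Proof. by apply: eq_Rintegral => x _; rewrite mulrC. Qed.

Lemma innerDl f g h : inL2 f -> inL2 g -> inL2 h ->
  inner (fun x => f x + g x) h = inner f h + inner g h.
Proof.
move=> Lf Lg Lh; rewrite /inner -RintegralD//; first last.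
- exact: inL2M_integrable.
- exact: inL2M_integrable.
- exact: measurable_I11.
by apply: eq_Rintegral => x _; rewrite mulrDl.
Qed.

Lemma innerZl (c : R) f g : inL2 f -> inL2 g ->
  inner (fun x => c * f x) g = c * inner f g.
Proof.
move=> Lf Lg; rewrite /inner -RintegralZl//; first last.
- exact: inL2M_integrable.
- exact: measurable_I11.
by apply: eq_Rintegral => x _; rewrite mulrA.
Qed.

Lemma innerBl f g h : inL2 f -> inL2 g -> inL2 h ->
  inner (fun x => f x - g x) h = inner f h - inner g h.
Proof.
move=> Lf Lg Lh; rewrite -mulN1r -innerZl// -innerDl//; last exact: inL2Z.
by apply: eq_inner => // x _; rewrite mulN1r.
Qed.

Lemma innerDr f g h : inL2 f -> inL2 g -> inL2 h ->
  inner h (fun x => f x + g x) = inner h f + inner h g.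
Proof. by move=> *; rewrite !(innerC h); exact: innerDl. Qed.

Lemma innerBr f g h : inL2 f -> inL2 g -> inL2 h ->
  inner h (fun x => f x - g x) = inner h f - inner h g.
Proof. by move=> *; rewrite !(innerC h); exact: innerBl. Qed.

Lemma innerZr (c : R) f g : inL2 f -> inL2 g ->
  inner g (fun x => c * f x) = c * inner g f.
Proof. by move=> *; rewrite !(innerC g); exact: innerZl. Qed.

Lemma inner0l g : inner (fun=> 0) g = 0.
Proof.
rewrite /inner (_ : (fun x => _) = cst 0).
  by rewrite /Rintegral integral0.
by apply/funext => x; rewrite mul0r.
Qed.

Lemma inner_suml (I : Type) (r : seq I) (P : pred I) (F : I -> R -> R) g :
  (forall i, inL2 (F i)) -> inL2 g ->
  inner (fun x => \sum_(i <- r | P i) F i x) g = \sum_(i <- r | P i) inner (F i) g.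
Proof.
move=> cF Lg; elim: r => [|i r IH].
  by under eq_fun do rewrite big_nil; rewrite big_nil inner0l.
rewrite big_cons; under eq_fun do rewrite big_cons; case: (P i) => //.
by rewrite innerDl// ?IH//; exact: inL2_sum.
Qed.

Lemma inner_ge0 f : 0 <= inner f f.
Proof. by apply: Rintegral_ge0 => x _; rewrite -expr2 sqr_ge0. Qed.

Definition nrm f : R := Num.sqrt (inner f f).

Lemma nrm_ge0 f : 0 <= nrm f. Proof. exact: sqrtr_ge0. Qed.
Lemma nrm2 f : nrm f ^+ 2 = inner f f. Proof. by rewrite sqr_sqrtr ?inner_ge0. Qed.

Lemma cauchy_schwarz_sqr f g : inL2 f -> inL2 g -> inner f g ^+ 2 <= inner f f * inner g g.
Proof.
move=> Lf Lg.
set a := inner f f; set b := inner f g; set c := inner g g.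
have key t : 0 <= a - 2 * t * b + t ^+ 2 * c.
  have Lt := inL2Z t Lg.
  have := inner_ge0 (fun x => f x - t * g x).
  rewrite innerBl ?innerBr ?innerZl ?innerZr//; last exact: inL2B.
  by rewrite (innerC g f) -/a -/b -/c; congr (_ <= _); ring.
have a0 : 0 <= a by exact: inner_ge0.
have c0 : 0 <= c by exact: inner_ge0.
have [c00|cn0] := eqVneq c 0.
  rewrite c00 mulr0; have [->|bn0] := eqVneq b 0; first by rewrite expr0n.
  (* With c = 0 the quadratic polynomial is a - 2 t b, and this t gives it the value -1. *)
  have := key ((a + 1) / (2 * b)); rewrite c00 mulr0 addr0.
  rewrite (_ : 2 * _ * b = a + 1); last by field.
  by move=> ?; exfalso; lra.
have := key (b / c).
have cp : 0 < c by rewrite lt0r cn0.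
rewrite (_ : _ + _ = (a * c - b ^+ 2) / c); last by field.
by rewrite pmulr_lge0 ?invr_gt0// subr_ge0.
Qed.

Lemma cauchy_schwarz f g : inL2 f -> inL2 g -> `|inner f g| <= nrm f * nrm g.
Proof.
move=> Lf Lg; rewrite -(@ler_pXn2r _ 2)// ?nnegrE ?mulr_ge0 ?nrm_ge0//.
by rewrite real_normK ?num_real// exprMn !nrm2 cauchy_schwarz_sqr.
Qed.

Lemma nrmD f g : inL2 f -> inL2 g -> nrm (fun x => f x + g x) <= nrm f + nrm g.
Proof.
move=> Lf Lg; rewrite -(@ler_pXn2r _ 2)// ?nnegrE ?addr_ge0 ?nrm_ge0//.
rewrite nrm2 innerDl ?innerDr//; last exact: inL2D.
rewrite sqrrD !nrm2 (innerC g f).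
have := le_trans (ler_norm _) (cauchy_schwarz Lf Lg); lra.
Qed.

Lemma nrmZ (c : R) f : inL2 f -> nrm (fun x => c * f x) = `|c| * nrm f.
Proof.
move=> Lf; rewrite /nrm innerZl ?innerZr//; last exact: inL2Z.
by rewrite mulrA sqrtrM -expr2 ?sqr_ge0// sqrtr_sqr.
Qed.

Lemma eq_nrm f g : (forall x, I11 x -> f x = g x) -> nrm f = nrm g.
Proof. by move=> fg; rewrite /nrm (eq_inner fg fg). Qed.

Lemma nrmB f g : inL2 f -> inL2 g -> nrm (fun x => f x - g x) <= nrm f + nrm g.
Proof.
move=> Lf Lg; have -> : nrm g = nrm (fun x => -1 * g x).
  by rewrite nrmZ// normrN1 mul1r.
have := nrmD Lf (inL2Z (-1) Lg).
by under eq_fun do rewrite mulN1r.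
Qed.

Lemma normL2E f : inL2 f -> normL2 f = (nrm f)%:E.
Proof.
move=> Lf; rewrite /normL2 unlock /nrm.
have int := inL2M_integrable Lf Lf.
have -> : (\int[mu]_x `|(EFin \o f \_ I11) x| `^ 2 = (inner f f)%:E)%E.
  rewrite /inner /Rintegral fineK; last first.
    exact: (@integrable_fin_num _ _ R mu I11 measurable_I11 _ int).
  rewrite [RHS]integral_mkcond; apply: eq_integral => x _ /=.
  rewrite restrict_EFin /= /patch; case: ifP => _; rewrite /= ?normr0.
    by rewrite powR_mulrn// real_normK ?num_real// expr2.
  by rewrite powR0.
rewrite /= powR12_sqrt//; exact: inner_ge0.
Qed.

Lemma derI_LR f g : derI f g -> derivable_oo_LRcontinuous f (-1) 1.
Proof.
move=> fg; have cf := derI_cont fg; split.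
- move=> x; rewrite in_itv/= => /andP[? ?].
  suff: I11 x by move=> /fg[].
  by apply/I11P; apply/andP; split; lra.
- exact/cvg_at_right_filter/(cf _ I11_N1).
- exact/cvg_at_left_filter/(cf _ I11_1).
Qed.

Lemma derI_derive1 f g : derI f g -> {in `]-1, 1[%R, f^`() =1 g}.
Proof.
move=> fg x; rewrite in_itv/= => /andP[? ?].
have /fg[_ <-] : I11 x by apply/I11P; apply/andP; split; lra.
by rewrite derive1E.
Qed.

Lemma Rintegral_derI f g : derI f g -> contI g ->
  \int[mu]_(x in I11) g x = f 1 - f (-1).
Proof.
move=> fg cg; rewrite /Rintegral /I11.
rewrite (@continuous_FTC2 _ g f (-1) 1) //.
- exact: contI_within.
- exact: derI_LR fg.
- exact: derI_derive1.
Qed.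

Lemma inner_by_parts f f' g g' : derI f f' -> derI g g' -> contI f' -> contI g' ->
  inner f' g = f 1 * g 1 - f (-1) * g (-1) - inner f g'.
Proof.
move=> df dg cf' cg'.
have d : derI (f * g)%R (fun x => f' x * g x + f x * g' x).
  move=> x Ix; have ? := df x Ix; have ? := dg x Ix.
  exact: dM.
have cf := derI_cont df; have cg := derI_cont dg.
have := Rintegral_derI d (contID (contIM cf' cg) (contIM cf cg')).
rewrite RintegralD//; first last.
- exact/contI_integrable/contIM.
- exact/contI_integrable/contIM.
- exact: measurable_I11.
by rewrite !fctE => <-; rewrite /inner; ring.
Qed.

Lemma derI_MVT f g x y : derI f g -> -1 <= x -> x <= y -> y <= 1 ->
  exists2 c, x <= c <= y & f y - f x = g c * (y - x).
Proof.
move=> fg x1 xy y1.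
have sub z : x <= z <= y -> I11 z.
  by move=> /andP[? ?]; apply/I11P; apply/andP; split; lra.
have [||c cxy E] := @MVT_segment _ f g x y xy.
- by move=> z; rewrite in_itv/= => /andP[? ?]; apply: fg; apply: sub; lra.
- apply: continuous_in_subspaceT => z; rewrite inE/= in_itv/= => zxy.
  exact/(derI_cont fg)/sub.
by exists c => //; rewrite in_itv in cxy.
Qed.

Lemma derI_le f g x y : derI f g -> (forall x, I11 x -> 0 <= g x) ->
  -1 <= x -> x <= y -> y <= 1 -> f x <= f y.
Proof.
move=> fg g0 x1 xy y1; have [c /andP[xc cy] E] := derI_MVT fg x1 xy y1.
rewrite -subr_ge0 E mulr_ge0 ?subr_ge0//; apply: g0.
by apply/I11P; apply/andP; split; lra.
Qed.

(** The nearest-point projection of the line onto [-1, 1], written with absolute values so that its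
    continuity is immediate. *)
Definition clampI x : R := (`|x + 1| - `|x - 1|) / 2.

Lemma clampI_id x : I11 x -> clampI x = x.
Proof.
move=> /I11P/andP[? ?]; rewrite /clampI ger0_norm ?ler0_norm; lra.
Qed.

Lemma clampI_I11 x : I11 (clampI x).
Proof.
apply/I11P; rewrite /clampI; case: (ger0P (x + 1)) => ?; case: (ger0P (x - 1)) => ?;
  apply/andP; split; lra.
Qed.

Lemma clampI_continuous : continuous clampI.
Proof.
move=> x; rewrite /clampI.
have cn (c : R) : {for x, continuous (fun x => `|x + c|)}.
  apply: (@continuous_comp _ _ _ (fun x => x + c) (fun x => `|x|)).
    by apply: continuousD; [exact: cvg_id|exact: cst_continuous].
  exact: norm_continuous.
apply: (@continuousM _ _ (fun x => `|x + 1| - `|x - 1|) (fun=> 2^-1)).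
  by apply: continuousB; exact: cn.
exact: cst_continuous.
Qed.

Lemma primitive f : contI f -> exists F, derI F f /\ F (-1) = 0.
Proof.
move=> cf; pose ft := f \o clampI.
have cft : continuous ft.
  move=> x; apply: continuous_comp; first exact: clampI_continuous.
  exact/cf/clampI_I11.
(* Integration of the constant extension from -2 makes -1 and 1 interior points, so the derivatives
   there are two-sided. *)
pose F0 x := \int[mu]_(t in `[-2, x]) ft t.
have dF0 : derI F0 ft.
  move=> x /I11P/andP[x1 x2].
  have lt2 : x < 2 by lra.
  have gt2 : -2 < x by lra.
  have ift : mu.-integrable `[-2, 2] (EFin \o ft).
    apply: continuous_compact_integrable; first exact: segment_compact.
    exact: continuous_subspaceT.
  have [d1 d2] := continuous_FTC1_closed lt2 ift gt2 (cft x).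
  by split; [exact: d1|rewrite -derive1E; exact: d2].
exists (fun x => F0 x - F0 (-1)); split; last by rewrite subrr.
move=> x Ix; have := dF0 x Ix => ?.
have -> : f x = ft x by rewrite /ft /= clampI_id.
by deriv; rewrite addr0.
Qed.

(** At an end point f is known to vanish on one side only. If g did not vanish at x, it would have
    no zero on a short interval of [-1, 1] adjacent to x, against the mean value theorem. *)
Lemma derI_eq0 f g : derI f g -> contI g -> (forall x, I11 x -> f x = 0) ->
  forall x, I11 x -> g x = 0.
Proof.
move=> fg cg f0 x Ix; apply/eqP/negPn/negP => gx0.
have : \forall z \near x, g z != 0.
  exact: (cvgr_neq0 (g x) (cg x Ix) gx0).
move=> /nbhs_ballP[e /= e0 eB].
pose d := Num.min e 1 / 2.
have d0 : 0 < d by rewrite divr_gt0// lt_min e0 ltr01.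
have de : d < e by rewrite /d ltr_pdivrMr// gt_min; apply/orP; left; lra.
have d1 : d < 1 by rewrite /d ltr_pdivrMr// gt_min; apply/orP; right; lra.
have [a [b [a1 ab b1 abx]]] : exists a b, [/\ -1 <= a, a < b, b <= 1 &
    forall z, a <= z <= b -> `|x - z| < e].
  case/I11P/andP: Ix => x1 x2; have [x0|x0] := leP x 0.
    exists x, (x + d); split; [lra..|] => z /andP[? ?].
    by rewrite ler0_norm; lra.
  exists (x - d), x; split; [lra..|] => z /andP[? ?].
  by rewrite ger0_norm; lra.
have [c cab] := derI_MVT fg a1 (ltW ab) b1.
have /andP[? ?] := cab.
rewrite !f0 ?subrr; [|apply/I11P; apply/andP; split; lra..].
move=> /esym/eqP; rewrite mulf_eq0 subr_eq0 (gt_eqF ab) orbF.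
by have := eB c (abx c cab); rewrite /= => /negbTE ->.
Qed.

(** The primitive of f^2 is monotone and vanishes at both ends, hence vanishes identically, and so
    does its derivative. *)
Lemma inner_eq0 f : contI f -> inner f f = 0 -> forall x, I11 x -> f x = 0.
Proof.
move=> cf f0 x Ix.
have [Q [dQ Q1]] := primitive (contIM cf cf).
have Qe : Q 1 = 0.
  by rewrite -f0 /inner (Rintegral_derI dQ (contIM cf cf)) Q1 subr0.
have g0 z : I11 z -> 0 <= f z * f z by rewrite -expr2 sqr_ge0.
have Q0 z : I11 z -> Q z = 0.
  move=> /I11P/andP[z1 z2]; apply/eqP; rewrite eq_le.
  by rewrite -{1}Qe (derI_le dQ g0 z1 z2)// -{1}Q1 (derI_le dQ g0 _ z1).
have /eqP := derI_eq0 dQ (contIM cf cf) Q0 Ix.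
by rewrite -expr2 sqrf_eq0 => /eqP.
Qed.

(** This is Cauchy-Schwarz on [-1, x] without integrals over subintervals: 2 |y'| <= e y'^2 + 1 / e
    makes e Q + (x + 1) / e -+ 2 y nondecreasing, where Q is a primitive of y'^2, and e is chosen at
    the end. *)
Lemma sup_bound y y' x : derI y y' -> contI y' -> y (-1) = 0 -> I11 x ->
  y x ^+ 2 <= 2 * inner y' y'.
Proof.
move=> dy cy' y1 Ix.
have [Q [dQ Q1]] := primitive (contIM cy' cy').
have Q1E : inner y' y' = Q 1 by rewrite /inner (Rintegral_derI dQ (contIM cy' cy')) Q1 subr0.
have QX : Q x <= Q 1.
  case/I11P/andP: Ix => ? ?.
  by apply: (derI_le dQ) => // z _; rewrite -expr2 sqr_ge0.
have key (s : bool) e : 0 < e -> 2 * ((-1) ^+ s * y x) <= e * Q x + 2 / e.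
  move=> e0; pose sg : R := (-1) ^+ s.
  have sg2 : sg * sg = 1 by rewrite -expr2 /sg sqrr_sign.
  have d : derI (fun x => e * Q x + (x + 1) / e - 2 * (sg * y x))
            (fun x => e * (y' x - sg / e) ^+ 2).
    move=> z Iz; have ? := dQ z Iz; have ? := dy z Iz.
    by deriv; have e00 := lt0r_neq0 e0; field: sg2.
  have h1 : forall z, I11 z -> 0 <= e * (y' z - sg / e) ^+ 2.
    by move=> z _; rewrite mulr_ge0 ?sqr_ge0 ?ltW.
  case/I11P/andP: (Ix) => x1 x2.
  have h := derI_le d h1 (lexx _) x1 x2.
  rewrite Q1 y1 addNr mul0r !mulr0 addr0 subr0 in h.
  have : (x + 1) / e <= 2 / e by rewrite ler_pM2r ?invr_gt0//; lra.
  by rewrite /sg in h *; lra.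
rewrite Q1E; apply: le_trans (_ : 2 * Q x <= _); last by lra.
have abs e : 0 < e -> 2 * `|y x| <= e * Q x + 2 / e.
  move=> e0; case: (ger0P (y x)) => _; first by have := key false e e0; rewrite expr0 mul1r.
  by have := key true e e0; rewrite expr1 mulN1r.
have [->|yn0] := eqVneq (y x) 0.
  rewrite expr0n /= mulr_ge0//; apply: le_trans (_ : Q (-1) <= _); first by rewrite Q1.
  case/I11P/andP: Ix => ? ?.
  by apply: (derI_le dQ) => // z _; rewrite -expr2 sqr_ge0.
have yp : 0 < `|y x| by rewrite normr_gt0.
(* This e turns [2 / e] into |y x|, which is absorbed on the left. *)
have := abs (2 / `|y x|) (divr_gt0 (ltr0Sn _ _) yp).
rewrite invf_div mulrCA divff// mulr1 => h.
have {}h : `|y x| <= 2 / `|y x| * Q x by lra.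
have := ler_wpM2r (ltW yp) h.
rewrite -expr2 real_normK ?num_real//.
by rewrite mulrAC divfK ?normr_eq0//.
Qed.

Lemma inner_le_sup f (M : R) : contI f -> (forall x, I11 x -> f x ^+ 2 <= M) ->
  inner f f <= 2 * M.
Proof.
move=> cf fM; have := @le_Rintegral _ _ _ mu I11 (fun x => f x * f x) (fun=> M).
move=> /(_ measurable_I11 (contI_integrable (contIM cf cf)) (contI_integrable (@contI_cst M))).
move=> h; apply: le_trans (h _) _; first by move=> x Ix; rewrite -expr2 fM.
have d : derI (fun x => M * x) (fun=> M).
  by move=> x _; deriv; ring.
by rewrite (Rintegral_derI d (@contI_cst M)); lra.
Qed.

End Calculus.

(** * Uniform cluster points of bounded equi-Lipschitz sequences *)

Section ArzelaAscoli.
Context {R : realType}.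
Implicit Types (f : nat -> R -> R) (x : R).

(** The values stay in a compact segment, and a cluster point of an ultrafilter is a limit. This
    replaces the extraction of diagonal subsequences. *)
Lemma ultra_limit (U : set_system nat) (a : nat -> R) (M : R) :
  UltraFilter U -> (forall n, `|a n| <= M) ->
  exists l, forall e : R, 0 < e -> U [set n | `|a n - l| < e].
Proof.
move=> UU aM.
have FU : ProperFilter (a @ U) by apply: fmap_proper_filter; exact: ultra_proper.
have [|l [_ cl]] := @segment_compact R (- M) M _ FU.
  apply: (@filterS _ U _ setT) => [n _ /=|]; last exact: filterT.
  by rewrite in_itv /= -ler_norml.
exists l => e e0.
have [//|UC] := in_ultra_setVsetC [set n | `|a n - l| < e] UU.
have [|y [/= ye]] := cl [set y | e <= `|y - l|] (ball l e) _ (nbhsx_ballx l e e0).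
  change (U (a @^-1` [set y | e <= `|y - l|])).
  by apply: filterS UC => n h /=; have [/h|] := ltP `|a n - l| e.
by rewrite /ball /= distrC ltNge ye.
Qed.

(** An ultrafilter finer than the one at infinity yields pointwise limits everywhere at once. The
    limit inherits the Lipschitz bound, and closeness on a finite net spreads to the whole
    interval. *)
Lemma lipschitz_cluster f (M L : R) : 0 <= L ->
  (forall n x, I11 x -> `|f n x| <= M) ->
  (forall n x y, I11 x -> I11 y -> `|f n x - f n y| <= L * `|x - y|) ->
  exists v, contI v /\ forall (e : R) N, 0 < e -> exists2 n, (N <= n)%N &
     forall x, I11 x -> `|f n x - v x| <= e.
Proof.
move=> L0 fM fL.
have [U [UU oU]] := @ultraFilterLemma nat \oo _.
have PU : ProperFilter U := ultra_proper.
have lim x : exists l, forall e : R, 0 < e -> U [set n | `|f n (clampI x) - l| < e].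
  by apply: (@ultra_limit U _ M) => n; exact/fM/clampI_I11.
have [v vP] := choice lim.
have vL x y : I11 x -> I11 y -> `|v x - v y| <= L * `|x - y|.
  move=> Ix Iy; apply/ler_addgt0Pr => e e0.
  have e20 : 0 < e / 2 by rewrite divr_gt0.
  have [n /= [h1 h2]] := filter_ex (filterI (vP x _ e20) (vP y _ e20)).
  rewrite !clampI_id// in h1 h2.
  have := fL n x y Ix Iy.
  rewrite (_ : v x - v y = (f n x - f n y) - (f n x - v x) + (f n y - v y)); last by ring.
  have := ler_normD (f n x - f n y - (f n x - v x)) (f n y - v y).
  have := ler_normB (f n x - f n y) (f n x - v x).
  lra.
have vc x : v x = v (clampI x).
  apply/eqP; rewrite -subr_eq0 -normr_le0; apply/ler_addgt0Pr => e e0.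
  have e20 : 0 < e / 2 by rewrite divr_gt0.
  have [n /= [h1 h2]] := filter_ex (filterI (vP x _ e20) (vP (clampI x) _ e20)).
  rewrite (clampI_id (clampI_I11 x)) in h2.
  have := ler_normB (f n (clampI x) - v (clampI x)) (f n (clampI x) - v x).
  rewrite (_ : _ - _ - _ = v x - v (clampI x)); last by ring.
  lra.
exists v; split.
  move=> x Ix; apply/cvgrPdist_le => e e0.
  have L1 : 0 < L + 1 by lra.
  have := @clampI_continuous R x.
  move=> /cvgrPdist_le /(_ (e / (L + 1))); rewrite divr_gt0// => /(_ isT).
  apply: filterS => t h; rewrite vc (vc t).
  apply: le_trans (vL _ _ (clampI_I11 _) (clampI_I11 _)) _.
  have := ler_wpM2l L0 h.
  move=> /le_trans; apply; rewrite mulrCA ger_pMr// ler_pdivrMr//; lra.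
move=> e N e0.
(* The net is k / (K + 1) - 1 for k from 0 to 2 (K + 1), both ends included. With this mesh the two
   Lipschitz errors add up to at most e / 2, and the error at the net point is below e / 2. *)
pose K := Num.truncn (4 * L / e).
have K1 : 2 * L / K.+1%:R <= e / 2.
  have : 4 * L / e < K.+1%:R by apply: truncnS_gt.
  rewrite ltr_pdivrMr// => h.
  by rewrite ler_pdivrMr// ?ltr0Sn//; lra.
pose pt (k : 'I_(2 * K.+1).+1) := clampI (k%:R / K.+1%:R - 1 : R).
have e20 : 0 < e / 2 by rewrite divr_gt0.
have net : U [set n | forall k : 'I_(2 * K.+1).+1, `|f n (pt k) - v (pt k)| < e / 2].
  apply: (@filter_forall _ _ (fun k n => `|f n (pt k) - v (pt k)| < e / 2) U) => k.
  have := vP (pt k) _ e20.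
  by rewrite (clampI_id (clampI_I11 _)).
have [n /= [h1 h2]] := filter_ex (filterI net (oU _ (nbhs_infty_ge N))).
exists n => // x Ix.
have /andP[x1 x2] := (I11P x).1 Ix.
have K0 : 0 < K.+1%:R :> R by rewrite ltr0Sn.
have t0 : 0 <= (x + 1) * K.+1%:R by rewrite mulr_ge0//; lra.
have /andP[k1 k2] := truncn_itv t0.
have kb : (Num.truncn ((x + 1) * K.+1%:R) < (2 * K.+1).+1)%N.
  rewrite ltnS -(ler_nat R); apply: le_trans k1 _.
  by rewrite natrM ler_pM2r//; lra.
pose k := Ordinal kb.
pose u : R := k%:R / K.+1%:R.
have kx : u <= x + 1 by rewrite ler_pdivrMr.
have kx2 : x + 1 < u + K.+1%:R^-1.
  by rewrite -[X in _ < _ + X]div1r -mulrDl natr1 ltr_pdivlMr.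
have k0 : 0 <= u by rewrite divr_ge0 ?ler0n ?ltW.
have ptE : pt k = clampI (u - 1) by [].
move: kx kx2 k0 ptE; move: K.+1%:R^-1 K1 => w K1 kx kx2 k0 ptE; clearbody u.
have Ik : I11 (u - 1) by move: kx k0 x2; clear; move=> *; apply/I11P; apply/andP; split; lra.
have d : `|x - pt k| <= w.
  by rewrite ptE (clampI_id Ik) ger0_norm; move: kx kx2; clear; lra.
have Ipt : I11 (pt k) by exact: clampI_I11.
have := h1 k; have := fL n x _ Ix Ipt; have := vL _ _ Ipt Ix.
rewrite (distrC (pt k)).
have := ler_wpM2l L0 d.
have := ler_normD (f n x - f n (pt k) + (f n (pt k) - v (pt k))) (v (pt k) - v x).
have := ler_normD (f n x - f n (pt k)) (f n (pt k) - v (pt k)).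
rewrite (_ : f n x - f n (pt k) + (f n (pt k) - v (pt k)) + (v (pt k) - v x) = f n x - v x); last by ring.
lra.
Qed.

End ArzelaAscoli.

(** * Completeness for the clamped operator - D^6 *)

Section ClampedProblem.
Context {R : realType}.
Implicit Types (f g h : R -> R) (Y Z : nat -> R -> R) (x : R).

(** A function is carried together with its derivatives up to order 6, so that integration by parts
    needs no iterated derivative operator. *)
Definition clamped Y := [/\ forall k, (k < 6)%N -> derI (Y k) (Y k.+1),
  contI (Y 6%N) & forall k, (k < 3)%N -> Y k 1 = 0 /\ Y k (-1) = 0].

Definition sol f Y := clamped Y /\ forall x, I11 x -> Y 6%N x = - f x.

Lemma clamped_cont Y k : clamped Y -> (k <= 6)%N -> contI (Y k).
Proof.
move=> [dY c6 _]; rewrite leq_eqVlt => /predU1P[->//|k6].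
exact: derI_cont (dY k k6).
Qed.

Lemma clamped_lin Y Z (a b : R) : clamped Y -> clamped Z ->
  clamped (fun k x => a * Y k x + b * Z k x).
Proof.
move=> [dY cY bY] [dZ cZ bZ]; split.
- move=> k k6 x Ix; have ? := dY k k6 x Ix; have ? := dZ k k6 x Ix.
  by deriv; ring.
- by apply: contID; apply: contIZ.
- move=> k k3; have [-> ->] := bY k k3; have [-> ->] := bZ k k3.
  by rewrite !mulr0 addr0.
Qed.

Lemma sol_lin f g Y Z (a b : R) : sol f Y -> sol g Z ->
  sol (fun x => a * f x + b * g x) (fun k x => a * Y k x + b * Z k x).
Proof.
move=> [cY Yf] [cZ Zg]; split; first exact: clamped_lin.
by move=> x Ix; rewrite Yf// Zg//; ring.
Qed.

(** Three integrations by parts; every boundary term contains some Z k with k < 3. *)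
Lemma clamped_parts Y Z : clamped Y -> clamped Z ->
  inner (Y 6%N) (Z 0%N) = - inner (Y 3%N) (Z 3%N).
Proof.
move=> CY CZ; have [dY _ _] := CY; have [dZ _ bZ] := CZ.
have P k l : (k < 6)%N -> (l < 3)%N ->
    inner (Y k.+1) (Z l) = - inner (Y k) (Z l.+1).
  move=> k6 l3; have l6 : (l < 6)%N by exact: leq_trans l3 _.
  rewrite (inner_by_parts (dY k k6) (dZ l l6)); last 2 first.
  - exact: clamped_cont.
  - exact: clamped_cont.
  by have [-> ->] := bZ l l3; rewrite !mulr0 subr0 sub0r.
by rewrite P// P// P// opprK.
Qed.

Lemma sol_inner f g Y Z : sol f Y -> sol g Z ->
  inner f (Z 0%N) = inner (Y 3%N) (Z 3%N).
Proof.
move=> [CY Yf] [CZ _]; rewrite -[RHS]opprK -(clamped_parts CY CZ).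
rewrite -mulN1r -innerZl; first last.
- exact/contI_inL2/clamped_cont.
- exact/contI_inL2/clamped_cont.
by apply: eq_inner => // x Ix; rewrite Yf// mulN1r opprK.
Qed.

(** Symmetry of the solution operator K that sends f to [Y 0]; [sol_inner] moreover shows that K is
    positive. *)
Lemma sol_sym f g Y Z : sol f Y -> sol g Z -> inner f (Z 0%N) = inner (Y 0%N) g.
Proof.
by move=> SY SZ; rewrite (sol_inner SY SZ) (innerC _ g) (sol_inner SZ SY) innerC.
Qed.

(** The Poincare inequality, applied three times, gives |Y|^2 <= 64 |Y'''|^2 for the L^2 norms. As
    |Y'''|^2 = <f, Y>, Cauchy-Schwarz gives |Y'''|^2 <= 64 |f|^2, and 2048 = 2 * 4^2 * 64. *)
Lemma sol_bound f Y x : contI f -> sol f Y -> I11 x ->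
  Y 0%N x ^+ 2 <= 2048 * inner f f /\ Y 1%N x ^+ 2 <= 2048 * inner f f.
Proof.
move=> cf SY Ix; have [CY Yf] := SY; have [dY _ bY] := CY.
have sup k z : (k < 3)%N -> I11 z ->
    Y k z ^+ 2 <= 2 * inner (Y k.+1) (Y k.+1).
  move=> k3 Iz; have k6 : (k < 6)%N by exact: leq_trans k3 _.
  apply: (sup_bound (dY k k6)) => //; first exact: clamped_cont.
  by have [] := bY k k3.
have step k : (k < 3)%N -> inner (Y k) (Y k) <= 4 * inner (Y k.+1) (Y k.+1).
  move=> k3; apply: le_trans (inner_le_sup _ (fun z => sup k z k3)) _.
    by apply: clamped_cont => //; exact: ltnW (leq_trans k3 _).
  by lra.
have s0 := step 0%N isT; have s1 := step 1%N isT; have s2 := step 2%N isT.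
have n3 : inner (Y 3%N) (Y 3%N) <= 64 * inner f f.
  have := cauchy_schwarz_sqr (contI_inL2 cf) (contI_inL2 (clamped_cont CY (leq0n 6))).
  rewrite (sol_inner SY SY).
  have := inner_ge0 f; have := inner_ge0 (Y 3%N).
  have := inner_ge0 (Y 0%N); rewrite /= in s0 s1 s2.
  move: s0 s1 s2; set n0 := inner (Y 0%N) _; set n1 := inner (Y 1%N) _.
  set n2 := inner (Y 2%N) _; set n3 := inner (Y 3%N) _; set nf := inner f f.
  move=> s0 s1 s2 p0 p3 pf h.
  have [-> |n3n0] := eqVneq n3 0; first by lra.
  have n3p : 0 < n3 by rewrite lt0r n3n0.
  rewrite -(ler_pM2r n3p) -expr2; apply: le_trans h _.
  rewrite (mulrC 64) -mulrA; apply: ler_wpM2l => //; lra.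
have b0 := sup 0%N x isT Ix; have b1 := sup 1%N x isT Ix.
by have := inner_ge0 f; split; lra.
Qed.

Lemma sol_le : exists2 C : R, 0 < C & forall f Y, contI f -> sol f Y ->
  [/\ nrm (Y 0%N) <= C * nrm f, forall x, I11 x -> `|Y 0%N x| <= C * nrm f &
   forall x, I11 x -> `|Y 1%N x| <= C * nrm f].
Proof.
(* 64^2 = 2 * 2048, the factor 2 being the length of the interval. *)
exists 64; first exact: ltr0Sn.
move=> f Y cf SY.
have F0 := inner_ge0 f.
have p0 : 0 <= 64 * nrm f by rewrite mulr_ge0 ?nrm_ge0 ?ler0n.
have le t : t ^+ 2 <= 4096 * inner f f -> `|t| <= 64 * nrm f.
  move=> h; rewrite -(@ler_pXn2r _ 2) ?nnegrE ?normr_ge0//.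
  rewrite real_normK ?num_real// exprMn nrm2; apply: le_trans h _.
  by move: F0; clear; lra.
split.
- rewrite -(ger0_norm (nrm_ge0 _)); apply: le; rewrite nrm2.
  apply: le_trans (inner_le_sup (clamped_cont SY.1 (leq0n 6)) _) _.
    by move=> x Ix; have [h _] := sol_bound cf SY Ix; exact: h.
  by move: F0; clear; lra.
- move=> x Ix; apply: le; have [h _] := sol_bound cf SY Ix.
  by move: F0 h; clear; lra.
- move=> x Ix; apply: le; have [_ h] := sol_bound cf SY Ix.
  by move: F0 h; clear; lra.
Qed.

(** Sixfold primitives from -1 satisfy the conditions at -1. Subtracting a (x + 1)^3 + b (x + 1)^4 +
    c (x + 1)^5 preserves these and the sixth derivative, and leaves three parameters for the three
    conditions at 1. *)
Lemma sol_exists f : contI f -> exists Y, sol f Y.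
Proof.
move=> cf.
have [P5 [d5 e5]] := primitive (contIN cf).
have [P4 [d4 e4]] := primitive (derI_cont d5).
have [P3 [d3 e3]] := primitive (derI_cont d4).
have [P2 [d2 e2]] := primitive (derI_cont d3).
have [P1 [d1 e1]] := primitive (derI_cont d2).
have [P0 [d0 e0]] := primitive (derI_cont d1).
pose a := (10 * P0 1 - 8 * P1 1 + 2 * P2 1) / 8.
pose b := (- 15 * P0 1 + 14 * P1 1 - 4 * P2 1) / 16.
pose c := (6 * P0 1 - 6 * P1 1 + 2 * P2 1) / 32.
pose Y k x := match k with
  | 0 => P0 x - (a * (x + 1) ^+ 3 + b * (x + 1) ^+ 4 + c * (x + 1) ^+ 5)
  | 1 => P1 x - (3 * a * (x + 1) ^+ 2 + 4 * b * (x + 1) ^+ 3 + 5 * c * (x + 1) ^+ 4)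
  | 2 => P2 x - (6 * a * (x + 1) + 12 * b * (x + 1) ^+ 2 + 20 * c * (x + 1) ^+ 3)
  | 3 => P3 x - (6 * a + 24 * b * (x + 1) + 60 * c * (x + 1) ^+ 2)
  | 4 => P4 x - (24 * b + 120 * c * (x + 1))
  | 5 => P5 x - 120 * c
  | _ => - f x
  end.
exists Y; split; last by [].
split.
- move=> k k6 x Ix.
  have ? := d5 x Ix; have ? := d4 x Ix; have ? := d3 x Ix.
  have ? := d2 x Ix; have ? := d1 x Ix; have ? := d0 x Ix.
  by do 6! (case: k k6 => [_|k k6 //]; first by rewrite /Y; deriv; ring).
- exact: contIN.
- move=> k k3; do 3! (case: k k3 => [_|k k3 //]; first by
    rewrite /Y /a /b /c ?e0 ?e1 ?e2; split; field).
Qed.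


Lemma sol_comb2 f g Y Z (a b : R) : sol f Y -> sol g Z ->
  sol (fun x => a * f x - b * g x) (fun k x => a * Y k x - b * Z k x).
Proof.
move=> SY SZ; have := sol_lin a (- b) SY SZ.
have E (h k : R -> R) : (fun x => a * h x + - b * k x) = (fun x => a * h x - b * k x).
  by apply/funext => x; rewrite mulNr.
rewrite E; congr sol; apply/funext => k; exact: E.
Qed.

Lemma solB f g Y Z : sol f Y -> sol g Z ->
  sol (fun x => f x - g x) (fun k x => Y k x - Z k x).
Proof.
move=> SY SZ; have := sol_comb2 1 1 SY SZ.
have E (h k : R -> R) : (fun x => 1 * h x - 1 * k x) = (fun x => h x - k x).
  by apply/funext => x; rewrite !mul1r.
rewrite E; congr sol; apply/funext => k; exact: E.
Qed.

Lemma solZ f Y (a : R) : sol f Y -> sol (fun x => a * f x) (fun k x => a * Y k x).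
Proof.
move=> SY; have := sol_comb2 a 0 SY SY.
have E (h : R -> R) : (fun x => a * h x - 0 * h x) = (fun x => a * h x).
  by apply/funext => x; rewrite mul0r subr0.
rewrite E; congr sol; apply/funext => k; exact: E.
Qed.

Lemma sol_neq0 f Y : contI f -> sol f Y -> 0 < nrm f -> 0 < nrm (Y 0%N).
Proof.
move=> cf [[dY cY bY] Yf] f0; rewrite lt0r nrm_ge0 andbT; apply/eqP => Y0.
have z k : (k <= 6)%N -> forall x, I11 x -> Y k x = 0.
  elim: k => [_|k IHk k6].
    apply: (inner_eq0 (derI_cont (dY 0%N isT))).
    by rewrite -nrm2 Y0 expr0n.
  apply: (derI_eq0 (dY k k6)); first exact: clamped_cont (And3 dY cY bY) _.
  exact/IHk/ltnW.
suff : nrm f = 0 by move=> E; rewrite E ltxx in f0.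
rewrite /nrm (@eq_inner _ _ (fun=> 0) _ f) ?inner0l ?sqrtr0// => x Ix.
by apply/eqP; rewrite -oppr_eq0 -Yf// z.
Qed.

Lemma nrm_le_sup f (e : R) : 0 <= e -> contI f ->
  (forall x, I11 x -> `|f x| <= e) -> nrm f <= 2 * e.
Proof.
move=> e0 cf fe.
have e20 : 0 <= 2 * e by rewrite mulr_ge0.
rewrite -(@ler_pXn2r _ 2) ?nnegrE ?nrm_ge0// nrm2.
apply: le_trans (inner_le_sup (M := e ^+ 2) cf _) _.
  move=> x Ix; rewrite -[X in X <= _]real_normK ?num_real//.
  by rewrite ler_pXn2r ?nnegrE//; exact: fe.
by have := sqr_ge0 e; rewrite exprMn; clear; lra.
Qed.

(* Power iteration: the normalized iterates of the solution operator K cluster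
   at an eigenfunction of K ^ 2. *)
Lemma power_iteration f : contI f -> 0 < nrm f ->
  exists v V W (Q : R), [/\ 0 < Q, contI v, 0 < nrm v, sol v V & sol (V 0%N) W] /\
    (forall x, I11 x -> W 0%N x = Q * v x) /\
    forall E (l : R), sol (fun x => l * E 0%N x) E -> l != 0 ->
      inner f (E 0%N) = 0 -> inner v (E 0%N) = 0.
Proof.
move=> cf f_gt0.
have [C C0 solC] := sol_le.
have [K solK] : exists K : (R -> R) -> nat -> R -> R,
    forall g, contI g -> sol g (K g).
  have /choice[K HK] : forall g, exists Y, contI g -> sol g Y.
    move=> g; have [cg|ncg] := pselect (contI g); last by exists (fun _ _ => 0).
    by have [Y SY] := sol_exists cg; exists Y.
  by exists K.
pose fs n := iter n (fun g => K g 0%N) f.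
have cfs n : contI (fs n).
  by elim: n => // n IH; exact: clamped_cont (solK _ IH).1 _.
have Lfs n := contI_inL2 (cfs n).
have Sfs n : sol (fs n) (K (fs n)) by exact: solK.
have shift n m : inner (fs n.+1) (fs m) = inner (fs n) (fs m.+1).
  by rewrite (sol_sym (Sfs n) (Sfs m)).
have N1 n : inner (fs n.+2) (fs n) = nrm (fs n.+1) ^+ 2 by rewrite nrm2 shift.
have N_gt0 n : 0 < nrm (fs n).
  by elim: n => // n IH; exact: sol_neq0 (cfs n) (Sfs n) IH.
have N_le n : nrm (fs n.+1) <= C * nrm (fs n).
  by have [] := solC _ _ (cfs n) (Sfs n).
pose q n := (nrm (fs n.+1) / nrm (fs n)) ^+ 2.
have q_gt0 n : 0 < q n by rewrite exprn_gt0// divr_gt0.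
have C2 : 0 <= C ^+ 2 by exact: sqr_ge0.
have q_le n : q n <= C ^+ 2.
  rewrite ler_pXn2r ?nnegrE ?(ltW C0)//; last by rewrite ltW// divr_gt0.
  by rewrite ler_pdivrMr.
(* The norms of the iterates are log-convex: |f_(n+1)|^2 = <f_(n+2), f_n> <= |f_(n+2)| |f_n| by
   symmetry and Cauchy-Schwarz. *)
have q_nd : nondecreasing_seq q.
  apply/nondecreasing_seqP => n; rewrite ler_pXn2r ?nnegrE ?divr_ge0 ?nrm_ge0//.
  rewrite ler_pdivrMr// mulrAC ler_pdivlMr// -expr2 -N1.
  by apply: le_trans (ler_norm _) (cauchy_schwarz (Lfs n.+2) (Lfs n)).
have q_cvg : cvgn q.
  by apply: nondecreasing_is_cvgn => //; exists (C ^+ 2) => _ [n _ <-].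
pose Q := limn q.
have qQ n : q n <= Q by exact: nondecreasing_cvgn_le.
have Q_gt0 : 0 < Q by exact: lt_le_trans (q_gt0 0%N) (qQ 0%N).
pose c n := (nrm (fs n))^-1.
have c_gt0 n : 0 < c n by rewrite invr_gt0.
(* Division by the norm two steps earlier leaves two applications of K, hence bounds by C^2 for the
   values and for the derivative. *)
pose z n x := c n * fs n.+2 x.
have cz n : contI (z n) by exact: contIZ.
have zbound n t : `|t| <= C * nrm (fs n.+1) -> `|c n * t| <= C ^+ 2.
  move=> h; rewrite normrM (gtr0_norm (c_gt0 n)) mulrC ler_pdivrMr//.
  by apply: le_trans h _; rewrite expr2 -mulrA ler_pM2l.
have [v [cv vlim]] : exists v, contI v /\ forall (e : R) M, 0 < e ->
    exists2 n, (M <= n)%N & forall x, I11 x -> `|z n x - v x| <= e.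
  apply: (@lipschitz_cluster _ z _ _ C2).
    move=> n x Ix; apply: zbound; have [_ h _] := solC _ _ (cfs n.+1) (Sfs n.+1).
    exact: h.
  move=> n x y; wlog xy : x y / x <= y.
    move=> H Ix Iy; have [xy|/ltW yx] := leP x y; first exact: H.
    by rewrite distrC (distrC x); exact: H.
  move=> /I11P/andP[x1 x2] /I11P/andP[y1 y2].
  have [[dY _ _] _] := Sfs n.+1.
  have [t /andP[xt ty] E] := derI_MVT (dY 0%N isT) x1 xy y2.
  rewrite distrC /z -mulrBr E mulrA normrM (distrC x); apply: ler_wpM2r => //.
  apply: zbound; have [_ _ h] := solC _ _ (cfs n.+1) (Sfs n.+1).
  by apply: h; move: x1 xt ty y2; clear; move=> *; apply/I11P; apply/andP; split; lra.
have Lv := contI_inL2 cv; have Lz n := contI_inL2 (cz n).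
have vz (e : R) M : 0 < e -> exists2 n, (M <= n)%N & nrm (fun x => z n x - v x) <= e.
  move=> e0; have e20 : 0 < e / 2 by rewrite divr_gt0.
  have [n Mn zn] := vlim (e / 2) M e20; exists n => //.
  rewrite (_ : e = 2 * (e / 2)); last by clear; field.
  by apply: nrm_le_sup => //; [exact: ltW|exact: contIB].
have SV := solK _ cv; set V := K v in SV.
have cV0 : contI (V 0%N) by exact: clamped_cont SV.1 _.
have SW := solK _ cV0; set W := K (V 0%N) in SW.
have cW0 : contI (W 0%N) by exact: clamped_cont SW.1 _.
(* This is (K^2 - Q) applied to the normalized iterate. By [nrmd] it tends to 0, because q n tends
   to Q. *)
pose d n x := c n * fs n.+2 x - Q * c n * fs n x.
have cd n : contI (d n) by apply: contIB; apply: contIZ.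
have nrmd n : nrm (d n) ^+ 2 <= 2 * Q * (Q - q n).
  have Lc m := inL2Z (c n) (Lfs m).
  have LQ := inL2Z (Q * c n) (Lfs n).
  rewrite nrm2 /d innerBl ?innerBr ?innerZl ?innerZr//; last exact: inL2B.
  rewrite (innerC (fs n)) !N1 -!nrm2.
  have -> : nrm (fs n.+2) ^+ 2 = q n.+1 * q n * nrm (fs n) ^+ 2.
    rewrite /q; move: (N_gt0 n) (N_gt0 n.+1); clear; move=> /lt0r_neq0 ? /lt0r_neq0 ?.
    by field; apply/andP.
  have -> : nrm (fs n.+1) ^+ 2 = q n * nrm (fs n) ^+ 2.
    by rewrite /q; move: (N_gt0 n); clear; move=> /lt0r_neq0 ?; field.
  have -> : c n * (c n * (q n.+1 * q n * nrm (fs n) ^+ 2)) -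
     c n * (Q * c n * (q n * nrm (fs n) ^+ 2)) -
     (Q * c n * (c n * (q n * nrm (fs n) ^+ 2)) -
     Q * c n * (Q * c n * nrm (fs n) ^+ 2)) = q n.+1 * q n - 2 * Q * q n + Q ^+ 2.
    rewrite /c; move: (N_gt0 n) (q n) (q n.+1); clear; move=> /lt0r_neq0 ? ? ?.
    by field.
  have := ler_pM (ltW (q_gt0 n.+1)) (ltW (q_gt0 n)) (qQ n.+1) (qQ n).
  by rewrite -expr2; clear; lra.
exists v, V, W, Q; split; last split.
- split=> //.
  (* The norm of [z n] is a product of two ratios, each at least the square root of q 0; so every z
     n has norm at least q 0, and v is nonzero. *)
  have [n _ hn] := vz (q 0%N / 2) 0%N (divr_gt0 (q_gt0 _) (ltr0Sn _ _)).
  have h1 : q 0%N <= nrm (z n).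
    rewrite nrmZ// (gtr0_norm (c_gt0 n)).
    have -> : c n * nrm (fs n.+2) = (nrm (fs n.+2) / nrm (fs n.+1)) * (nrm (fs n.+1) / nrm (fs n)).
      rewrite /c; move: (N_gt0 n) (N_gt0 n.+1); clear; move=> /lt0r_neq0 ? /lt0r_neq0 ?.
      by field; apply/andP.
    have h m : Num.sqrt (q 0%N) <= nrm (fs m.+1) / nrm (fs m).
      rewrite -[leRHS]ger0_norm ?divr_ge0 ?nrm_ge0// -sqrtr_sqr.
      by apply: ler_wsqrtr; exact: (q_nd 0%N m).
    rewrite -[leLHS]sqr_sqrtr ?(ltW (q_gt0 _))// expr2.
    by apply: ler_pM; rewrite ?sqrtr_ge0.
  have h2 : nrm (z n) <= nrm (fun x => z n x - v x) + nrm v.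
    rewrite (@eq_nrm _ (z n) (fun x => (z n x - v x) + v x)).
      exact: nrmD (inL2B (Lz n) Lv) Lv.
    by move=> x _; rewrite subrK.
  by move: (q_gt0 0%N) h1 h2 hn; clear; lra.
- move=> x Ix; apply/eqP; rewrite -subr_eq0; apply/eqP; move: x Ix.
  have cWq : contI (fun x => W 0%N x - Q * v x) by apply: contIB => //; exact: contIZ.
  apply: (inner_eq0 cWq); rewrite -nrm2; apply/eqP; rewrite sqrf_eq0.
  rewrite eq_le nrm_ge0 andbT; apply/ler_addgt0Pr => e e0; rewrite add0r.
  have CQ : 0 < C ^+ 2 + Q by rewrite ltr_pwDr.
  pose e1 := e / (2 * (C ^+ 2 + Q)); pose e2 := e / (2 * C ^+ 2).
  have e10 : 0 < e1 by rewrite divr_gt0// mulr_gt0.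
  have e20 : 0 < e2 by rewrite divr_gt0// mulr_gt0// exprn_gt0.
  have : \forall n \near \oo, Q - q n < e2 ^+ 2 / (2 * Q).
    have e30 : 0 < e2 ^+ 2 / (2 * Q) by rewrite divr_gt0 ?exprn_gt0// mulr_gt0.
    have /cvgrPdist_lt/(_ _ e30) := q_cvg.
    by apply: filterS => n; rewrite ger0_norm// subr_ge0; exact: qQ.
  move=> [M _ HM]; have [n Mn zn] := vz e1 M e10.
  have {}HM : nrm (d n) <= e2.
    rewrite -(@ler_pXn2r _ 2)// ?nnegrE ?nrm_ge0 ?(ltW e20)//.
    apply: le_trans (nrmd n) _.
    have := HM n Mn; rewrite /= ltr_pdivlMr ?mulr_gt0// => h.
    by rewrite ltW// mulrC.
  have solC2 g Y Z : contI g -> sol g Y -> sol (Y 0%N) Z -> nrm (Z 0%N) <= C ^+ 2 * nrm g.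
    move=> cg SY SZ; have cY : contI (Y 0%N) by exact: clamped_cont SY.1 _.
    have [h1 _ _] := solC _ _ cg SY; have [h2 _ _] := solC _ _ cY SZ.
    by apply: le_trans h2 _; rewrite expr2 -mulrA ler_pM2l.
  have Sd1 := sol_comb2 (c n) (Q * c n) (Sfs n.+2) (Sfs n).
  have Sd2 := sol_comb2 (c n) (Q * c n) (Sfs n.+3) (Sfs n.+1).
  have h2 := solC2 _ _ _ (cd n) Sd1 Sd2.
  have Sz1 := solB (solZ (c n) (Sfs n.+2)) SV.
  have Sz2 := solB (solZ (c n) (Sfs n.+3)) SW.
  have h4 := solC2 _ _ _ (contIB (cz n) cv) Sz1 Sz2.
  move: h2 h4.
  set F2 := fun x => _ - _; set F3 := fun x => _ - W 0%N x => h2 h4.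
  have LF2 : inL2 F2 by apply/contI_inL2; exact: clamped_cont Sd2.1 _.
  have LF3 : inL2 F3 by apply/contI_inL2; exact: clamped_cont Sz2.1 _.
  have LF0 : inL2 (fun x => z n x - v x) by exact: inL2B.
  have LF1 := inL2Z Q LF0.
  (* K^2 v - Q v = K^2 d_n - K^2 (z_n - v) + Q (z_n - v). The choice of e2 allots e / 2 to the first
     term, that of e1 allots e / 2 to the other two. *)
  rewrite (@eq_nrm _ _ (fun x => (F2 x - F3 x) + Q * (z n x - v x))); last first.
    move=> x _; rewrite /F2 /F3 /z /=.
    by ring.
  apply: le_trans (nrmD (inL2B LF2 LF3) LF1) _.
  have h5 := nrmB LF2 LF3.
  rewrite nrmZ// (gtr0_norm Q_gt0).
  have h6 := ler_wpM2l (ltW Q_gt0) zn.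
  have h7 := ler_wpM2l C2 zn.
  have h8 := ler_wpM2l C2 HM.
  have h9 : e1 * (C ^+ 2 + Q) = e / 2.
    by rewrite /e1; move: CQ; clear; move=> /lt0r_neq0 ?; field.
  have h10 : C ^+ 2 * e2 = e / 2.
    by rewrite /e2; move: C0; clear; move=> /lt0r_neq0 ?; field.
  move: h2 h4 h5 h6 h7 h8 h9 h10; clear; lra.
- move=> E l SE l0 fE.
  have cE : contI (E 0%N) by exact: clamped_cont SE.1 _.
  have LE := contI_inL2 cE.
  have fsE n : inner (fs n) (E 0%N) = 0.
    elim: n => // n IH; have := sol_sym (Sfs n) SE.
    rewrite IH innerZr//; last exact: (Lfs n.+1).
    by move/esym/eqP; rewrite mulf_eq0 (negPf l0) => /eqP.
  apply/eqP; rewrite -normr_le0; apply/ler_addgt0Pr => e e0; rewrite add0r.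
  have p0 : 0 < nrm (E 0%N) + 1 by rewrite ltr_wpDl// nrm_ge0.
  have [n _ hn] := vz (e / (nrm (E 0%N) + 1)) 0%N (divr_gt0 e0 p0).
  have : inner (fun x => z n x - v x) (E 0%N) = - inner v (E 0%N).
    by rewrite innerBl// /z innerZl// fsE mulr0 sub0r.
  rewrite -(normrN (inner v _)) => <-.
  apply: le_trans (cauchy_schwarz (inL2B (Lz n) Lv) LE) _.
  apply: le_trans (ler_wpM2r (nrm_ge0 _) hn) _.
  rewrite mulrAC ler_pdivrMr//; apply: ler_wpM2l; first exact: ltW.
  by rewrite lerDl.
Qed.

(** With r^2 = Q the operator K^2 - Q factors as (K - r) (K + r). So E = (K + r) v, up to the factor
    r, satisfies K E = r E and is orthogonal to v and to K v, hence to itself. Thus E = 0 and K v =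
    - r v, against the positivity of K. *)
Lemma clamped_complete f : contI f ->
  (forall (l : R) E, 0 < l -> clamped E ->
     (forall x, I11 x -> E 6%N x = - (l * E 0%N x)) -> inner f (E 0%N) = 0) ->
  forall x, I11 x -> f x = 0.
Proof.
move=> cf f_ort; apply: (inner_eq0 cf); rewrite -nrm2.
apply/eqP; rewrite sqrf_eq0 -[_ == _]negbK -[~~ (_ == _)]andbT -(nrm_ge0 f) -lt0r.
apply/negP => f_gt0.
have [v [V [W [Q [[Q_gt0 cv v_gt0 SV SW] [WE ort]]]]]] := power_iteration cf f_gt0.
have Lv := contI_inL2 cv.
have cV0 : contI (V 0%N) by exact: clamped_cont SV.1 _.
pose r := Num.sqrt Q.
have r0 : 0 < r by rewrite sqrtr_gt0.
have r2 : r * r = Q by rewrite -expr2 sqr_sqrtr// ltW.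
pose E k x := 1 * W k x + r * V k x.
have CE : clamped E := clamped_lin 1 r SW.1 SV.1.
have E0E x : I11 x -> E 0%N x = r * (V 0%N x + r * v x).
  by move=> Ix; rewrite /E WE// -r2; ring.
have E6 x : I11 x -> E 6%N x = - (r^-1 * E 0%N x).
  move=> Ix; rewrite E0E// /E SW.2// SV.2//.
  by rewrite mulrA mulVf ?lt0r_neq0//; ring.
have rV0 : 0 < r^-1 by rewrite invr_gt0.
have cE : contI (E 0%N) by exact: clamped_cont CE _.
have LE := contI_inL2 cE.
have SE : sol (fun x => r^-1 * E 0%N x) E by split.
have vE : inner v (E 0%N) = 0.
  by apply: (ort E r^-1) => //; [exact: lt0r_neq0|exact: f_ort rV0 CE E6].
have VE : inner (V 0%N) (E 0%N) = 0.
  have LV := contI_inL2 cV0.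
  have := sol_sym SV SE; rewrite vE innerZr//.
  by move/esym/eqP; rewrite mulf_eq0 gt_eqF//= => /eqP.
have E00 x : I11 x -> E 0%N x = 0.
  apply: (inner_eq0 cE).
  rewrite (@eq_inner _ _ (fun x => r * (V 0%N x + r * v x)) _ (E 0%N))//.
  have LV := contI_inL2 cV0; have Lrv := inL2Z r Lv.
  rewrite innerZl ?innerDl ?innerZl//; last exact: inL2D.
  by rewrite VE vE !mulr0 addr0 mulr0.
have vV x : I11 x -> V 0%N x = - r * v x.
  move=> Ix; have /eqP := E00 x Ix; rewrite E0E// mulf_eq0 gt_eqF//= => /eqP h.
  by rewrite mulNr; move: h; clear; lra.
have := inner_ge0 (V 3%N); rewrite -(sol_inner SV SV).
rewrite (@eq_inner _ v v _ (fun x => - r * v x))// innerZr// mulNr oppr_ge0.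
by rewrite pmulr_rle0// -nrm2 leNgt exprn_gt0.
Qed.

End ClampedProblem.

(** * Hyperbolic functions and comparison by derivatives *)

Section Hyperbolic.
Context {R : realType}.
Implicit Types x y : R.

Lemma coshN x : cosh (- x) = cosh x.
Proof. by rewrite /cosh opprK addrC. Qed.

Lemma sinhN x : sinh (- x) = - sinh x.
Proof. by rewrite /sinh opprK -mulNr opprB. Qed.

Lemma sinh0 : sinh 0 = 0 :> R.
Proof. by rewrite /sinh oppr0 subrr mul0r. Qed.

Lemma cosh0 : cosh 0 = 1 :> R.
Proof. by rewrite /cosh oppr0 expR0; field. Qed.

Lemma expRE x : expR x = cosh x + sinh x.
Proof. by rewrite /cosh /sinh; field. Qed.

Lemma expRNE x : expR (- x) = cosh x - sinh x.
Proof. by rewrite /cosh /sinh; field. Qed.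

Lemma cosh2_sinh2 x : cosh x ^+ 2 = 1 + sinh x ^+ 2.
Proof.
have : expR x * expR (- x) = 1 by rewrite -expRD subrr expR0.
by rewrite expRE expRNE => h; lra.
Qed.

Lemma coshD x y : cosh (x + y) = cosh x * cosh y + sinh x * sinh y.
Proof. by rewrite /cosh /sinh opprD !expRD; field. Qed.

Lemma sinhD x y : sinh (x + y) = sinh x * cosh y + cosh x * sinh y.
Proof. by rewrite /cosh /sinh opprD !expRD; field. Qed.

Lemma cosh_gt0 x : 0 < cosh x.
Proof. by rewrite /cosh divr_gt0// addr_gt0 ?expR_gt0. Qed.

Lemma cosh_ge1 x : 1 <= cosh x.
Proof.
rewrite -(@ler_pXn2r _ 2) ?nnegrE ?(ltW (cosh_gt0 _))// expr1n cosh2_sinh2.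
by rewrite lerDl sqr_ge0.
Qed.

Lemma ler_deriv (f g : R -> R) (a b : R) : a <= b ->
  (forall x, is_derive x 1 f (g x)) -> (forall x, a <= x <= b -> 0 <= g x) ->
  f a <= f b.
Proof.
move=> ab fg g0.
have cf : {within `[a, b], continuous f}.
  apply: continuous_subspaceT => z.
  by apply/differentiable_continuous/derivable1_diffP; case: (fg z).
have [c cxy E] := @MVT_segment _ f g a b ab (fun z _ => fg z) cf.
by rewrite -subr_ge0 E mulr_ge0 ?subr_ge0//; apply: g0; rewrite in_itv in cxy.
Qed.

Lemma ltr_deriv (f g : R -> R) (a b : R) : a < b ->
  (forall x, is_derive x 1 f (g x)) -> (forall x, a < x < b -> 0 < g x) ->
  f a < f b.
Proof.
move=> ab fg g0.
have cf : {within `[a, b], continuous f}.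
  apply: continuous_subspaceT => z.
  by apply/differentiable_continuous/derivable1_diffP; case: (fg z).
have [c cxy E] := @MVT _ f g a b ab (fun z _ => fg z) cf.
by rewrite -subr_gt0 E mulr_gt0 ?subr_gt0//; apply: g0; rewrite in_itv in cxy.
Qed.

Lemma sinh_ge0 x : 0 <= x -> 0 <= sinh x.
Proof.
move=> x0; rewrite -[X in X <= _]sinh0; apply: (ler_deriv x0 (g := cosh)).
  by move=> t; apply: deq (dsinh (did t)) _; rewrite mulr1.
by move=> t _; exact/ltW/cosh_gt0.
Qed.

Lemma sinh_ge x : 0 <= x -> x <= sinh x.
Proof.
move=> x0; rewrite -subr_ge0.
have -> : 0 = sinh 0 - 0 :> R by rewrite sinh0 subrr.
apply: (ler_deriv (f := fun t => sinh t - t) x0 (g := fun t => cosh t - 1)).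
  by move=> t; deriv; rewrite mulr1.
by move=> t _; rewrite subr_ge0 cosh_ge1.
Qed.

Lemma cosh_le x y : 0 <= x -> x <= y -> cosh x <= cosh y.
Proof.
move=> x0 xy; apply: (ler_deriv xy (g := sinh)).
  by move=> t; apply: deq (dcosh (did t)) _; rewrite mulr1.
by move=> t /andP[xt _]; apply: sinh_ge0; exact: le_trans xt.
Qed.

Lemma cosh_ge x : 0 <= x -> 1 + x ^+ 2 / 2 <= cosh x.
Proof.
move=> x0; rewrite -subr_ge0.
have -> : 0 = cosh 0 - (1 + 0 ^+ 2 / 2) :> R by rewrite cosh0; field.
apply: (ler_deriv (f := fun t => cosh t - (1 + t ^+ 2 / 2)) x0 (g := fun t => sinh t - t)).
  by move=> t; deriv; field.
by move=> t /andP[t0 _]; rewrite subr_ge0 sinh_ge.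
Qed.

End Hyperbolic.

(** * Solutions of y^(6) = - l^6 y *)

Section Modes.
Context {R : realType}.
Local Notation s3 := (Num.sqrt (3 : R)).
Implicit Types (l x : R) (c : R * R * R) (b : bool).

Lemma s3_sqr : s3 ^+ 2 = 3.
Proof. by rewrite sqr_sqrtr// ler0n. Qed.

Lemma s3_gt0 : 0 < s3. Proof. by rewrite sqrtr_gt0 ltr0n. Qed.

(* The even (b = true) and odd (b = false) solutions of y^(6) = - l^6 y. *)
Definition mfun b l c x : R :=
  if b then c.1.1 * cos (l * x)
     + (c.1.2 * (cos (l * x / 2) * cosh (s3 * l * x / 2))
        + c.2 * (sin (l * x / 2) * sinh (s3 * l * x / 2)))
  else c.1.1 * sin (l * x)
     + (c.1.2 * (sin (l * x / 2) * cosh (s3 * l * x / 2))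
        + c.2 * (cos (l * x / 2) * sinh (s3 * l * x / 2))).

(** Differentiation in coordinates; it exchanges the two parities. *)
Definition dcoef b l c : R * R * R :=
  if b then (- (l * c.1.1), l / 2 * (- c.1.2 + s3 * c.2), l / 2 * (s3 * c.1.2 + c.2))
  else (l * c.1.1, l / 2 * (c.1.2 + s3 * c.2), l / 2 * (s3 * c.1.2 - c.2)).

Lemma mfun_derive b l c x :
  is_derive x 1 (mfun b l c) (mfun (~~ b) l (dcoef b l c) x).
Proof. by case: b; rewrite /mfun /dcoef /=; deriv; field. Qed.

Fixpoint coefk b l c k :=
  if k is k'.+1 then dcoef (b (+) odd k') l (coefk b l c k') else c.

Definition modek b l c k := mfun (b (+) odd k) l (coefk b l c k).

Lemma modek_derive b l c k x :
  is_derive x 1 (modek b l c k) (modek b l c k.+1 x).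
Proof. have -> : modek b l c k.+1 = mfun (~~ (b (+) odd k)) l (dcoef (b (+) odd k) l (coefk b l c k)).
  by rewrite /modek /= addbN.
exact: mfun_derive. Qed.

Lemma coefk6 b l c : coefk b l c 6 =
  (- l ^+ 6 * c.1.1, - l ^+ 6 * c.1.2, - l ^+ 6 * c.2).
Proof.
have s := s3_sqr.
by case: b; rewrite /= /dcoef /=; congr (_, _, _); field: s.
Qed.

Lemma mfunZ b l (a : R) c x :
  mfun b l (a * c.1.1, a * c.1.2, a * c.2) x = a * mfun b l c x.
Proof. by case: b; rewrite /mfun /=; ring. Qed.

Lemma modek6 b l c x : modek b l c 6 x = - l ^+ 6 * modek b l c 0 x.
Proof. by rewrite /modek coefk6 /= addbF mfunZ. Qed.

Lemma mfunN b l c x : mfun b l c (- x) = (-1) ^+ (~~ b) * mfun b l c x.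
Proof.
case: b; rewrite /mfun !mulrN !mulNr ?cosN ?sinN ?coshN ?sinhN; ring.
Qed.

(* D^4 - l^2 D^2 + l^4 annihilates the hyperbolic part. *)
Lemma modek_trig b l c x :
  modek b l c 4 x - l ^+ 2 * modek b l c 2 x + l ^+ 4 * modek b l c 0 x
  = 3 * l ^+ 4 * mfun b l (c.1.1, 0, 0) x.
Proof.
have s := s3_sqr.
rewrite -mfunZ /modek /= !addbF.
set c4 := dcoef _ _ (dcoef _ _ _); set c2 := dcoef _ _ _.
have -> : mfun b l c4 x - l ^+ 2 * mfun b l c2 x + l ^+ 4 * mfun b l c x =
    mfun b l (c4.1.1 - l ^+ 2 * c2.1.1 + l ^+ 4 * c.1.1,
      c4.1.2 - l ^+ 2 * c2.1.2 + l ^+ 4 * c.1.2,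
      c4.2 - l ^+ 2 * c2.2 + l ^+ 4 * c.2) x.
  by move: c4 c2; case: (b) => c4 c2; rewrite /mfun /=; ring.
by congr (mfun _ _ (_, _, _) _); rewrite /c4 /c2; case: (b); rewrite /dcoef /=; field: s.
Qed.

Lemma modek_eq0 b l c : (forall x, I11 x -> modek b l c 0 x = 0) ->
  forall k x, I11 x -> modek b l c k x = 0.
Proof.
move=> c0; elim=> // k IH.
apply: derI_eq0 IH; first by move=> x _; exact: modek_derive.
by apply: (@derI_cont _ _ (modek b l c k.+2)) => x _; exact: modek_derive.
Qed.

(** The trigonometric coefficient can be isolated by a differential operator; the odd case follows
    by differentiating once. Since this coefficient is 1 in the explicit families, none of their
    members vanishes identically. *)
Lemma mfun_eq0 b l c : l != 0 -> (forall x, I11 x -> mfun b l c x = 0) ->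
  c.1.1 = 0.
Proof.
move=> l0; have I0 : I11 (0 : R) by apply/I11P; apply/andP; split; lra.
have even d : (forall x, I11 x -> mfun true l d x = 0) -> d.1.1 = 0.
  move=> d0; have z : forall x, I11 x -> modek true l d 0 x = 0 by [].
  have := modek_trig true l d 0; rewrite !(modek_eq0 z _ I0).
  have -> : mfun true l (d.1.1, 0, 0) 0 = d.1.1.
    by rewrite /mfun /= mulr0 cos0; ring.
  rewrite !mulr0 subr0 addr0.
  have l4 : 3 * l ^+ 4 != 0 by rewrite mulf_neq0 ?expf_neq0// pnatr_eq0.
  by rewrite -[X in X = _](mulr0 (3 * l ^+ 4)) => /(mulfI l4).
case: b => [|c0]; first exact: even.
have /even : forall x, I11 x -> mfun true l (dcoef false l c) x = 0.
  exact: (@modek_eq0 false l c c0 1).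
by rewrite /= => /eqP; rewrite mulf_eq0 (negPf l0) => /eqP.
Qed.

End Modes.

(** * Roots of the characteristic function *)

Section Roots.
Context {R : realType}.
Local Notation s3 := (Num.sqrt (3 : R)).
Implicit Types (l t x : R) (m : nat).

Definition charF l : R := cos l * (cosh (s3 * l) + cos l) - 2.

Lemma char_cE l : char_c l = 2 * charF l.
Proof.
rewrite /char_c /charF (_ : 2 * l = l *+ 2); last by rewrite mulr_natl.
by rewrite cos_mulr2n; ring.
Qed.

Lemma char_c_eq0 l : (char_c l = 0) <-> (charF l = 0).
Proof.
rewrite char_cE; split=> [/eqP|->]; last by rewrite mulr0.
by rewrite mulf_eq0 pnatr_eq0 => /eqP.
Qed.

Lemma charF_derive l : is_derive l 1 charF
  (- sin l * (cosh (s3 * l) + cos l) + cos l * (s3 * sinh (s3 * l) - sin l)).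
Proof. by rewrite /charF; deriv; ring. Qed.

Lemma cosDmpi m t : cos (m%:R * pi + t) = (-1) ^+ m * cos t.
Proof. by rewrite addrC mulr_natl (alternatingn (@cosDpi R)). Qed.

Lemma sinDmpi m t : sin (m%:R * pi + t) = (-1) ^+ m * sin t.
Proof. by rewrite addrC mulr_natl (alternatingn (@sinDpi R)). Qed.

Lemma charF_lt0 l : cos l <= 0 -> charF l < 0.
Proof.
move=> c0; rewrite subr_lt0; apply: le_lt_trans (_ : 0 < 2); last by [].
rewrite mulr_le0_ge0//; have := cosh_ge1 (s3 * l); have := cos_geN1 l; lra.
Qed.

Lemma cosh_large l : pi <= l -> 7 <= cosh (s3 * l).
Proof.
move=> pl; have p2 := pi_ge2 R; have l2 : 2 <= l by exact: le_trans pl.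
have s0 := (@s3_gt0 R).
apply: le_trans (cosh_ge _); last by rewrite mulr_ge0 ?(ltW s0)//; lra.
by rewrite exprMn s3_sqr expr2; nra.
Qed.

(** The derivative is - sin (cosh - sinh) - (sin - s3 cos) sinh - 2 sin cos, with the hyperbolic
    functions taken at s3 l. *)
Lemma charF_derive_lt0 l : 0 <= cos l -> s3 * cos l <= sin l -> 0 < l -> 0 < sin l ->
  - sin l * (cosh (s3 * l) + cos l) + cos l * (s3 * sinh (s3 * l) - sin l) < 0.
Proof.
move=> c0 cs l0 s0.
have S0 : 0 <= sinh (s3 * l) by rewrite sinh_ge0// mulr_ge0 ?(ltW s3_gt0)// ltW.
have SC : sinh (s3 * l) < cosh (s3 * l).
  by rewrite -subr_gt0 -expRNE expR_gt0.
have := ler_wpM2r S0 cs; have := mulr_ge0 (ltW s0) c0.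
have : 0 < sin l * (cosh (s3 * l) - sinh (s3 * l)) by rewrite mulr_gt0// subr_gt0.
lra.
Qed.

(** This is pi / 3, the angle in the first quadrant from which on sin >= s3 cos. *)
Local Notation theta := (acos (2^-1) : R).

Lemma theta_bounds : 0 < theta /\ theta < pi / 2.
Proof.
have h : -1 <= (2^-1 : R) <= 1 by lra.
have h1 : -1 <= (2^-1 : R) < 1 by lra.
have t0 := acos_gt0 h1; split=> //.
have tpi := acos_lepi h.
have ct : cos theta = 2^-1 by rewrite acosK// in_itv.
have p0 := pi_gt0 R.
rewrite -ltr_cos ?in_itv/=; last 2 first.
- by rewrite (ltW t0) tpi.
- by apply/andP; split; lra.
by rewrite cos_pihalf ct; lra.
Qed.

Lemma cos_theta : cos theta = 2^-1.
Proof. by rewrite acosK// in_itv/=; lra. Qed.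

Lemma cos_le_pi x y : 0 <= x -> x <= y -> y <= pi -> cos y <= cos x.
Proof.
move=> x0 xy yp; rewrite le_eqVlt orbC; move: xy.
rewrite le_eqVlt => /predU1P[->|xy]; first by rewrite eqxx orbT.
by rewrite ltr_cos ?in_itv/= ?xy// ?x0 ?yp ?(le_trans x0 (ltW xy))// (le_trans (ltW xy) yp).
Qed.

Lemma theta_trig t : theta <= t -> t <= pi / 2 ->
  [/\ 0 <= cos t, s3 * cos t <= sin t & 0 < sin t].
Proof.
have [t0 tp] := theta_bounds; have p0 := pi_gt0 R => t1 t2.
have c0 : 0 <= cos t by apply: cos_ge0_pihalf; lra.
have s0 : 0 < sin t by apply: sin_gt0_pi; lra.
have c2 : cos t <= 2^-1 by rewrite -cos_theta; apply: cos_le_pi => //; lra.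
split=> //.
rewrite -(@ler_pXn2r _ 2) ?nnegrE ?(ltW s0)// ?mulr_ge0 ?(ltW s3_gt0)//.
rewrite exprMn s3_sqr sin2cos2.
have : cos t ^+ 2 <= 2^-1 ^+ 2 by rewrite ler_pXn2r ?nnegrE// invr_ge0.
by rewrite exprVn -natrX; lra.
Qed.

Lemma charF_decr m x y : ~~ odd m -> theta <= x -> x < y -> y <= pi / 2 ->
  charF (m%:R * pi + y) < charF (m%:R * pi + x).
Proof.
move=> om tx xy yp; rewrite -ltrN2.
have em : (-1) ^+ m = 1 :> R by rewrite -signr_odd (negPf om).
apply: (ltr_deriv (f := fun t => - charF (m%:R * pi + t))
  (g := fun t => - (- sin (m%:R * pi + t) * (cosh (s3 * (m%:R * pi + t)) + cos (m%:R * pi + t))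
   + cos (m%:R * pi + t) * (s3 * sinh (s3 * (m%:R * pi + t)) - sin (m%:R * pi + t)))) xy).
  by move=> t; rewrite /charF; deriv; ring.
move=> t /andP[xt ty]; rewrite oppr_gt0.
have [c0 cs s0] : [/\ 0 <= cos t, s3 * cos t <= sin t & 0 < sin t].
  by apply: theta_trig; lra.
apply: charF_derive_lt0; rewrite ?cosDmpi ?sinDmpi ?em ?mul1r//.
have [t0 _] := theta_bounds; rewrite ltr_wpDl// ?mulr_ge0 ?ler0n ?pi_ge0//; lra.
Qed.

Lemma charF_even_pos m t : ~~ odd m -> (0 < m)%N -> 0 <= t -> t <= theta ->
  0 < charF (m%:R * pi + t).
Proof.
move=> om m0 t0 tt; have em : (-1) ^+ m = 1 :> R by rewrite -signr_odd (negPf om).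
have [th0 thp] := theta_bounds; have p0 := pi_gt0 R.
have mp : pi <= m%:R * pi + t :> R.
  rewrite -[leLHS]addr0 lerD// -[leLHS]mul1r ler_pM2r//.
  by rewrite (ler_nat _ 1).
have := cosh_large mp; rewrite /charF cosDmpi em mul1r.
have : 2^-1 <= cos t by rewrite -cos_theta; apply: cos_le_pi => //; lra.
set C := cosh _; set c := cos t => hc hC.
have : 0 <= (c - 2^-1) * C by rewrite mulr_ge0; lra.
have : 0 <= c * (c - 2^-1) by rewrite mulr_ge0; lra.
lra.
Qed.

Lemma charF_incr m x y : odd m -> pi / 2 <= x -> x < y -> y <= pi ->
  charF (m%:R * pi + x) < charF (m%:R * pi + y).
Proof.
move=> om px xy yp; have p0 := pi_gt0 R.
have em : (-1) ^+ m = -1 :> R by rewrite -signr_odd om.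
rewrite /charF !cosDmpi em !mulN1r.
have cx : cos x <= 0.
  by rewrite -cos_pihalf; apply: cos_le_pi => //; lra.
have cxy : cos y < cos x by rewrite ltr_cos// in_itv/=; lra.
have Cxy : cosh (s3 * (m%:R * pi + x)) <= cosh (s3 * (m%:R * pi + y)).
  have s0 := (@s3_gt0 R).
  have mp : 0 <= m%:R * pi :> R by rewrite mulr_ge0// ?pi_ge0 ?ler0n.
  by apply: cosh_le; [rewrite mulr_ge0 ?(ltW s0)//; lra|rewrite ler_pM2l//; lra].
have C1 := cosh_ge1 (s3 * (m%:R * pi + x)).
move: C1 Cxy; set Cx := cosh _; set Cy := cosh _ => C1 Cxy.
have h1 : 0 < (cos x - cos y) * (Cx - cos y - cos x).
  by rewrite mulr_gt0 ?subr_gt0//; lra.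
have h2 : 0 <= - cos y * (Cy - Cx) by rewrite mulr_ge0; lra.
lra.
Qed.

(* char_c + 3 solves y^(6) = - 64 y with y^(k)(0) = 0 for 0 < k < 6, so it
   decreases from its value 3 at 0 as long as it is positive. *)
Lemma charF_small l : 0 < l -> l <= pi -> charF l < 0.
Proof.
move=> l0 lp; have [t0 tp] := theta_bounds; have p0 := pi_gt0 R.
have small x : 0 < x -> x <= theta -> charF x < 0.
  move=> x0 xt; pose Y := modek true (2 : R) (1, 2, 0).
  have Y0E z : Y 0%N z = char_c z + 3.
    rewrite /Y /modek /mfun /= /char_c.
    rewrite (_ : 2 * z / 2 = z); last by field.
    by rewrite (_ : s3 * 2 * z / 2 = s3 * z); [ring|field].
  have Yd k (z : R) : is_derive z 1 (Y k) (Y k.+1 z) by exact: modek_derive.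
  have Yv k : (0 < k < 6)%N -> Y k 0 = 0.
    have s := (@s3_sqr R).
    do 6 (move: k; case=> [|k]; first by move=> // _; rewrite /Y /modek /mfun /dcoef /=;
      rewrite ?(mulr0, mul0r, sin0, cos0, cosh0, sinh0); field: s).
    by [].
  (* Here cos >= 1/2 and cosh >= 1 give 2 charF + 3 >= 1/2. So the sixth derivative is negative, and
     this sign passes down to the first derivative, since the intermediate ones vanish at 0. *)
  have Y0p z : 0 < z -> z <= theta -> 0 < Y 0%N z.
    move=> z0 zt; rewrite Y0E char_cE /charF.
    have hc : 2^-1 <= cos z by rewrite -cos_theta; apply: cos_le_pi => //; lra.
    have := cosh_ge1 (s3 * z); move: hc; set c := cos z; set C := cosh _ => hc hC.
    have : 0 <= (c - 2^-1) * (C + c) by rewrite mulr_ge0; lra.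
    lra.
  have step k z : (0 < k < 6)%N -> (forall z, 0 < z -> z <= theta -> Y k.+1 z < 0) ->
      0 < z -> z <= theta -> Y k z < 0.
    move=> k6 H z0 zt; rewrite -oppr_gt0 -[ltLHS]oppr0 -(Yv k k6).
    apply: (ltr_deriv (f := fun t => - Y k t) (g := fun t => - Y k.+1 t) z0 (fun t => dN (Yd k t))).
    by move=> t /andP[? ?]; rewrite oppr_gt0; apply: H; lra.
  have Y6 z : 0 < z -> z <= theta -> Y 6%N z < 0.
    move=> z0 zt; rewrite /Y modek6 mulNr oppr_lt0 mulr_gt0 ?exprn_gt0//.
    exact: Y0p.
  have Y5 z := step 5%N z isT Y6; have Y4 z := step 4%N z isT Y5.
  have Y3 z := step 3%N z isT Y4; have Y2 z := step 2%N z isT Y3.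
  have Y1 z := step 1%N z isT Y2.
  have : - Y 0%N 0 < - Y 0%N x.
    apply: (ltr_deriv (f := fun t => - Y 0%N t) (g := fun t => - Y 1%N t) x0 (fun t => dN (Yd 0%N t))).
    by move=> t /andP[? ?]; rewrite oppr_gt0; apply: Y1; lra.
  rewrite !Y0E !char_cE {1}/charF mulr0 cosh0 cos0; lra.
have [lt|lt] := leP l theta; first exact: small.
have [l2|l2] := leP l (pi / 2).
  apply: lt_trans (small theta t0 (lexx _)).
  by have := @charF_decr 0 theta l isT (lexx _) lt l2; rewrite mul0r !add0r.
by apply: charF_lt0; rewrite -cos_pihalf; apply: cos_le_pi; lra.
Qed.

Lemma charF_mpi m : charF (m.+1%:R * pi) != 0.
Proof.
have p0 := pi_gt0 R.
have := cosDmpi m.+1 0; rewrite addr0 cos0 mulr1 => cE.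
have mp : pi <= m.+1%:R * pi :> R.
  by rewrite -[leLHS]mul1r ler_pM2r// (ler_nat _ 1).
have := cosh_large mp; rewrite /charF cE -signr_odd; case: (odd m.+1) => /= h.
  by rewrite expr1 lt_eqF//; lra.
by rewrite expr0 gt_eqF//; lra.
Qed.

(** Put l = m pi + t. For even m, [charF] is positive for t <= theta, decreasing up to pi / 2 and
    negative from there on. For odd m it is negative for t < pi / 2 and increasing afterwards. *)
Lemma charF_root_unique m x y : (0 < m)%N ->
  m%:R * pi < x < m.+1%:R * pi -> m%:R * pi < y < m.+1%:R * pi ->
  charF x = 0 -> charF y = 0 -> x = y.
Proof.
move=> m0; have p0 := pi_gt0 R; have [t0 tp] := theta_bounds.
suff W t u : t < u -> 0 < t -> u < pi -> charF (m%:R * pi + t) = 0 ->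
    charF (m%:R * pi + u) = 0 -> False.
  have -> : m.+1%:R * pi = m%:R * pi + pi :> R by rewrite -natr1; ring.
  move=> /andP[x1 x2] /andP[y1 y2] Fx Fy; apply/eqP/negPn/negP => xy.
  have E z : z = m%:R * pi + (z - m%:R * pi) by ring.
  case/orP: (lt_total xy) => h.
    by apply: (W (x - m%:R * pi) (y - m%:R * pi)); rewrite -?E//; lra.
  by apply: (W (y - m%:R * pi) (x - m%:R * pi)); rewrite -?E//; lra.
move=> tu tt0 up Ft Fu.
case: (boolP (odd m)) => om.
  have em : (-1) ^+ m = -1 :> R by rewrite -signr_odd om.
  have [tl|tl] := leP (pi / 2) t.
    by have := charF_incr om tl tu (ltW up); rewrite Ft Fu ltxx.
  have : charF (m%:R * pi + t) < 0.
    apply: charF_lt0; rewrite cosDmpi em mulN1r oppr_le0.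
    by apply: cos_ge0_pihalf; lra.
  by rewrite Ft ltxx.
have em : (-1) ^+ m = 1 :> R by rewrite -signr_odd (negPf om).
have [tl|tl] := leP t theta.
  by have := charF_even_pos om m0 (ltW tt0) tl; rewrite Ft ltxx.
have [ul|ul] := leP u (pi / 2).
  by have := charF_decr om (ltW tl) tu ul; rewrite Ft Fu ltxx.
have : charF (m%:R * pi + u) < 0.
  apply: charF_lt0; rewrite cosDmpi em mul1r -cos_pihalf.
  by apply: cos_le_pi; lra.
by rewrite Fu ltxx.
Qed.

Lemma charF_root_exists m : (0 < m)%N ->
  exists2 x, m%:R * pi < x < m.+1%:R * pi & charF x = 0.
Proof.
move=> m0; have p0 := pi_gt0 R; have [t0 tp] := theta_bounds.
have cF : continuous charF.
  move=> z; apply/differentiable_continuous/derivable1_diffP.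
  by case: (charF_derive z).
have -> : m.+1%:R * pi = m%:R * pi + pi :> R by rewrite -natr1; ring.
have mid : charF (m%:R * pi + pi / 2) < 0.
  by apply: charF_lt0; rewrite cosDmpi cos_pihalf mulr0.
case: (boolP (odd m)) => om.
  have end0 : 0 < charF (m%:R * pi + pi).
    have em : (-1) ^+ m = -1 :> R by rewrite -signr_odd om.
    rewrite /charF cosDmpi em cospi mulN1r opprK mul1r.
    have mp : pi <= m%:R * pi + pi :> R by rewrite lerDr mulr_ge0// ?ler0n ltW.
    by have := cosh_large mp; lra.
  have ab : m%:R * pi + pi / 2 <= m%:R * pi + pi :> R by lra.
  have [|x] := @IVT _ charF _ _ 0 ab (continuous_subspaceT cF).
    rewrite min_l ?max_r ?(ltW mid) ?(ltW end0)//; lra.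
  rewrite in_itv/= => /andP[x1 x2] Fx; exists x => //.
  apply/andP; split; first lra.
  rewrite lt_neqAle x2 andbT; apply/eqP => xE.
  by rewrite -xE Fx ltxx in end0.
have st := charF_even_pos om m0 (ltW t0) (lexx _).
have ab : m%:R * pi + theta <= m%:R * pi + pi / 2 :> R by lra.
have [|x] := @IVT _ charF _ _ 0 ab (continuous_subspaceT cF).
  rewrite min_r ?max_l ?(ltW mid) ?(ltW st)//; lra.
by rewrite in_itv/= => /andP[x1 x2] Fx; exists x => //; apply/andP; split; lra.
Qed.

Lemma charF_root_locate l : 0 < l -> charF l = 0 ->
  exists2 m, (0 < m)%N & m%:R * pi < l < m.+1%:R * pi.
Proof.
move=> l0 Fl; have p0 := pi_gt0 R.
have lp : 0 <= l / pi by rewrite divr_ge0// ltW.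
have /andP[k1 k2] := truncn_itv lp; move: k1 k2; set k := Num.truncn _ => k1 k2.
rewrite ler_pdivlMr// in k1; rewrite ltr_pdivrMr// in k2.
exists k.
  rewrite lt0n; apply/eqP => k0; rewrite k0 mul1r in k2.
  by have := charF_small l0 (ltW k2); rewrite Fl ltxx.
rewrite k2 andbT lt_neqAle k1 andbT; apply/eqP => lE.
have k0 : (0 < k)%N.
  rewrite lt0n; apply/eqP => k0; rewrite -lE k0 mul0r ltxx in l0; exact: notF l0.
by have := charF_mpi k.-1; rewrite prednK// lE Fl eqxx.
Qed.

(** There is no root in (0, pi], none at a multiple of pi, and exactly one between consecutive
    positive multiples; so the least root above the current one is the root in the next interval. *)
Lemma lambda_c_root m :
  m.+1%:R * pi < (lambda_c m.+1 : R) < m.+2%:R * pi /\ charF (lambda_c m.+1 : R) = 0.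
Proof.
have p0 := pi_gt0 R.
(* The alternative [a = 0] starts the recursion: 0 is itself a root of [char_c], and [next_root]
   searches strictly above its argument. *)
suff next a k : (a = 0 /\ k = 0%N) \/ [/\ (0 < k)%N, k%:R * pi < a < k.+1%:R * pi & charF a = 0] ->
    k.+1%:R * pi < next_root a < k.+2%:R * pi /\ charF (next_root a) = 0.
  elim: m => [|m [b F]]; first by apply: next; left.
  by apply: (next (lambda_c m.+1)); right.
move=> H.
have [r rI Fr] := charF_root_exists (ltn0Sn k).
have ak : a < k.+1%:R * pi.
  by case: H => [[-> _]|[_ /andP[_ ->] _]//]; rewrite mulr_gt0// ltr0Sn.
have a0 : 0 <= a.
  case: H => [[-> _]//|[_ /andP[h _] _]]; apply: le_trans (ltW h).
  by rewrite mulr_ge0// ?ler0n ltW.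
suff -> : next_root a = r by [].
pose S := [set x | a < x /\ char_c x = 0].
have rS : (S `&` lbound S) r.
  split.
    split; last exact/char_c_eq0.
    by case/andP: rI => ? _; apply: lt_trans ak _.
  move=> y [ay /char_c_eq0 Fy]; rewrite leNgt; apply/negP => yr.
  have [j j0 jI] := charF_root_locate (le_lt_trans a0 ay) Fy.
  have jk : (j < k.+2)%N.
    rewrite -(ltr_nat R) -(ltr_pM2r p0); case/andP: jI => h _; case/andP: rI => _.
    by apply: lt_trans; apply: lt_trans h yr.
  have kj : (k <= j)%N.
    rewrite -ltnS -(ltr_nat R) -(ltr_pM2r p0); case/andP: jI => _; apply: le_lt_trans.
    case: H => [[_ ->]|[_ /andP[h _] _]].
      by rewrite mul0r; exact/ltW/(le_lt_trans a0 ay).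
    exact: ltW (lt_trans h ay).
  rewrite ltnS leq_eqVlt in jk; case/predU1P: jk => [jE|jk].
    by rewrite jE in jI; rewrite (charF_root_unique (ltn0Sn k) jI rI Fy Fr) ltxx in yr.
  have {}jk : j = k by apply/eqP; rewrite eqn_leq kj andbT -ltnS.
  rewrite jk in jI j0; case: H => [[_ kE]|[_ aI Fa]]; first by rewrite kE in j0.
  by rewrite (charF_root_unique j0 aI jI Fa Fy) ltxx in ay.
have [[_ _] lb] := rS.
have [nS nlb] : (S `&` lbound S) (next_root a) by apply: xgetPex; exists r.
by apply/eqP; rewrite eq_le (nlb r rS.1) (lb _ nS).
Qed.

Lemma lambda_c_surj l : 0 < l -> char_c l = 0 -> exists m, l = lambda_c m.+1.
Proof.
move=> l0 /char_c_eq0 Fl; have [[//|m] _ mI] := charF_root_locate l0 Fl.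
have [b F] := lambda_c_root m.
by exists m; apply: (charF_root_unique (ltn0Sn m)).
Qed.

End Roots.

(** * The explicit eigenfunctions *)

Section Algebra.
(** To be read as s = s3, p = cos (l / 2), q = sin (l / 2), C = cosh (s3 l / 2), S = sinh (s3 l /
    2), a = cos l. D and E are the denominators in psi and phi, and al, be the hyperbolic
    coefficients of psi. The factorization of the double-angle terms makes all identities
    polynomial. *)
Variables (R : realType) (s p q C S a D E al be : R).
Hypotheses (s2 : s ^+ 2 = 3) (p2 : p ^+ 2 = 1 - q ^+ 2) (C2 : C ^+ 2 = 1 + S ^+ 2).
Hypotheses (aE : a = 1 - 2 * q ^+ 2) (DE : D = s * (2 * q * p) - 2 * S * C).
Hypotheses (EE : E = a - (C ^+ 2 + S ^+ 2)).
Hypotheses (D0 : D != 0) (E0 : E != 0).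
Hypothesis alE : al = (- 2 * s * a * q * C - 2 * (a - 2) * p * S) / D.
Hypothesis beE : be = ((- 3 * q + q ^+ 3 - 3 * p ^+ 2 * q) * C + 2 * s * a * p * S) / D.

Lemma alg_psi1 : a + (al * (p * C) + be * (q * S)) = 0.
Proof. by rewrite alE beE; field: s2 p2 C2 aE DE. Qed.

Lemma alg_H1 : 2 * q * p + ((al + s * be) / 2 * (q * C) + (s * al - be) / 2 * (p * S)) = 0.
Proof. by rewrite alE beE; field: s2 p2 C2 aE DE. Qed.

Lemma alg_psi3 : - a + ((al + s * be) / 2 * (p * C) + (be - s * al) / 2 * (q * S))
  = (3 * a * (2 * S * C) - s * (2 * q * p) * (2 * a + (C ^+ 2 + S ^+ 2))) / D.
Proof. by rewrite alE beE; field: s2 p2 C2 aE DE. Qed.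

(** This is psi'(1) / l. While psi(1) = 0 and the vanishing of the antiderivative at 1 hold for
    every l, the condition psi'(1) = 0 is the characteristic equation. *)
Lemma alg_psi2E :
  - (2 * q * p) + ((- al + s * be) / 2 * (q * C) + (s * al + be) / 2 * (p * S))
  = s * (a * (C ^+ 2 + S ^+ 2 + a) - 2) / D.
Proof. by rewrite alE beE; field: s2 p2 C2 aE DE. Qed.

Hypothesis char : a * (C ^+ 2 + S ^+ 2 + a) = 2.

Let b2 : (2 * q * p) ^+ 2 = 1 - a ^+ 2.
Proof. by rewrite aE; ring: p2. Qed.
Let aX : a * (C ^+ 2 + S ^+ 2) = 2 - a ^+ 2.
Proof. by rewrite -char; ring. Qed.

(** The given coefficients of phi have denominator E, those of psi^(4) have denominator D. After
    cross-multiplication the characteristic equation, in the form of I1 and I2, identifies them. *)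
Lemma alg_phi_ss : 4 * q * p * (p * S - s * q * C) / E = - (s * al + be) / 2.
Proof.
have -> : - (s * al + be) / 2 = ((2 + 4 * a) * (q * C) - 2 * s * (p * S)) / D.
  by rewrite alE beE; field: s2 p2 C2 aE DE.
apply/eqP; rewrite eqr_div//; apply/eqP.
have I1 : (2 * q * p) ^+ 2 + 4 * q ^+ 2 * C ^+ 2 = - E.
  rewrite b2 EE; have -> : 4 * q ^+ 2 * C ^+ 2 = 1 + (C ^+ 2 + S ^+ 2) - a - a * (C ^+ 2 + S ^+ 2).
    by rewrite aE; ring: C2.
  by rewrite aX; ring.
have I2 : 2 * (3 * (2 * q * p) ^+ 2 + 4 * p ^+ 2 * S ^+ 2) = - E * (2 + 4 * a).
  rewrite b2 EE.
  have -> : 4 * p ^+ 2 * S ^+ 2 = (C ^+ 2 + S ^+ 2) + a * (C ^+ 2 + S ^+ 2) - 1 - a.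
    by rewrite aE; ring: p2 C2.
  have -> : - (a - (C ^+ 2 + S ^+ 2)) * (2 + 4 * a) =
    - 2 * a - 4 * a ^+ 2 + 2 * (C ^+ 2 + S ^+ 2) + 4 * (a * (C ^+ 2 + S ^+ 2)) by ring.
  by rewrite aX; ring.
have -> : ((2 + 4 * a) * (q * C) - 2 * s * (p * S)) * E =
   2 * s * (p * S) * (- E) - (- E * (2 + 4 * a)) * (q * C) by ring.
by rewrite -I2 -I1; ring: DE s2.
Qed.

Lemma alg_phi_cc : - 4 * q * p * (s * p * S + q * C) / E = (s * be - al) / 2.
Proof.
have -> : (s * be - al) / 2 = (- 2 * s * (q * C) + (4 * a - 2) * (p * S)) / D.
  by rewrite alE beE; field: s2 p2 C2 aE DE.
apply/eqP; rewrite eqr_div//; apply/eqP.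
have I1 : (2 * q * p) ^+ 2 - 4 * p ^+ 2 * S ^+ 2 = E.
  rewrite b2 EE.
  have -> : 4 * p ^+ 2 * S ^+ 2 = (C ^+ 2 + S ^+ 2) + a * (C ^+ 2 + S ^+ 2) - 1 - a.
    by rewrite aE; ring: p2 C2.
  by rewrite aX; ring.
have I2 : - 2 * (3 * (2 * q * p) ^+ 2 - 4 * q ^+ 2 * C ^+ 2) = E * (4 * a - 2).
  rewrite b2 EE; have -> : 4 * q ^+ 2 * C ^+ 2 = 1 + (C ^+ 2 + S ^+ 2) - a - a * (C ^+ 2 + S ^+ 2).
    by rewrite aE; ring: C2.
  have -> : (a - (C ^+ 2 + S ^+ 2)) * (4 * a - 2) =
    4 * a ^+ 2 - 2 * a + 2 * (C ^+ 2 + S ^+ 2) - 4 * (a * (C ^+ 2 + S ^+ 2)) by ring.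
  by rewrite aX; ring.
have -> : (- 2 * s * (q * C) + (4 * a - 2) * (p * S)) * E =
   - 2 * s * (q * C) * E + (E * (4 * a - 2)) * (p * S) by ring.
by rewrite -I2 -I1; ring: DE s2.
Qed.

End Algebra.

Section AlgebraConst.
(** To be read as a = cos l, b = sin l, X = cosh (s3 l), Y = sinh (s3 l); the hypothesis [aX] is the
    characteristic equation. *)
Variables (R : realType) (s a b X Y l : R).
Hypotheses (s2 : s ^+ 2 = 3) (b2 : b ^+ 2 = 1 - a ^+ 2) (Y2 : Y ^+ 2 = X ^+ 2 - 1).
Hypotheses (aX : a * X = 2 - a ^+ 2) (a0 : a != 0) (l0 : l != 0).
Hypotheses (D0 : s * b - Y != 0) (E0 : X - a != 0).

(** On the left stands psi''(1)^2 / (3 l^4). Multiplication by a^2 lets X occur only in the product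
    a X, which the characteristic equation eliminates. *)
Lemma alg_norm : ((3 * a * Y - s * b * (2 * a + X)) / (s * b - Y)) ^+ 2 / 3 =
  (3 * s * b - (2 * a ^+ 2 + 1) * Y) / (s * b - Y).
Proof.
have Y2' : a ^+ 2 * Y ^+ 2 = b ^+ 2 * (4 - a ^+ 2).
  have -> : a ^+ 2 * Y ^+ 2 = (a * X) ^+ 2 - a ^+ 2 by rewrite Y2; ring.
  by rewrite aX b2; ring.
have key : (3 * a * Y - s * b * (2 * a + X)) ^+ 2 =
   3 * ((3 * s * b - (2 * a ^+ 2 + 1) * Y) * (s * b - Y)).
  apply: (mulfI (expf_neq0 2 a0)).
  have -> : a ^+ 2 * (3 * a * Y - s * b * (2 * a + X)) ^+ 2 =
    9 * a ^+ 2 * (a ^+ 2 * Y ^+ 2) - 6 * s * b * Y * a ^+ 2 * (2 * a ^+ 2 + a * X)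
    + 3 * b ^+ 2 * (2 * a ^+ 2 + a * X) ^+ 2 by ring: s2.
  have -> : a ^+ 2 * (3 * ((3 * s * b - (2 * a ^+ 2 + 1) * Y) * (s * b - Y))) =
    27 * b ^+ 2 * a ^+ 2 - 6 * s * b * Y * a ^+ 2 * (a ^+ 2 + 2)
    + 3 * (2 * a ^+ 2 + 1) * (a ^+ 2 * Y ^+ 2) by ring: s2.
  by rewrite Y2' aX; ring.
by rewrite exprMn key exprVn; field.
Qed.

Lemma alg_cform : 
  (24 * l * (s * b - Y) * ((X - a) / 2))^-1
  * (4 * s * a ^+ 2 * (2 * X ^+ 2 - 1)
     - 2 * s * X * (- 18 * l * b + 7 * a + (4 * a ^+ 3 - 3 * a))
     - 2 * s * (9 * l * (2 * b * a) - 7 * (2 * a ^+ 2 - 1) + (2 * (2 * a ^+ 2 - 1) ^+ 2 - 1))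
     + 6 * Y * (7 * b - (3 * b - 4 * b ^+ 3) + 2 * l * (4 * a ^+ 3 - 3 * a))
     - 6 * (l + 2 * b * a) * (2 * Y * X)) =
  (3 * s * b - (2 * a ^+ 2 + 1) * Y) / (s * b - Y).
Proof.
set N := (X in _ * X).
suff -> : N = 12 * l * (X - a) * (3 * s * b - (2 * a ^+ 2 + 1) * Y).
  by field; rewrite l0 D0 E0.
apply: (mulfI a0).
have -> : a * N =
  4 * s * a * (2 * (a * X) ^+ 2 - a ^+ 2) - 2 * s * (a * X) * (4 * a + 4 * a ^+ 3)
  - 2 * s * a * (8 * a ^+ 4 - 22 * a ^+ 2 + 8) + 24 * a * Y * b * (1 + b ^+ 2)
  - 24 * a * b * Y * (a * X)
  + 12 * l * (3 * s * b * (a * X - a ^+ 2) + Y * (4 * a ^+ 4 - 3 * a ^+ 2 - a * X)).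
  by rewrite /N; ring.
have -> : a * (12 * l * (X - a) * (3 * s * b - (2 * a ^+ 2 + 1) * Y)) =
  12 * l * (a * X - a ^+ 2) * (3 * s * b - (2 * a ^+ 2 + 1) * Y) by ring.
by rewrite aX; ring: b2.
Qed.

End AlgebraConst.

Section Explicit.
Context {R : realType}.
Local Notation s3 := (Num.sqrt (3 : R)).
Implicit Types (l t x : R) (m : nat).

Lemma sin_half l : sin l = 2 * sin (l / 2) * cos (l / 2).
Proof. by rewrite {1}(splitr l) sinD; ring. Qed.

Lemma cos_half l : cos l = cos (l / 2) ^+ 2 - sin (l / 2) ^+ 2.
Proof. by rewrite {1}(splitr l) cosD; ring. Qed.

Lemma sinh_half l : sinh l = 2 * sinh (l / 2) * cosh (l / 2) :> R.
Proof. by rewrite {1}(splitr l) sinhD; ring. Qed.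

Lemma cosh_half l : cosh l = cosh (l / 2) ^+ 2 + sinh (l / 2) ^+ 2 :> R.
Proof. by rewrite {1}(splitr l) coshD; ring. Qed.

(* psi, phi and the antiderivative Y 0 of psi all come from one solution chain
   with clamped ends. *)
Definition mode_chain l (Y : nat -> R -> R) (f g : R -> R) : Prop :=
  [/\ 0 < l, (forall k x, is_derive x 1 (Y k) (Y k.+1 x)),
      (forall x, Y 6%N x = - l ^+ 6 * Y 0%N x),
      (forall k, (k < 3)%N -> Y k 1 = 0 /\ Y k (-1) = 0) &
      (f = Y 1%N) /\ (g = fun x => l ^- 4 * Y 5%N x)].

Lemma modek_ends b l c k : modek b l c k 1 = 0 -> modek b l c k (-1) = 0.
Proof. by rewrite /modek mfunN => ->; rewrite mulr0. Qed.

Lemma modek_chain b l c f g : 0 < l -> (forall k, (k < 3)%N -> modek b l c k 1 = 0) ->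
  f =1 modek b l c 1 -> g =1 (fun x => l ^- 4 * modek b l c 5 x) ->
  mode_chain l (modek b l c) f g.
Proof.
move=> l0 bc fE gE; split=> //; first exact: modek_derive.
- by move=> x; rewrite modek6.
- by move=> k k3; split; [exact: bc|apply/modek_ends/bc].
- by split; apply/funext.
Qed.

Lemma sin_le l : 0 <= l -> sin l <= l.
Proof.
move=> l0; rewrite -subr_ge0.
have -> : 0 = 0 - sin 0 :> R by rewrite sin0 subrr.
have d (t : R) : is_derive t 1 (fun t => t - sin t) (1 - cos t).
  by deriv; rewrite mulr1.
by apply: (ler_deriv l0 d) => t _; rewrite subr_ge0 cos_le1.
Qed.

Lemma norm_sin_le x : `|sin x| <= `|x|.
Proof.
wlog x0 : x / 0 <= x.
  move=> W; have [/W//|/ltW x0] := leP 0 x.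
  by have := W (- x); rewrite sinN !normrN oppr_ge0 => /(_ x0).
rewrite (ger0_norm x0) ler_norml sin_le// andbT lerNl.
have d (t : R) : is_derive t 1 (fun t => t + sin t) (1 + cos t) by deriv; rewrite mulr1.
have := ler_deriv x0 d; rewrite sin0 addr0 => h.
by rewrite -subr_ge0 opprK; apply: h => t _; have := cos_geN1 t; lra.
Qed.

Lemma sinh_gt l : 0 < l -> l < sinh l.
Proof.
move=> l0; rewrite -subr_gt0.
have -> : 0 = sinh 0 - 0 :> R by rewrite sinh0 subrr.
apply: (ltr_deriv (f := fun t => sinh t - t) l0 (g := fun t => cosh t - 1)).
  by move=> t; deriv; rewrite mulr1.
move=> t /andP[t0 _]; rewrite subr_gt0; apply: lt_le_trans (cosh_ge (ltW t0)).
by rewrite ltrDl divr_gt0// exprn_gt0.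
Qed.

Section Cosine.
Variable l : R.
Hypotheses (l0 : 0 < l) (Fl : charF l = 0).

(* The coefficients of cos cosh and sin sinh in psi_c_form. *)
Definition psi_cc l : R :=
  (- 2 * s3 * cos l * sin (l / 2) * cosh (s3 * l / 2)
   - 2 * (cos l - 2) * cos (l / 2) * sinh (s3 * l / 2)) / (s3 * sin l - sinh (s3 * l)).
Definition psi_ss l : R :=
  ((- 3 * sin (l / 2) + sin (l / 2) ^+ 3 - 3 * cos (l / 2) ^+ 2 * sin (l / 2))
     * cosh (s3 * l / 2)
   + 2 * s3 * cos l * cos (l / 2) * sinh (s3 * l / 2)) / (s3 * sin l - sinh (s3 * l)).
(** The preimage of the coefficients of psi under [dcoef false l]. *)
Definition anti_c l : R * R * R :=
  (l^-1, (psi_cc l + s3 * psi_ss l) / (2 * l), (s3 * psi_cc l - psi_ss l) / (2 * l)).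

Let s2 := @s3_sqr R.
Let p2 : cos (l / 2) ^+ 2 = 1 - sin (l / 2) ^+ 2. Proof. exact: cos2sin2. Qed.
Let C2 : cosh (s3 * l / 2) ^+ 2 = 1 + sinh (s3 * l / 2) ^+ 2.
Proof. exact: cosh2_sinh2. Qed.
Let aE : cos l = 1 - 2 * sin (l / 2) ^+ 2.
Proof. by rewrite cos_half p2; ring. Qed.
Let sl0 : 0 < s3 * l. Proof. by rewrite mulr_gt0// s3_gt0. Qed.
Let DE : s3 * sin l - sinh (s3 * l) =
  s3 * (2 * sin (l / 2) * cos (l / 2)) - 2 * sinh (s3 * l / 2) * cosh (s3 * l / 2).
Proof. by rewrite -sin_half -sinh_half. Qed.
Let D_lt0 : s3 * sin l - sinh (s3 * l) < 0.
Proof.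
rewrite subr_lt0; apply: le_lt_trans (sinh_gt sl0).
by rewrite ler_pM2l ?s3_gt0// sin_le// ltW.
Qed.
Let D0 : s3 * sin l - sinh (s3 * l) != 0. Proof. by rewrite lt_eqF. Qed.
Let cosh_gt1 : 1 < cosh (s3 * l).
Proof.
by apply: lt_le_trans (cosh_ge (ltW sl0)); rewrite ltrDl divr_gt0// exprn_gt0.
Qed.
Let EE : cos l - cosh (s3 * l) = cos l - (cosh (s3 * l / 2) ^+ 2 + sinh (s3 * l / 2) ^+ 2).
Proof. by rewrite -cosh_half. Qed.
Let E0 : cos l - cosh (s3 * l) != 0.
Proof. by rewrite lt_eqF// subr_lt0; apply: le_lt_trans cosh_gt1; exact: cos_le1. Qed.
Let char : cos l * (cosh (s3 * l / 2) ^+ 2 + sinh (s3 * l / 2) ^+ 2 + cos l) = 2.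
Proof. by rewrite -cosh_half; apply/eqP; rewrite -subr_eq0; apply/eqP. Qed.
Let char' : cos l * (cosh (s3 * l) + cos l) = 2.
Proof. by rewrite cosh_half. Qed.
Let C0 : cosh (s3 * l / 2) != 0. Proof. exact/lt0r_neq0/cosh_gt0. Qed.
Let p0 : cos (l / 2) != 0.
Proof.
apply/eqP => p0; have := char'; rewrite cos_half p0 expr0n sub0r.
have -> : sin (l / 2) ^+ 2 = 1 by rewrite sin2cos2 p0 expr0n subr0.
by have := cosh_gt1; lra.
Qed.
Let q0 : sin (l / 2) != 0.
Proof.
apply/eqP => q0; have := char'; rewrite aE q0 expr0n mulr0 subr0.
by have := cosh_gt1; lra.
Qed.

(** The factor cos (l / 2) cosh (s3 l / 2) clears tan and tanh. This needs cos (l / 2) != 0: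
    otherwise cos l = -1, and the characteristic function would be negative. *)
Lemma psi_c_formE x : psi_c_form l x = mfun true l (1, psi_cc l, psi_ss l) x.
Proof.
rewrite /psi_c_form /mfun /= /psi_cc /psi_ss /tan /tanh mul1r; congr (_ + _).
have D0' := D0; move: (s3 * sin l - sinh (s3 * l)) D0' => D D0'.
rewrite (sin_half l); move: (cos l) (cos (l * x / 2) * _) (sin (l * x / 2) * _) D0' p0 C0.
move: (cos (l / 2)) (cosh (s3 * l / 2)) => p C a c1 c2 D0' p0' C0'.
by field; rewrite D0' p0' C0'.
Qed.

(** The coefficients on the right are those of psi^(4) / l^4. *)
Lemma phi_c_formE x : phi_c_form l x =
  mfun true l (1, (s3 * psi_ss l - psi_cc l) / 2, - (s3 * psi_cc l + psi_ss l) / 2) x.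
Proof.
rewrite -(alg_phi_cc s2 p2 C2 aE DE EE D0 E0 (erefl (psi_cc l)) (erefl (psi_ss l)) char).
rewrite -(alg_phi_ss s2 p2 C2 aE DE EE D0 E0 (erefl (psi_cc l)) (erefl (psi_ss l)) char).
rewrite /phi_c_form /mfun /= mul1r -addrA; congr (_ + _).
rewrite addrC; congr (_ + _); congr (_ * _); last first.
  by rewrite (sin_half l); move: E0 => ?; field.
rewrite /csc /sech /cot /tanh (sin_half l).
have E1 : cos l - cosh (s3 * l) =
    - 2 * (sin (l / 2) ^+ 2 * cosh (s3 * l / 2) ^+ 2 + cos (l / 2) ^+ 2 * sinh (s3 * l / 2) ^+ 2).
  by rewrite EE aE; ring: p2 C2.
have E2 : sin (l / 2) ^+ 2 * cosh (s3 * l / 2) ^+ 2 + cos (l / 2) ^+ 2 * sinh (s3 * l / 2) ^+ 2 != 0.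
  by apply: contra_neq E0 => E2; rewrite E1 E2 mulr0.
rewrite E1; move: E2 q0 C0.
move: (sin (l / 2)) (cos (l / 2)) (cosh (s3 * l / 2)) (sinh (s3 * l / 2)) => q p C S.
move=> W0 q0' C0'.
have -> : 1 + (p / q) ^+ 2 * (S / C) ^+ 2 = (q ^+ 2 * C ^+ 2 + p ^+ 2 * S ^+ 2) / (q ^+ 2 * C ^+ 2).
  by field; rewrite q0' C0'.
by move: (q ^+ 2 * C ^+ 2 + _) W0 => W W0; field; rewrite W0 q0' C0'.
Qed.

(** The third value is kept general, not set to 0: for an arbitrary l it later forces a clamped odd
    solution to have l among the roots. *)
Lemma anti_c_ends : [/\ modek false l (anti_c l) 0 1 = 0, modek false l (anti_c l) 1 1 = 0 &
  modek false l (anti_c l) 2 1 = l * (s3 * charF l / (s3 * sin l - sinh (s3 * l)))].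
Proof.
have l00 := lt0r_neq0 l0.
have c1 : dcoef false l (anti_c l) = (1, psi_cc l, psi_ss l).
  by rewrite /dcoef /anti_c /=; congr (_, _, _); field: s2.
split.
- have := alg_H1 s2 p2 C2 aE DE D0 (erefl (psi_cc l)) (erefl (psi_ss l)) => H1.
  rewrite /modek /mfun /= !mulr1 (sin_half l).
  by apply: (mulfI l00); rewrite mulr0 -[RHS]H1; field.
- have := alg_psi1 s2 p2 C2 aE DE D0 (erefl (psi_cc l)) (erefl (psi_ss l)) => H1.
  by rewrite /modek [coefk _ _ _ _]c1 /mfun /= !mulr1 mul1r.
- have := alg_psi2E s2 p2 C2 aE DE D0 (erefl (psi_cc l)) (erefl (psi_ss l)).
  rewrite (_ : _ - 2 = charF l); last by rewrite -cosh_half.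
  move=> <-.
  rewrite /modek [coefk _ _ _ _](_ : _ = dcoef true l (1, psi_cc l, psi_ss l)); last by rewrite -c1.
  by rewrite /mfun /dcoef /= !mulr1 (sin_half l); field.
Qed.

Lemma cos_mode_chain :
  mode_chain l (modek false l (anti_c l)) (psi_c_form l) (phi_c_form l).
Proof.
have l00 := lt0r_neq0 l0.
have c1 : dcoef false l (anti_c l) = (1, psi_cc l, psi_ss l).
  by rewrite /dcoef /anti_c /=; congr (_, _, _); field: s2.
have [H0 H1 H2] := anti_c_ends.
apply: modek_chain => //.
- by case=> [|[|[|//]]] _ //; rewrite H2 Fl mulr0 mul0r mulr0.
- by move=> x; rewrite psi_c_formE /modek [coefk _ _ _ _]c1.
- move=> x; rewrite phi_c_formE /modek -mfunZ; congr mfun.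
  rewrite [coefk _ _ _ _](_ : _ = dcoef false l (dcoef true l (dcoef false l (dcoef true l (1, psi_cc l, psi_ss l))))); last by rewrite -c1.
  by rewrite /dcoef /=; congr (_, _, _); field: s2.
Qed.

Lemma c_formE_closed : c_form l =
  (3 * s3 * sin l - (2 * cos l ^+ 2 + 1) * sinh (s3 * l)) / (s3 * sin l - sinh (s3 * l)).
Proof.
have l00 := lt0r_neq0 l0.
have b2 : sin l ^+ 2 = 1 - cos l ^+ 2 by exact: sin2cos2.
have Y2 : sinh (s3 * l) ^+ 2 = cosh (s3 * l) ^+ 2 - 1 by rewrite cosh2_sinh2; ring.
have aX : cos l * cosh (s3 * l) = 2 - cos l ^+ 2 by rewrite -char'; ring.
have a0 : cos l != 0.
  by apply/eqP => a0; have := char'; rewrite a0 mul0r; lra.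
have E0' : cosh (s3 * l) - cos l != 0 by rewrite -oppr_eq0 opprB.
rewrite -(alg_cform b2 aX a0 l00 D0 E0').
rewrite /c_form /csc /sech /cot /tanh.
have cos2 : cos (2 * l) = 2 * cos l ^+ 2 - 1.
  by rewrite mulr_natl cos_mulr2n; ring.
have sin2 : sin (2 * l) = 2 * sin l * cos l.
  by rewrite mulr_natl sin_mulr2n; ring.
have cos4 : cos (4 * l) = 2 * (2 * cos l ^+ 2 - 1) ^+ 2 - 1.
  rewrite (_ : 4 * l = (2 * l) *+ 2); last by ring.
  by rewrite cos_mulr2n cos2; ring.
have cos3 : cos (3 * l) = 4 * cos l ^+ 3 - 3 * cos l.
  by rewrite (_ : 3 * l = 2 * l + l) ?cosD ?cos2 ?sin2; [ring: b2|ring].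
have sin3 : sin (3 * l) = 3 * sin l - 4 * sin l ^+ 3.
  rewrite (_ : 3 * l = 2 * l + l) ?sinD ?cos2 ?sin2; last by ring.
  by have := cos2sin2 l; move: (cos l) (sin l) => a b a2; ring: a2.
have cosh2 : cosh (2 * s3 * l) = 2 * cosh (s3 * l) ^+ 2 - 1.
  rewrite (_ : 2 * s3 * l = s3 * l + s3 * l) ?coshD; last by ring.
  by rewrite -!expr2 Y2; ring.
have sinh2 : sinh (2 * s3 * l) = 2 * sinh (s3 * l) * cosh (s3 * l).
  by rewrite (_ : 2 * s3 * l = s3 * l + s3 * l) ?sinhD; ring.
rewrite cos2 sin2 cos4 cos3 sin3 cosh2 sinh2; congr (_ * _).
have E1 : (cosh (s3 * l) - cos l) / 2 =
    sin (l / 2) ^+ 2 * cosh (s3 * l / 2) ^+ 2 + cos (l / 2) ^+ 2 * sinh (s3 * l / 2) ^+ 2.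
  by rewrite -opprB EE aE; field: p2 C2.
have E2 : sin (l / 2) ^+ 2 * cosh (s3 * l / 2) ^+ 2 + cos (l / 2) ^+ 2 * sinh (s3 * l / 2) ^+ 2 != 0.
  by rewrite -E1 mulf_neq0// invr_neq0// pnatr_eq0.
rewrite E1; move: E2 q0 C0 l00 D0.
move: (s3 * sin l - sinh (s3 * l)) (sin (l / 2)) (cos (l / 2)) (cosh (s3 * l / 2)) (sinh (s3 * l / 2)) => D q p C S.
move: l => L W0 q0' C0' L0' D0'.
have -> : 1 + (p / q) ^+ 2 * (S / C) ^+ 2 = (q ^+ 2 * C ^+ 2 + p ^+ 2 * S ^+ 2) / (q ^+ 2 * C ^+ 2).
  by field; rewrite q0' C0'.
by move: (q ^+ 2 * C ^+ 2 + _) W0 => W W0; field; rewrite W0 q0' C0' L0' D0'.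
Qed.

(** The right-hand side is psi''(1)^2 / (3 l^4), the value of <psi, phi> that the Pohozaev identity
    yields; the sine constant gets the same form below. *)
Lemma c_formE : c_form l = modek false l (anti_c l) 3 1 ^+ 2 / (3 * l ^+ 4).
Proof.
have l00 := lt0r_neq0 l0.
have c1 : dcoef false l (anti_c l) = (1, psi_cc l, psi_ss l).
  by rewrite /dcoef /anti_c /=; congr (_, _, _); field: s2.
have b2 : sin l ^+ 2 = 1 - cos l ^+ 2 by exact: sin2cos2.
have Y2 : sinh (s3 * l) ^+ 2 = cosh (s3 * l) ^+ 2 - 1 by rewrite cosh2_sinh2; ring.
have aX : cos l * cosh (s3 * l) = 2 - cos l ^+ 2 by rewrite -char'; ring.
have a0 : cos l != 0.
  by apply/eqP => a0; have := char'; rewrite a0 mul0r; lra.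
have -> : modek false l (anti_c l) 3 1 = l ^+ 2 *
   ((3 * cos l * sinh (s3 * l) - s3 * sin l * (2 * cos l + cosh (s3 * l))) / (s3 * sin l - sinh (s3 * l))).
  rewrite (sinh_half (s3 * l)) (cosh_half (s3 * l)) (sin_half l).
  rewrite -(sinh_half (s3 * l)) -[in X in _ / X](sin_half l).
  rewrite (sinh_half (s3 * l)) -[in X in _ / X](sinh_half (s3 * l)).
  rewrite -(alg_psi3 s2 p2 C2 aE DE D0 (erefl (psi_cc l)) (erefl (psi_ss l))).
  rewrite /modek [coefk _ _ _ _](_ : _ = dcoef false l (dcoef true l (1, psi_cc l, psi_ss l))); last by rewrite -c1.
  by rewrite /mfun /dcoef /= !mulr1; field: s2.
rewrite exprMn.
have -> : (l ^+ 2) ^+ 2 * ((3 * cos l * sinh (s3 * l) - s3 * sin l * (2 * cos l + cosh (s3 * l))) /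
   (s3 * sin l - sinh (s3 * l))) ^+ 2 / (3 * l ^+ 4) =
   ((3 * cos l * sinh (s3 * l) - s3 * sin l * (2 * cos l + cosh (s3 * l))) /
   (s3 * sin l - sinh (s3 * l))) ^+ 2 / 3.
  by move: (_ / (s3 * sin l - sinh (s3 * l))) => t; field.
by rewrite (alg_norm s2 b2 Y2 aX a0 D0) c_formE_closed.
Qed.

End Cosine.

Section Sine.
Variable m : nat.
Let l : R := lambda_s m.+1.

(* The coefficients of sin cosh and cos sinh in psi_s_form. *)
Definition psi_sc (l : R) : R := - 2 * cos (l / 2) ^+ 3 / cosh (s3 * l / 2).
Definition psi_cs (l : R) : R := - 2 * sin (l / 2) ^+ 3 / sinh (s3 * l / 2).
Definition anti_s (l : R) : R * R * R :=
  (- l^-1, (- psi_sc l + s3 * psi_cs l) / (2 * l), (s3 * psi_sc l + psi_cs l) / (2 * l)).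

Let s2 := @s3_sqr R.
Let l0 : 0 < l. Proof. by rewrite mulr_gt0// ?ltr0Sn// pi_gt0. Qed.
Let l00 : l != 0. Proof. exact: lt0r_neq0. Qed.
Let sl0 : 0 < s3 * l. Proof. by rewrite mulr_gt0// s3_gt0. Qed.
Let C2 : cosh (s3 * l / 2) ^+ 2 = 1 + sinh (s3 * l / 2) ^+ 2.
Proof. exact: cosh2_sinh2. Qed.
Let C0 : cosh (s3 * l / 2) != 0. Proof. exact/lt0r_neq0/cosh_gt0. Qed.
Let S0 : sinh (s3 * l / 2) != 0.
Proof.
have h : 0 < s3 * l / 2 by rewrite divr_gt0.
exact/lt0r_neq0/(lt_trans h)/sinh_gt.
Qed.
Let b0 : sin l = 0.
Proof. by have := sinDmpi m.+1 (0 : R); rewrite addr0 sin0 mulr0. Qed.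

(** The half angle is a multiple of pi / 2, so the parity of the index decides; the computations
    with the sine family split along this alternative. *)
Lemma half_cases : (sin (l / 2) = 0 /\ cos (l / 2) ^+ 2 = 1) \/
  (cos (l / 2) = 0 /\ sin (l / 2) ^+ 2 = 1).
Proof.
have := b0; rewrite (sin_half l) => /eqP; rewrite !mulf_eq0 pnatr_eq0 /=.
case/orP => /eqP h; [left|right]; split=> //.
  by rewrite cos2sin2 h expr0n subr0.
by rewrite sin2cos2 h expr0n subr0.
Qed.

Lemma psi_s_formE x : psi_s_form l x = mfun false l (1, psi_sc l, psi_cs l) x.
Proof.
rewrite /psi_s_form /mfun /= /psi_sc /psi_cs mul1r (sinh_half (s3 * l)).
by field; rewrite S0 C0.
Qed.

Lemma phi_s_formE x : phi_s_form l x =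
  mfun false l (1, - (psi_sc l + s3 * psi_cs l) / 2, (s3 * psi_sc l - psi_cs l) / 2) x.
Proof.
have E (A B A' B' u v w : R) : A = A' -> B = - B' ->
    w + A * u - B * v = 1 * w + (A' * u + B' * v) by move=> -> ->; ring.
rewrite /phi_s_form /mfun /=; apply: E.
  rewrite (cos_half l) (cosh_half (s3 * l)) /psi_sc /psi_cs.
  case: half_cases => [[-> c2]|[-> c2]].
    have -> : cos (l / 2) ^+ 3 = cos (l / 2) by rewrite exprSr c2 mul1r.
    have -> : cos (l / 2) ^+ 2 - 0 ^+ 2 + (cosh (s3 * l / 2) ^+ 2 + sinh (s3 * l / 2) ^+ 2) = 2 * cosh (s3 * l / 2) ^+ 2.
      by rewrite c2 C2; ring.
    by rewrite c2; field; rewrite S0 C0.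
  have -> : sin (l / 2) ^+ 3 = sin (l / 2) by rewrite exprSr c2 mul1r.
  have -> : 0 ^+ 2 - sin (l / 2) ^+ 2 + (cosh (s3 * l / 2) ^+ 2 + sinh (s3 * l / 2) ^+ 2) = 2 * sinh (s3 * l / 2) ^+ 2.
    by rewrite c2 C2; ring.
  by rewrite c2; field; rewrite S0 C0.
rewrite (cos_half l) /psi_sc /psi_cs /csch /coth.
case: half_cases => [[-> c2]|[-> c2]].
  have -> : cos (l / 2) ^+ 3 = cos (l / 2) by rewrite exprSr c2 mul1r.
  by rewrite c2; field; rewrite S0 C0.
have -> : sin (l / 2) ^+ 3 = sin (l / 2) by rewrite exprSr c2 mul1r.
by rewrite c2; field; rewrite S0 C0.
Qed.

Let c1 : dcoef true l (anti_s l) = (1, psi_sc l, psi_cs l).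
Proof. by rewrite /dcoef /anti_s /=; congr (_, _, _); field: s2. Qed.

Lemma sin_mode_chain :
  mode_chain l (modek true l (anti_s l)) (psi_s_form l) (phi_s_form l).
Proof.
apply: modek_chain => //.
- case=> [|[|[|//]]] _.
  + rewrite /modek /mfun /= !mulr1 (cos_half l) /psi_sc /psi_cs.
    case: half_cases => [[-> c2]|[-> c2]].
      rewrite (_ : cos (l / 2) ^+ 3 = cos (l / 2)); last by rewrite exprSr c2 mul1r.
      by field: c2; rewrite l00 S0 C0.
    rewrite (_ : sin (l / 2) ^+ 3 = sin (l / 2)); last by rewrite exprSr c2 mul1r.
    by field: c2; rewrite l00 S0 C0.
  + rewrite /modek [coefk _ _ _ _]c1 /mfun /= !mulr1 b0 /psi_sc /psi_cs.
    by case: half_cases => [[-> c2]|[-> c2]]; field; rewrite S0 C0.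
  + rewrite /modek [coefk _ _ _ _](_ : _ = dcoef false l (1, psi_sc l, psi_cs l)); last by rewrite -c1.
    rewrite /mfun /dcoef /= !mulr1 (cos_half l) /psi_sc /psi_cs.
    case: half_cases => [[-> c2]|[-> c2]].
      rewrite (_ : cos (l / 2) ^+ 3 = cos (l / 2)); last by rewrite exprSr c2 mul1r.
      by field: c2; rewrite S0 C0.
    rewrite (_ : sin (l / 2) ^+ 3 = sin (l / 2)); last by rewrite exprSr c2 mul1r.
    by field: c2; rewrite S0 C0.
- by move=> x; rewrite psi_s_formE /modek [coefk _ _ _ _]c1.
- move=> x; rewrite phi_s_formE /modek -mfunZ; congr mfun.
  rewrite [coefk _ _ _ _](_ : _ = dcoef true l (dcoef false l (dcoef true l (dcoef false l (1, psi_sc l, psi_cs l))))); last by rewrite -c1.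
  by rewrite /dcoef /=; congr (_, _, _); field: s2.
Qed.

Lemma anti_s3 : modek true l (anti_s l) 3 1 = l ^+ 2 *
    ((psi_sc l - s3 * psi_cs l) / 2 * (sin (l / 2) * cosh (s3 * l / 2))
     + (s3 * psi_sc l + psi_cs l) / 2 * (cos (l / 2) * sinh (s3 * l / 2))).
Proof.
rewrite /modek [coefk _ _ _ _](_ : _ = dcoef true l (dcoef false l (1, psi_sc l, psi_cs l))); last by rewrite -c1.
by rewrite /mfun /dcoef /= !mulr1 b0; field: s2.
Qed.

Lemma s_formE : s_form l = modek true l (anti_s l) 3 1 ^+ 2 / (3 * l ^+ 4).
Proof.
rewrite anti_s3.
have cos2 : cos (2 * l) = 2 * cos l ^+ 2 - 1.
  by rewrite mulr_natl cos_mulr2n; ring.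
have sin2 : sin (2 * l) = 0.
  by rewrite mulr_natl sin_mulr2n b0 mulr0 mul0rn.
have cos4 : cos (4 * l) = 2 * (2 * cos l ^+ 2 - 1) ^+ 2 - 1.
  rewrite (_ : 4 * l = (2 * l) *+ 2); last by ring.
  by rewrite cos_mulr2n cos2; ring.
have cosh2 : cosh (2 * s3 * l) = 2 * cosh (s3 * l) ^+ 2 - 1.
  rewrite (_ : 2 * s3 * l = s3 * l + s3 * l) ?coshD; last by ring.
  by rewrite -!expr2 cosh2_sinh2; ring.
have sinh2 : sinh (2 * s3 * l) = 2 * sinh (s3 * l) * cosh (s3 * l).
  by rewrite (_ : 2 * s3 * l = s3 * l + s3 * l) ?sinhD; ring.
rewrite /s_form cos2 sin2 cos4 cosh2 sinh2 (sinh_half (s3 * l)) (cosh_half (s3 * l)) (cos_half l).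
rewrite /csch /sech /psi_sc /psi_cs.
case: half_cases => [[-> c2]|[-> c2]].
  rewrite (_ : cos (l / 2) ^+ 3 = cos (l / 2)); last by rewrite exprSr c2 mul1r.
  rewrite c2 (_ : 1 - 0 ^+ 2 = 1); last by rewrite expr0n subr0.
  rewrite (_ : 1 + (cosh (s3 * l / 2) ^+ 2 + sinh (s3 * l / 2) ^+ 2) = 2 * cosh (s3 * l / 2) ^+ 2); last by rewrite C2; ring.
  by field: s2 c2 C2; rewrite l00 S0 C0.
rewrite (_ : sin (l / 2) ^+ 3 = sin (l / 2)); last by rewrite exprSr c2 mul1r.
rewrite c2 (_ : 0 ^+ 2 - 1 = -1); last by rewrite expr0n sub0r.
rewrite (_ : -1 + (cosh (s3 * l / 2) ^+ 2 + sinh (s3 * l / 2) ^+ 2) = 2 * sinh (s3 * l / 2) ^+ 2); last by rewrite C2; ring.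
by field: s2 c2 C2; rewrite l00 S0 C0.
Qed.

(** The constant is tanh^2 or coth^2 of s3 l / 2, according as sin (l / 2) or cos (l / 2)
    vanishes. *)
Lemma s_form_ge : 2^-1 <= s_form l.
Proof.
have C7 : 7 <= cosh (s3 * l).
  by apply: cosh_large; rewrite /l /lambda_s ler_peMl ?pi_ge0// ler1n.
have C4 : 4 <= cosh (s3 * l / 2) ^+ 2.
  by move: C7; rewrite (cosh_half (s3 * l)) C2; lra.
have S3 : sinh (s3 * l / 2) ^+ 2 = cosh (s3 * l / 2) ^+ 2 - 1 by rewrite C2; ring.
rewrite s_formE anti_s3 /psi_sc /psi_cs.
case: half_cases => [[-> c2]|[-> c2]].
  rewrite (_ : cos (l / 2) ^+ 3 = cos (l / 2)); last by rewrite exprSr c2 mul1r.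
  rewrite [leRHS](_ : _ = sinh (s3 * l / 2) ^+ 2 / cosh (s3 * l / 2) ^+ 2).
    by rewrite S3 ler_pdivlMr; lra.
  by field: s2 c2; rewrite l00 S0 C0.
rewrite (_ : sin (l / 2) ^+ 3 = sin (l / 2)); last by rewrite exprSr c2 mul1r.
rewrite [leRHS](_ : _ = cosh (s3 * l / 2) ^+ 2 / sinh (s3 * l / 2) ^+ 2).
  by rewrite S3 ler_pdivlMr; lra.
by field: s2 c2; rewrite l00 S0 C0.
Qed.

End Sine.
End Explicit.

(** * Classification of the clamped eigenfunctions *)

Section ClampedEigenfunctions.
Context {R : realType}.
Local Notation s3 := (Num.sqrt (3 : R)).
Implicit Types (l x : R) (c : R * R * R).

(** Gronwall's argument for the sum En of the squares of the derivatives: |En'| <= (2 + L) En by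
    completing squares, so En times a decaying exponential is monotone on either side of 0. *)
Lemma ode_unique (d : nat -> R -> R) (L : R) : 0 < L ->
  (forall k, (k < 6)%N -> derI (d k) (d k.+1)) ->
  (forall x, I11 x -> d 6%N x = - (L * d 0%N x)) ->
  (forall k, (k < 6)%N -> d k 0 = 0) -> forall x, I11 x -> d 0%N x = 0.
Proof.
move=> L0 dd d6 dz x Ix.
pose En x := d 0%N x ^+ 2 + d 1%N x ^+ 2 + d 2%N x ^+ 2 + d 3%N x ^+ 2 + d 4%N x ^+ 2 + d 5%N x ^+ 2.
pose En' x := 2 * (d 0%N x * d 1%N x + d 1%N x * d 2%N x + d 2%N x * d 3%N x
  + d 3%N x * d 4%N x + d 4%N x * d 5%N x - L * (d 5%N x * d 0%N x)).
have dE z : I11 z -> is_derive z 1 En (En' z).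
  move=> Iz; have ? := dd 0%N isT z Iz; have ? := dd 1%N isT z Iz.
  have ? := dd 2%N isT z Iz; have ? := dd 3%N isT z Iz.
  have ? := dd 4%N isT z Iz; have := dd 5%N isT z Iz; rewrite d6// => ?.
  by rewrite /En /En'; deriv; ring.
pose K := 2 + L.
have bound z : `|En' z| <= K * En z.
  rewrite /En' /En /K ler_norml; apply/andP; split; rewrite -subr_ge0.
    have -> : forall a b c d e f : R, 2 * (a * b + b * c + c * d + d * e + e * f - L * (f * a))
      - - ((2 + L) * (a ^+ 2 + b ^+ 2 + c ^+ 2 + d ^+ 2 + e ^+ 2 + f ^+ 2)) =
      (a + b) ^+ 2 + (b + c) ^+ 2 + (c + d) ^+ 2 + (d + e) ^+ 2 + (e + f) ^+ 2
      + a ^+ 2 + f ^+ 2 + L * ((f - a) ^+ 2 + b ^+ 2 + c ^+ 2 + d ^+ 2 + e ^+ 2).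
      by move=> *; ring.
    by do ?[exact: sqr_ge0|apply: addr_ge0|apply: mulr_ge0|exact: ltW].
  have -> : forall a b c d e f : R, (2 + L) * (a ^+ 2 + b ^+ 2 + c ^+ 2 + d ^+ 2 + e ^+ 2 + f ^+ 2)
    - 2 * (a * b + b * c + c * d + d * e + e * f - L * (f * a)) =
    (a - b) ^+ 2 + (b - c) ^+ 2 + (c - d) ^+ 2 + (d - e) ^+ 2 + (e - f) ^+ 2
    + a ^+ 2 + f ^+ 2 + L * ((f + a) ^+ 2 + b ^+ 2 + c ^+ 2 + d ^+ 2 + e ^+ 2).
    by move=> *; ring.
  by do ?[exact: sqr_ge0|apply: addr_ge0|apply: mulr_ge0|exact: ltW].
have En0 : En 0 = 0 by rewrite /En !dz// expr0n /= !addr0.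
have I0 : I11 (0 : R) by apply/I11P; apply/andP; split; lra.
have En_le : En x <= 0.
  have mono (sg : bool) : let e : R := (-1) ^+ sg in
      derI (fun z => e * (En z * expR (e * K * z))) (fun z => (e * En' z + K * En z) * expR (e * K * z)).
    move=> e z Iz; have ? := dE z Iz.
    have e2 : e * e = 1 by rewrite -expr2 sqrr_sign.
    by deriv; ring: e2.
  have pos (sg : bool) z : I11 z -> 0 <= ((-1) ^+ sg * En' z + K * En z) * expR ((-1) ^+ sg * K * z).
    move=> Iz; apply: mulr_ge0; last exact: expR_ge0.
    have := bound z; rewrite ler_norml => /andP[h1 h2].
    by move: h1 h2; clear; case: sg; rewrite ?expr0 ?expr1 ?mul1r ?mulN1r; lra.
  case/I11P/andP: (Ix) => x1 x2.
  have [x0|/ltW x0] := leP 0 x.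
    have N1 : -1 <= 0 :> R by lra.
    have := derI_le (mono true) (pos true) N1 x0 x2.
    rewrite /= expr1 En0 mul0r mulr0 mulN1r oppr_ge0.
    by rewrite pmulr_lle0// expR_gt0.
  have P1 : 0 <= 1 :> R by lra.
  have := derI_le (mono false) (pos false) x1 x0 P1.
  by rewrite /= expr0 En0 mul0r mulr0 mul1r pmulr_lle0// expR_gt0.
apply/eqP; rewrite -sqrf_eq0 eq_le sqr_ge0 andbT; apply: le_trans En_le.
by rewrite /En -!addrA lerDl ?addr_ge0 ?sqr_ge0.
Qed.

Lemma even_initial l (w0 w2 w4 : R) : 0 < l -> exists c,
  [/\ modek true l c 0 0 = w0, modek true l c 2 0 = w2, modek true l c 4 0 = w4 &
      forall k, odd k -> modek true l c k 0 = 0].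
Proof.
move=> l0; have l00 := lt0r_neq0 l0; have s0 := lt0r_neq0 (@s3_gt0 R).
have s2 := @s3_sqr R.
pose v2 := w2 / l ^+ 2; pose v4 := w4 / l ^+ 4.
(* The solution of w0 = A + C, v2 = - A + (C + s3 D) / 2, v4 = A + (s3 D - C) / 2, where A = w0 -
   C. *)
pose C := (2 * w0 - v4 + v2) / 3; pose D := (v2 + v4) / s3.
exists (w0 - C, C, D); split.
- rewrite /modek /mfun /= ?(mulr0, mul0r, sin0, cos0, cosh0, sinh0); ring.
- rewrite /modek /mfun /= ?(mulr0, mul0r, sin0, cos0, cosh0, sinh0) /C /D /v2 /v4.
  by field: s2; rewrite l00 s0.
- rewrite /modek /mfun /= ?(mulr0, mul0r, sin0, cos0, cosh0, sinh0) /C /D /v2 /v4.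
  by field: s2; rewrite l00 s0.
- move=> k ok; rewrite /modek ok /mfun /= ?(mulr0, mul0r, sin0, cos0, cosh0, sinh0); ring.
Qed.

Lemma modek_shift l c k : modek false l c k.+1 = modek true l (dcoef false l c) k.
Proof.
have E j : coefk false l c j.+1 = coefk true l (dcoef false l c) j.
  elim: j => // j IH.
  rewrite -[RHS]/(dcoef (true (+) odd j) l (coefk true l (dcoef false l c) j)) -IH.
  by rewrite -[LHS]/(dcoef (false (+) odd j.+1) l (coefk false l c j.+1)) /=; case: (odd j).
by rewrite /modek E /=; case: (odd k).
Qed.

Lemma odd_initial l (w1 w3 w5 : R) : 0 < l -> exists c,
  [/\ modek false l c 1 0 = w1, modek false l c 3 0 = w3, modek false l c 5 0 = w5 &
      forall k, ~~ odd k -> modek false l c k 0 = 0].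
Proof.
move=> l0; have l00 := lt0r_neq0 l0; have s2 := @s3_sqr R.
have [d [d1 d3 d5 d0]] := even_initial w1 w3 w5 l0.
exists (d.1.1 / l, (d.1.2 + s3 * d.2) / (2 * l), (s3 * d.1.2 - d.2) / (2 * l)).
set c := (_, _, _).
have cE : dcoef false l c = d.
  by rewrite [RHS](_ : d = (d.1.1, d.1.2, d.2)); [rewrite /dcoef /=; congr (_, _, _); field: s2|case: (d) => [[]]].
split; [by rewrite modek_shift cE..|].
move=> k ok; rewrite /modek /= (negPf ok) /mfun /= ?(mulr0, mul0r, sin0, cos0, cosh0, sinh0); ring.
Qed.

Lemma ode_solution l (E : nat -> R -> R) : 0 < l ->
  (forall k, (k < 6)%N -> derI (E k) (E k.+1)) ->
  (forall x, I11 x -> E 6%N x = - (l ^+ 6 * E 0%N x)) ->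
  exists ce co, forall k x, (k < 6)%N -> I11 x ->
    E k x = modek true l ce k x + modek false l co k x.
Proof.
move=> l0 dE E6.
have [ce [e0 e2 e4 eo]] := even_initial (E 0%N 0) (E 2%N 0) (E 4%N 0) l0.
have [co [u1 u3 u5 ue]] := odd_initial (E 1%N 0) (E 3%N 0) (E 5%N 0) l0.
exists ce, co.
pose G k x := modek true l ce k x + modek false l co k x.
pose d k x := E k x - G k x.
have dd k : (k < 6)%N -> derI (d k) (d k.+1).
  move=> k6 x Ix; have ? := dE k k6 x Ix.
  have ? := modek_derive true l ce k x; have ? := modek_derive false l co k x.
  by rewrite /d /G; deriv.
have d6 x : I11 x -> d 6%N x = - (l ^+ 6 * d 0%N x).
  by move=> Ix; rewrite /d /G E6// !modek6; ring.
have dz k : (k < 6)%N -> d k 0 = 0.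
  rewrite /d /G => k6; have [ok|ok] := boolP (odd k).
    rewrite (eo k ok) add0r; move: k k6 ok.
    by do 6 (case=> [_ //|]; rewrite ?u1 ?u3 ?u5 ?subrr//).
  rewrite (ue k ok) addr0; move: k k6 ok.
  by do 6 (case=> [_ //|]; rewrite ?e0 ?e2 ?e4 ?subrr//).
have d0 := ode_unique (exprn_gt0 6 l0) dd d6 dz.
have dk k : (k < 6)%N -> forall x, I11 x -> d k x = 0.
  elim: k => // k IH k6; have k5 := ltnW k6.
  apply: (derI_eq0 (dd k k5)); last exact: IH.
  exact: derI_cont (dd k.+1 k6).
by move=> k x k6 Ix; apply/eqP; rewrite -subr_eq0; apply/eqP; exact: dk.
Qed.

(** The values at 1 and -1 are the sum and, up to a common sign, the difference of the contributions
    of the two parities. *)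
Lemma clamped_split l ce co : (forall k x, (k < 3)%N -> x = 1 \/ x = -1 ->
    modek true l ce k x + modek false l co k x = 0) ->
  forall k, (k < 3)%N -> modek true l ce k 1 = 0 /\ modek false l co k 1 = 0.
Proof.
move=> H k k3; have h1 := H k 1 k3 (or_introl erefl).
have := H k (-1) k3 (or_intror erefl).
rewrite /modek !mfunN -!/(modek _ _ _ _ _) -/(modek true l ce k 1) -/(modek false l co k 1).
by rewrite /=; case: (odd k); rewrite ?expr1 ?expr0 => h2; split; lra.
Qed.

(** Cramer's rule: the determinant is a multiple of s3 sin l - sinh (s3 l), which is negative
    because sin l <= l and s3 l < sinh (s3 l). The even case has a plus sign instead. *)
Lemma odd_lead0 l (C D : R) : 0 < l ->
  modek false l (0, C, D) 0 1 = 0 -> modek false l (0, C, D) 1 1 = 0 -> C = 0 /\ D = 0.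
Proof.
move=> l0; rewrite /modek /mfun /= !mulr1 !mul0r !mulr0 !mul0r !add0r.
set p := cos (l / 2); set q := sin (l / 2); set Ch := cosh _; set Sh := sinh _ => e0 e1.
have sl0 : 0 < s3 * l by rewrite mulr_gt0// s3_gt0.
have D_neq0 : s3 * (2 * q * p) - 2 * Sh * Ch != 0.
  rewrite -sin_half -sinh_half lt_eqF// subr_lt0; apply: le_lt_trans (sinh_gt sl0).
  by rewrite ler_pM2l ?s3_gt0// sin_le// ltW.
have e1' : (C + s3 * D) * (p * Ch) + (s3 * C - D) * (q * Sh) = 0.
  by apply: (mulfI (lt0r_neq0 l0)); rewrite mulr0 -[RHS](mulr0 2) -e1; field.
have pq : p ^+ 2 = 1 - q ^+ 2 by exact: cos2sin2.
have CS : Ch ^+ 2 = 1 + Sh ^+ 2 by exact: cosh2_sinh2.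
split; apply: (mulIf D_neq0); rewrite mul0r.
  have -> : C * (s3 * (2 * q * p) - 2 * Sh * Ch) =
    2 * (s3 * (p * Ch) - q * Sh) * (C * (q * Ch) + D * (p * Sh))
    - 2 * (p * Sh) * ((C + s3 * D) * (p * Ch) + (s3 * C - D) * (q * Sh)) by ring: pq CS.
  by rewrite e0 e1' !mulr0 subr0.
have -> : D * (s3 * (2 * q * p) - 2 * Sh * Ch) =
    2 * (q * Ch) * ((C + s3 * D) * (p * Ch) + (s3 * C - D) * (q * Sh))
    - 2 * (p * Ch + s3 * (q * Sh)) * (C * (q * Ch) + D * (p * Sh)) by ring: pq CS.
by rewrite e0 e1' !mulr0 subr0.
Qed.

Lemma even_lead0 l (C D : R) : 0 < l ->
  modek true l (0, C, D) 0 1 = 0 -> modek true l (0, C, D) 1 1 = 0 -> C = 0 /\ D = 0.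
Proof.
move=> l0; rewrite /modek /mfun /= !mulr1 !mul0r !mulr0 !oppr0 !mul0r !add0r.
set p := cos (l / 2); set q := sin (l / 2); set Ch := cosh _; set Sh := sinh _ => e0 e1.
have sl0 : 0 < s3 * l by rewrite mulr_gt0// s3_gt0.
have D_neq0 : s3 * (2 * q * p) + 2 * Sh * Ch != 0.
  rewrite -sin_half -sinh_half gt_eqF//.
  suff : - (s3 * sin l) < sinh (s3 * l) by lra.
  apply: le_lt_trans (sinh_gt sl0).
  rewrite -mulrN ler_pM2l ?s3_gt0//; have := norm_sin_le l.
  by rewrite (ger0_norm (ltW l0)) ler_norml lerNl => /andP[].
have e1' : (s3 * D - C) * (q * Ch) + (s3 * C + D) * (p * Sh) = 0.
  by apply: (mulfI (lt0r_neq0 l0)); rewrite mulr0 -[RHS](mulr0 2) -e1; field.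
have pq : p ^+ 2 = 1 - q ^+ 2 by exact: cos2sin2.
have CS : Ch ^+ 2 = 1 + Sh ^+ 2 by exact: cosh2_sinh2.
split; apply: (mulIf D_neq0); rewrite mul0r.
  have -> : C * (s3 * (2 * q * p) + 2 * Sh * Ch) =
    2 * (s3 * (q * Ch) + p * Sh) * (C * (p * Ch) + D * (q * Sh))
    - 2 * (q * Sh) * ((s3 * D - C) * (q * Ch) + (s3 * C + D) * (p * Sh)) by ring: pq CS.
  by rewrite e0 e1' !mulr0 subr0.
have -> : D * (s3 * (2 * q * p) + 2 * Sh * Ch) =
    2 * (p * Ch) * ((s3 * D - C) * (q * Ch) + (s3 * C + D) * (p * Sh))
    - 2 * (s3 * (p * Sh) - q * Ch) * (C * (p * Ch) + D * (q * Sh)) by ring: pq CS.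
by rewrite e0 e1' !mulr0 subr0.
Qed.

Lemma modek_cont b l c k : contI (modek b l c k).
Proof. by apply: (@derI_cont _ _ (modek b l c k.+1)) => x _; exact: modek_derive. Qed.

Lemma modek_comb b l t c d k x :
  modek b l (c.1.1 + t * d.1.1, c.1.2 + t * d.1.2, c.2 + t * d.2) k x =
  modek b l c k x + t * modek b l d k x.
Proof.
have mE e c' d' : mfun e l (c'.1.1 + t * d'.1.1, c'.1.2 + t * d'.1.2, c'.2 + t * d'.2) x =
    mfun e l c' x + t * mfun e l d' x.
  by case: e; rewrite /mfun /=; ring.
rewrite /modek -mE; congr mfun; elim: k => //= k ->.
by case: (_ (+) _); rewrite /dcoef /=; congr (_, _, _); ring.
Qed.

Lemma modek0 b l k x : modek b l (0, 0, 0) k x = 0.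
Proof.
rewrite /modek (_ : coefk _ _ _ _ = (0, 0, 0)) ?mfun_0; last first.
  by elim: k => //= k ->; case: (_ (+) _); rewrite /dcoef /= !(mulr0, oppr0, addr0, subr0).
by case: (_ (+) _); rewrite /mfun /= !mul0r !addr0.
Qed.

Lemma sin_eq0_lambda l : 0 < l -> sin l = 0 -> exists m, l = lambda_s m.+1.
Proof.
move=> l0 sl; have p0 := pi_gt0 R.
have lp : 0 <= l / pi by rewrite divr_ge0 ?ltW.
have /andP[m1 m2] := truncn_itv lp; set m := Num.truncn _ in m1 m2.
move: m1 m2; rewrite ler_pdivlMr// ltr_pdivrMr// => m1 m2.
have : sin (m%:R * pi + (l - m%:R * pi)) = 0 by rewrite addrC subrK.
rewrite sinDmpi => /eqP; rewrite mulf_eq0 signr_eq0 /= => /eqP s0.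
have lm : l = m%:R * pi.
  apply/eqP; rewrite -subr_eq0; apply: contraPT s0 => lm.
  apply/eqP; rewrite gt_eqF// sin_gt0_pi// lt_def lm subr_ge0 m1 /=.
  by rewrite ltrBlDl -[X in _ + X]mul1r -mulrDl natr1.
case: m {m1 m2 s0} lm => [|m] lm; last by exists m.
by rewrite lm mul0r ltxx in l0.
Qed.

(** Subtracting the multiple of [anti_c l] with the same sine coefficient leaves a purely hyperbolic
    solution, which two end conditions annihilate. The third condition then makes l a root, unless
    the multiple is 0. *)
Lemma odd_clamped l c : 0 < l -> (forall k, (k < 3)%N -> modek false l c k 1 = 0) ->
  (forall k x, modek false l c k x = 0) \/
  exists m t, l = lambda_c m.+1 /\
    forall k x, modek false l c k x = t * modek false l (anti_c l) k x.
Proof.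
move=> l0 c0; have l00 := lt0r_neq0 l0.
have [H0 H1 H2] := anti_c_ends l0.
set a := anti_c l in H0 H1 H2 *; set t := l * c.1.1.
have dE k x : modek false l (0, c.1.2 + - t * a.1.2, c.2 + - t * a.2) k x =
    modek false l c k x - t * modek false l a k x.
  rewrite -[X in _ = _ + X]mulNr -modek_comb; congr (modek _ _ (_, _, _) _ _).
  by rewrite /t /a /anti_c /=; field.
have [||C0 D0] := @odd_lead0 l (c.1.2 + - t * a.1.2) (c.2 + - t * a.2) l0.
- by rewrite dE H0 c0// mulr0 subr0.
- by rewrite dE H1 c0// mulr0 subr0.
have cE k x : modek false l c k x = t * modek false l a k x.
  by apply/eqP; rewrite -subr_eq0 -dE C0 D0 modek0.
have [t0|t0] := eqVneq t 0; [left|right].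
  by move=> k x; rewrite cE t0 mul0r.
have : charF l = 0.
  have := c0 2%N isT; rewrite cE H2 => /eqP; rewrite mulf_eq0 (negPf t0) /=.
  rewrite mulf_eq0 (negPf l00) /= mulf_eq0 mulf_eq0 (negPf (lt0r_neq0 (@s3_gt0 R))) /=.
  case/orP => [/eqP//|]; rewrite invr_eq0 lt_eqF// subr_lt0.
  have sl0 : 0 < s3 * l by rewrite mulr_gt0// s3_gt0.
  apply: le_lt_trans (sinh_gt sl0).
  by rewrite ler_pM2l ?s3_gt0// sin_le// ltW.
move=> /char_c_eq0/(lambda_c_surj l0)[m lm].
by exists m, t.
Qed.

Lemma even_clamped l c : 0 < l -> (forall k, (k < 3)%N -> modek true l c k 1 = 0) ->
  (forall k x, modek true l c k x = 0) \/
  exists m t, l = lambda_s m.+1 /\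
    forall k x, modek true l c k x = t * modek true l (anti_s l) k x.
Proof.
move=> l0 c0; have l00 := lt0r_neq0 l0.
have [A0|A0] := eqVneq c.1.1 0; [left => k x|right].
  have cE : c = (0, c.1.2, c.2) by rewrite -A0; case: (c) => [[]].
  rewrite cE; have [||-> ->] := @even_lead0 l c.1.2 c.2 l0; rewrite -?cE ?c0//.
  exact: modek0.
have [m lm] : exists m, l = lambda_s m.+1.
  apply: (sin_eq0_lambda l0).
  have := c0 0%N isT; have := c0 1%N isT; have := c0 2%N isT.
  rewrite /modek /mfun /= !mulr1.
  set p := cos (l / 2); set q := sin (l / 2); set Ch := cosh _; set Sh := sinh _.
  set A := c.1.1; set C := c.1.2; set D := c.2 => e2 e1 e0.
  have sl0 : 0 < s3 * l / 2 by rewrite !mulr_gt0// ?s3_gt0 ?invr_gt0.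
  have pq : p ^+ 2 = 1 - q ^+ 2 by exact: cos2sin2.
  have CS : Ch ^+ 2 = 1 + Sh ^+ 2 by exact: cosh2_sinh2.
  have W0 : Sh ^+ 2 + q ^+ 2 != 0.
    rewrite gt_eqF// ltr_wpDr ?sqr_ge0// exprn_gt0//.
    exact: lt_trans (sinh_gt sl0).
  have s2 := @s3_sqr R.
  have aE : cos l = 1 - 2 * q ^+ 2 by rewrite cos_half -/p -/q pq; ring.
  have bE : sin l = 2 * q * p by rewrite sin_half.
  apply: (mulfI A0); apply: (mulfI W0); apply: (mulfI (lt0r_neq0 (@s3_gt0 R))).
  rewrite !mulr0.
  pose E0 := A * cos l + (C * (p * Ch) + D * (q * Sh)).
  pose E1 := - 2 * A * sin l + ((s3 * D - C) * (q * Ch) + (s3 * C + D) * (p * Sh)).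
  pose E2 := - 2 * A * cos l + ((C + s3 * D) * (p * Ch) + (D - s3 * C) * (q * Sh)).
  have E0_0 : E0 = 0 by [].
  have E1_0 : E1 = 0.
    by apply: (mulfI l00); rewrite mulr0 -[RHS](mulr0 2) -e1 /E1; field.
  have E2_0 : E2 = 0.
    by apply: (mulfI (expf_neq0 2 l00)); rewrite mulr0 -[RHS](mulr0 2) -e2 /E2; field: s2.
  (* Elimination of C and D from the three end conditions leaves a multiple of A sin l. The equation
     sin l = 0 must come first, since the end conditions of [anti_s l] are established at multiples
     of pi. *)
  have -> : s3 * ((Sh ^+ 2 + q ^+ 2) * (A * sin l)) =
     (Ch * Sh - s3 * (p * q)) * E0 - s3 / 2 * (p ^+ 2 * Ch ^+ 2 + q ^+ 2 * Sh ^+ 2) * E1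
     + (s3 * (p * q) + Ch * Sh) / 2 * E2.
    by rewrite /E0 /E1 /E2 aE bE; field: pq CS s2.
  by rewrite E0_0 E1_0 E2_0 !mulr0 subr0 addr0.
have [_ _ _ H _] := @sin_mode_chain R m; rewrite -lm in H.
exists m, (- l * c.1.1); split=> // k x.
set a := anti_s l in H *; set t := - l * c.1.1.
have dE j y : modek true l (0, c.1.2 + - t * a.1.2, c.2 + - t * a.2) j y =
    modek true l c j y - t * modek true l a j y.
  rewrite -[X in _ = _ + X]mulNr -modek_comb; congr (modek _ _ (_, _, _) _ _).
  by rewrite /t /a /anti_s /=; field.
have [||C0 D0] := @even_lead0 l (c.1.2 + - t * a.1.2) (c.2 + - t * a.2) l0.
- by rewrite dE (H 0%N isT).1 c0// mulr0 subr0.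
- by rewrite dE (H 1%N isT).1 c0// mulr0 subr0.
by apply/eqP; rewrite -subr_eq0 -dE C0 D0 modek0.
Qed.

(* The antiderivative of psi i that vanishes at both ends; junk for Cmode 0. *)
Definition anti (i : mode) : nat -> R -> R :=
  match i with
  | Cmode m => modek false (lambda_c m) (anti_c (lambda_c m))
  | Smode k => modek true (lambda_s k.+1) (anti_s (lambda_s k.+1))
  end.

Lemma lambda_c_gt0 m : 0 < lambda_c m.+1 :> R.
Proof.
by have [/andP[h _] _] := @lambda_c_root R m; apply: lt_trans h; rewrite mulr_gt0// ?pi_gt0// ltr0n.
Qed.

(** The modes with nonzero eigenvalue, which are those with a clamped antiderivative. *)
Definition pos_mode (i : mode) := if i is Cmode 0 then False else True.

Lemma mode_chainP i : pos_mode i -> mode_chain (eigval i) (anti i) (psi i) (phi i).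
Proof.
case: i => [[//|m]|k] _; last exact: sin_mode_chain.
by apply: cos_mode_chain; [exact: lambda_c_gt0|case: (@lambda_c_root R m)].
Qed.

Lemma anti_complete f : contI f -> (forall i, pos_mode i -> inner f (anti i 0%N) = 0) ->
  forall x, I11 x -> f x = 0.
Proof.
move=> cf fa; apply: (clamped_complete cf) => L E L0 cE EE.
pose l := expR (ln L / 6).
have l0 : 0 < l by exact: expR_gt0.
have l6 : l ^+ 6 = L by rewrite -expRM_natl mulr_natl -mulrnAr -mulr_natl mulfV// mulr1 lnK.
have [dE cE6 bE] := cE; rewrite -l6 in EE.
have [ce [co Es]] := ode_solution l0 dE EE.
have sp : forall k, (k < 3)%N -> modek true l ce k 1 = 0 /\ modek false l co k 1 = 0.
  apply: clamped_split => k x k3 xE; rewrite -Es ?(leq_trans k3)//.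
    by case: xE => ->; [exact: (bE k k3).1|exact: (bE k k3).2].
  by case: xE => ->; [exact: I11_1|exact: I11_N1].
have z b c : (forall k x, modek b l c k x = 0) -> inner f (modek b l c 0) = 0.
  move=> c0; rewrite innerC -[RHS](@inner0l _ f); apply: eq_inner => // x _; exact: c0.
have Lf := contI_inL2 cf.
have -> : inner f (E 0%N) = inner f (modek true l ce 0) + inner f (modek false l co 0).
  rewrite -innerDr//; first by apply: eq_inner => // x Ix; rewrite Es.
  - exact/contI_inL2/modek_cont.
  - exact/contI_inL2/modek_cont.
rewrite [X in X + _](_ : _ = 0) ?add0r.
  have [/z//|[m [t [lm cE']]]] := odd_clamped l0 (fun k k3 => (sp k k3).2).
  rewrite (eq_inner (f' := f) (g' := fun x => t * anti (Cmode m.+1) 0%N x))//; last first.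
    by move=> x _; rewrite cE' lm.
  have La : inL2 (anti (Cmode m.+1) 0%N) by apply: contI_inL2; exact: modek_cont.
  by rewrite innerZr// fa// mulr0.
have [/z//|[m [t [lm cE']]]] := even_clamped l0 (fun k k3 => (sp k k3).1).
rewrite (eq_inner (f' := f) (g' := fun x => t * anti (Smode m) 0%N x))//; last first.
  by move=> x _; rewrite cE' lm.
have La : inL2 (anti (Smode m) 0%N) by apply: contI_inL2; exact: modek_cont.
by rewrite innerZr// fa// mulr0.
Qed.

End ClampedEigenfunctions.

(** * Eigenfunctions and biorthogonality *)

Section Spectral.
Context {R : realType}.
Local Notation s3 := (Num.sqrt (3 : R)).
Implicit Types (l x : R) (i j : mode) (Y Z : nat -> R -> R).

Definition chain Y := forall k x, is_derive x 1 (Y k) (Y k.+1 x).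

Lemma chain_derive1n Y k n : chain Y -> derive1n n (Y k) = Y (k + n)%N.
Proof.
move=> cY; elim: n => [|n IH]; first by rewrite addn0.
rewrite derive1nS IH; apply/funext => x; rewrite derive1E addnS.
by have [_ ->] := cY (k + n)%N x.
Qed.

Lemma chain_cont Y k : chain Y -> contI (Y k).
Proof. by move=> cY; apply: (@derI_cont _ _ (Y k.+1)) => x _; exact: cY. Qed.

Lemma chain_derI Y k : chain Y -> derI (Y k) (Y k.+1).
Proof. by move=> cY x _; exact: cY. Qed.

Lemma chainZ Y (c : R) : chain Y -> chain (fun k x => c * Y k x).
Proof. by move=> cY k x; have ? := cY k x; deriv; ring. Qed.

Lemma chain_period Y (c : R) n : chain Y -> (forall x, Y n x = c * Y 0%N x) ->
  forall k x, Y (n + k)%N x = c * Y k x.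
Proof.
move=> cY Yn; elim=> [|k IH] x; first by rewrite addn0.
have [_ h1] := cY (n + k)%N x; have [_ h2] := chainZ c cY k x.
by rewrite addnS -h1 -h2; congr (derive _ _ _); apply/funext.
Qed.

Lemma chain_eigenfunction Y k l (bc : (R -> R) -> R -> Prop) : chain Y ->
  (forall x, Y 6%N x = - l ^+ 6 * Y 0%N x) -> (exists2 x, I11 x & Y k x <> 0) ->
  bc (Y k) (-1) /\ bc (Y k) 1 -> eigenfunction bc l (Y k).
Proof.
move=> cY Y6 nz b; split=> //.
- by move=> n x _ _; rewrite chain_derive1n//; case: (cY (k + n)%N x).
- by move=> x _; rewrite chain_derive1n// addnC (chain_period cY Y6); ring.
Qed.

Lemma neq0_witness b l c f : l != 0 -> c.1.1 = 1 -> f =1 mfun b l c -> exists2 x, I11 x & f x <> 0.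
Proof.
move=> l0 c1 fE; apply: contrapT => h.
have /(mfun_eq0 l0) : forall x, I11 x -> mfun b l c x = 0.
  by move=> x Ix; rewrite -fE; apply: contrapT => fx; apply: h; exists x.
by rewrite c1 => /eqP; rewrite oner_eq0.
Qed.

Lemma nonpos_mode i : ~ pos_mode i -> i = Cmode 0.
Proof. by case: i => [[|m]|k] // []. Qed.

Lemma psi_neq0 i : pos_mode i -> exists2 x, I11 x & psi i x <> 0 :> R.
Proof.
case: i => [[//|m]|k] _.
  apply: (neq0_witness (b := true) (lt0r_neq0 (lambda_c_gt0 m))); last first.
    by move=> x; apply: psi_c_formE; [exact: lambda_c_gt0|case: (@lambda_c_root R m)].
  by [].
have [l0 _ _ _ _] := @sin_mode_chain R k.
apply: (neq0_witness (b := false) (lt0r_neq0 l0)); last exact: psi_s_formE.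
by [].
Qed.

Lemma phi_neq0 i : pos_mode i -> exists2 x, I11 x & phi i x <> 0 :> R.
Proof.
case: i => [[//|m]|k] _.
  apply: (neq0_witness (b := true) (lt0r_neq0 (lambda_c_gt0 m))); last first.
    by move=> x; apply: phi_c_formE; [exact: lambda_c_gt0|case: (@lambda_c_root R m)].
  by [].
have [l0 _ _ _ _] := @sin_mode_chain R k.
apply: (neq0_witness (b := false) (lt0r_neq0 l0)); last exact: phi_s_formE.
by [].
Qed.

Definition poly_chain (k : nat) x : R :=
  match k with
  | 0 => x ^+ 4 - 2 * x ^+ 2 + 1
  | 1 => 4 * x ^+ 3 - 4 * x
  | 2 => 12 * x ^+ 2 - 4
  | 3 => 24 * x
  | 4 => 24
  | _ => 0
  end.

Lemma poly_chainP : chain poly_chain.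
Proof.
by do 5 ?[case=> [x|]; first by rewrite /poly_chain; deriv; ring] => k x; exact: dcst.
Qed.

Definition one_chain (k : nat) x : R := if k is 0%N then 1 else 0.

Lemma one_chainP : chain one_chain.
Proof. by case=> [|k] x; exact: dcst. Qed.

Lemma psi_eigenfunction i : eigenfunction bc_direct (eigval i) (psi i : R -> R).
Proof.
have [ip|ip] := pselect (pos_mode i).
  have [l0 cY Y6 bY [fE _]] := @mode_chainP R i ip.
  have := psi_neq0 ip; rewrite fE => nz; apply: (chain_eigenfunction cY Y6 nz).
  have b x : (x = 1 \/ x = -1) -> bc_direct (anti i 1) x.
    move=> xE; have z k : (k < 3)%N -> anti i k x = 0.
      by move=> /bY[? ?]; case: xE => ->.
    split; first exact: z.
      by rewrite (_ : derive1 _ = derive1n 1 (anti i 1))// chain_derive1n// z.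
    (* psi^(5) is the sixth derivative of the antiderivative, hence - l^6 times the antiderivative
       itself. *)
    by rewrite chain_derive1n// Y6 z// mulr0.
  by split; apply: b; [right|left].
rewrite (nonpos_mode ip); apply: (@chain_eigenfunction poly_chain 0%N) => //.
- exact: poly_chainP.
- by move=> x; rewrite /= expr0n oppr0 mul0r.
- exists 0; first by apply/I11P; apply/andP; split; lra.
  by rewrite /= !expr0n /= mulr0 subr0 add0r; apply/eqP; exact: oner_neq0.
- split; split; rewrite ?(chain_derive1n 0 _ poly_chainP)//=; try ring;
   by rewrite (_ : derive1 _ = derive1n 1 (poly_chain 0))// (chain_derive1n 0 1 poly_chainP) /=; ring.
Qed.

Lemma phi_eigenfunction i : eigenfunction bc_adjoint (eigval i) (phi i : R -> R).
Proof.
have [ip|ip] := pselect (pos_mode i).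
  have [l0 cY Y6 bY [_ fE]] := @mode_chainP R i ip.
  have cZ := chainZ (eigval i ^- 4) cY.
  have := phi_neq0 ip; rewrite fE => nz.
  apply: (@chain_eigenfunction (fun k x => eigval i ^- 4 * anti i k x) 5%N) => //.
    by move=> x; rewrite Y6; ring.
  have b x : (x = 1 \/ x = -1) -> bc_adjoint (fun x => eigval i ^- 4 * anti i 5%N x) x.
    move=> xE; have z k : (k < 3)%N -> eigval i ^- 4 * anti i (6 + k)%N x = 0.
      by move=> /bY[h1 h2]; rewrite (chain_period cY Y6); case: xE => ->; rewrite ?h1 ?h2 !mulr0.
    split; rewrite ?(chain_derive1n 5 _ cZ).
    - rewrite (_ : derive1 _ = derive1n 1 (fun x => eigval i ^- 4 * anti i 5%N x))//.
      by rewrite (chain_derive1n 5 1 cZ) (z 0%N).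
    - by rewrite (z 1%N).
    - by rewrite (z 2%N).
  by split; apply: b; [right|left].
rewrite (nonpos_mode ip); apply: (@chain_eigenfunction one_chain 0%N) => //.
- exact: one_chainP.
- by move=> x; rewrite /= expr0n oppr0 mul0r.
- by exists 0; [apply/I11P; apply/andP; split; lra|apply/eqP; exact: oner_neq0].
- by split; split; rewrite ?(chain_derive1n 0 _ one_chainP)//
    (_ : derive1 _ = derive1n 1 (one_chain 0))// (chain_derive1n 0 1 one_chainP).
Qed.

Lemma psi_cont i : contI (psi i : R -> R).
Proof.
have [ip|ip] := pselect (pos_mode i).
  by have [_ cY _ _ [-> _]] := @mode_chainP R i ip; exact: chain_cont.
by rewrite (nonpos_mode ip); exact: (@chain_cont poly_chain 0%N poly_chainP).
Qed.

Lemma phi_derI i : pos_mode i -> derI (phi i) (fun x : R => - eigval i ^+ 2 * anti i 0%N x).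
Proof.
move=> ip; have [l0 cY Y6 _ [_ ->]] := @mode_chainP R i ip => x _.
by apply: deq (chainZ _ cY 5 x) _; rewrite Y6; field; exact: lt0r_neq0.
Qed.

Lemma phi_cont i : contI (phi i : R -> R).
Proof.
have [ip|ip] := pselect (pos_mode i); first exact: derI_cont (phi_derI ip).
by rewrite (nonpos_mode ip); exact: (@contI_cst _ 1).
Qed.

Lemma inner_psi_phi i j : pos_mode i -> pos_mode j ->
  inner (psi i) (phi j) = eigval j ^+ 2 * inner (anti i 0%N) (anti j 0%N) :> R.
Proof.
move=> ip jp; have [_ cY _ bY [fE _]] := @mode_chainP R i ip.
have [_ cZ _ _ _] := @mode_chainP R j jp.
rewrite fE (inner_by_parts (chain_derI 0 cY) (phi_derI jp)).
- have [-> ->] := bY 0%N isT; rewrite !mul0r subrr sub0r.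
  rewrite innerZr; [ring|exact/contI_inL2/chain_cont..].
- exact: chain_cont.
- exact/contIZ/chain_cont.
Qed.

Lemma anti_sol i : pos_mode i -> sol (fun x : R => eigval i ^+ 6 * anti i 0%N x) (anti i).
Proof.
move=> ip; have [_ cY Y6 bY _] := @mode_chainP R i ip.
by split; [split=> // [k _|]; [exact: chain_derI|exact: chain_cont]|move=> x _; rewrite Y6; ring].
Qed.

(** Each sine eigenvalue is a multiple of pi, while the cosine eigenvalues lie strictly between such
    multiples, one in each interval. *)
Lemma eigval_inj i j : pos_mode i -> pos_mode j -> eigval i = eigval j :> R -> i = j.
Proof.
have p0 := pi_gt0 R.
have inj (m n : nat) (x : R) : m%:R * pi < x < m.+1%:R * pi -> n%:R * pi <= x < n.+1%:R * pi -> m = n.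
  move=> /andP[m1 m2] /andP[n1 n2]; apply/eqP; rewrite eqn_leq -ltnS -(ltnS n).
  have := lt_trans m1 n2; have := le_lt_trans n1 m2.
  by rewrite !ltr_pM2r// !ltr_nat => -> ->.
have cs (m k : nat) : lambda_c m.+1 <> lambda_s k.+1 :> R.
  move=> E; have [mI _] := @lambda_c_root R m.
  have mk : m.+1 = k.+1.
    by apply: inj mI _; rewrite E lexx /= ltr_pM2r// ltr_nat.
  by move: mI; rewrite E mk ltxx.
case: i j => [[//|m]|k] [[//|n]|j] _ _ /=.
- have [mI _] := @lambda_c_root R m; have [nI _] := @lambda_c_root R n => E.
  suff [->] : m.+1 = n.+1 by [].
  apply: inj mI _; have -> : lambda_c m.+1 = lambda_c n.+1 :> R by [].
  by case/andP: nI => /ltW -> ->.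
- by move=> /cs.
- by move=> /esym/cs.
- by move=> /(mulIf (lt0r_neq0 p0)) /eqP; rewrite eqr_nat => /eqP[->].
Qed.

Lemma eigval_gt0 i : pos_mode i -> 0 < eigval i :> R.
Proof. by move=> /(@mode_chainP R i)[]. Qed.

Lemma anti_orthogonal i j : pos_mode i -> pos_mode j -> i <> j ->
  inner (anti i 0%N) (anti j 0%N) = 0 :> R.
Proof.
move=> ip jp ij; have := sol_sym (anti_sol ip) (anti_sol jp).
have [_ cY _ _ _] := @mode_chainP R i ip; have [_ cZ _ _ _] := @mode_chainP R j jp.
have LY := contI_inL2 (@chain_cont (anti i) 0%N cY); have LZ := contI_inL2 (@chain_cont (anti j) 0%N cZ).
rewrite innerZl ?innerZr// => /eqP; rewrite -subr_eq0 -mulrBl mulf_eq0 subr_eq0.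
case/orP => [/eqP E|/eqP//]; case: ij; apply: eigval_inj => //.
by apply/eqP; rewrite -(@eqrXn2 _ 6) ?E// ltW// eigval_gt0.
Qed.

(* Pohozaev: x Y' satisfies the inhomogeneous equation with right-hand side
   -6 l^6 Y, and Green's identity for x Y' and Y yields the norm of Y. *)
Lemma inner_chain Y l : 0 < l -> chain Y -> (forall x, Y 6%N x = - l ^+ 6 * Y 0%N x) ->
  (forall k, (k < 3)%N -> Y k 1 = 0 /\ Y k (-1) = 0) ->
  inner (Y 0%N) (Y 0%N) = (Y 3%N 1 ^+ 2 + Y 3%N (-1) ^+ 2) / (6 * l ^+ 6).
Proof.
move=> l0 cY Y6 bY; have l00 := lt0r_neq0 l0.
(* This is the k-th derivative of x Y'. The first factor in J is [u 5] with Y^(6) replaced through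
   the equation. *)
pose u k x := x * Y k.+1 x + k%:R * Y k x.
pose J x := (- l ^+ 6 * (x * Y 0%N x) + 5 * Y 5%N x) * Y 0%N x - u 4%N x * Y 1%N x
  + u 3%N x * Y 2%N x - u 2%N x * Y 3%N x + u 1%N x * Y 4%N x - u 0%N x * Y 5%N x.
have dJ : derI J (fun x => - (6 * l ^+ 6) * (Y 0%N x * Y 0%N x)).
  move=> x _; have ? := cY 0%N x; have ? := cY 1%N x; have ? := cY 2%N x.
  have ? := cY 3%N x; have ? := cY 4%N x; have := cY 5%N x; rewrite Y6 => ?.
  by rewrite /J /u; deriv; ring.
have cYY : contI (fun x => Y 0%N x * Y 0%N x) by apply: contIM; exact: chain_cont.
have := Rintegral_derI dJ (contIZ cYY).
rewrite RintegralZl; [|exact: measurable_I11|exact: contI_integrable].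
rewrite -[\int[_]_(x in _) _]/(inner (Y 0%N) (Y 0%N)) /J /u.
have [z0 y0] := bY 0%N isT; have [z1 y1] := bY 1%N isT; have [z2 y2] := bY 2%N isT.
rewrite z0 y0 z1 y1 z2 y2 => h.
have l6 : 6 * l ^+ 6 != 0 by rewrite mulf_neq0// expf_neq0.
apply: (mulfI l6); rewrite [RHS]mulrC divfK//.
by apply: oppr_inj; rewrite -mulNr h; ring.
Qed.

Lemma inner_anti i : pos_mode i ->
  inner (anti i 0%N) (anti i 0%N) = (anti i 3 1 ^+ 2) / (3 * eigval i ^+ 6) :> R.
Proof.
move=> ip; have [l0 cY Y6 bY _] := @mode_chainP R i ip; rewrite (inner_chain l0 cY Y6 bY).
have -> : anti i 3 (-1) ^+ 2 = anti i 3 1 ^+ 2 :> R.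
  by case: (i) => [m|k]; rewrite /anti /modek mfunN /= ?expr1 ?expr0; ring.
by field; rewrite lt0r_neq0.
Qed.

Definition const i : R := match i with Cmode m => c_const m | Smode k => s_const k.+1 end.

Lemma inner_psi_phi_const i : inner (psi i) (phi i) = const i.
Proof.
have [ip|ip] := pselect (pos_mode i).
  rewrite inner_psi_phi// inner_anti//; have l0 := eigval_gt0 ip.
  have -> : const i = anti i 3 1 ^+ 2 / (3 * eigval i ^+ 4).
    case: i ip l0 => [[//|m]|k] _ l0; last exact: s_formE.
    by apply: c_formE => //; case: (@lambda_c_root R m).
  by field; rewrite lt0r_neq0.
rewrite (nonpos_mode ip) /= /inner.
have d : derI (fun x : R => x ^+ 5 / 5 - 2 * x ^+ 3 / 3 + x) (fun x => psi_c 0 x * phi_c 0 x).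
  by move=> x _; rewrite /psi_c /phi_c; deriv; field.
rewrite (Rintegral_derI d); last by apply: contIM; [exact: (@psi_cont (Cmode 0))|exact: (@phi_cont (Cmode 0))].
by field.
Qed.

(** Against phi_0 = 1, psi integrates to the difference of two zero end values. For psi_0 against
    phi_j, five integrations by parts end at the fifth derivative of a quartic; the boundary terms
    vanish through psi_0 = psi_0' = 0 at first and through the clamped conditions afterwards. *)
Lemma biorthogonal_offdiag i j : i <> j -> inner (psi i) (phi j) = 0 :> R.
Proof.
move=> ij; have [ip|ip] := pselect (pos_mode i); have [jp|jp] := pselect (pos_mode j).
- by rewrite inner_psi_phi// anti_orthogonal// mulr0.
- rewrite (nonpos_mode jp); have [_ cY _ bY [fE _]] := @mode_chainP R i ip.
  rewrite fE (inner_by_parts (chain_derI 0 cY) (chain_derI 0 one_chainP)); try exact: chain_cont.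
    have [-> ->] := bY 0%N isT.
    by rewrite innerC [inner _ _](@inner0l _ (anti i 0%N)) !mul0r !subr0.
  exact/chain_cont/one_chainP.
- rewrite (nonpos_mode ip); have [_ cZ _ bY [_ fE]] := @mode_chainP R j jp.
  have bp k n : inner (poly_chain k) (anti j n.+1) =
      poly_chain k 1 * anti j n 1 - poly_chain k (-1) * anti j n (-1) - inner (poly_chain k.+1) (anti j n).
    rewrite innerC (inner_by_parts (chain_derI n cZ) (chain_derI k poly_chainP)).
    + by rewrite innerC; ring.
    + exact: chain_cont.
    + exact/chain_cont/poly_chainP.
  have L0 := contI_inL2 (@chain_cont poly_chain 0%N poly_chainP).
  have L5 := contI_inL2 (@chain_cont (anti j) 5%N cZ).
  rewrite fE -[psi _]/(poly_chain 0) (innerZr _ L5 L0).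
  rewrite !bp; have [-> ->] := bY 0%N isT; have [-> ->] := bY 2%N isT.
  have [-> ->] := bY 1%N isT.
  have -> : inner (poly_chain 5) (anti j 0%N) = 0 by exact: inner0l.
  by rewrite /poly_chain; ring.
- by case: ij; rewrite (nonpos_mode ip) (nonpos_mode jp).
Qed.

End Spectral.

(** * Density of continuously differentiable functions *)

Section Density.
Context {R : realType}.
Implicit Types (f g : R -> R) (x t : R).
Local Notation mu := (@lebesgue_measure R).

(** The signed square root, inverse of t |t|. It carries an approximation of f |f| in L^1 to one of
    f in L^2. *)
Let ssqrt t := Num.sqrt t - Num.sqrt (- t).

Let ssqrt_continuous : continuous ssqrt.
Proof.
move=> t; apply: continuousB; first exact: sqrt_continuous.
by apply: continuous_comp; [exact: oppr_continuous|exact: sqrt_continuous].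
Qed.

Let ssqrtK t : ssqrt (t * `|t|) = t.
Proof.
rewrite /ssqrt; have [t0|t0] := ger0P t.
  by rewrite (@ler0_sqrtr _ (- _)) ?oppr_le0 ?mulr_ge0// subr0 -expr2 sqrtr_sqr ger0_norm.
rewrite ler0_sqrtr ?sub0r ?nmulr_rle0// ?oppr_ge0 ?ltW//.
by rewrite mulrN opprK -expr2 sqrtr_sqr ltr0_norm// opprK.
Qed.

(** Hoelder continuity of exponent 1/2 bounds the squared L^2 distance after the signed root by
    twice the L^1 distance before it. *)
Let ssqrt_dist (a b : R) : (ssqrt a - ssqrt b) ^+ 2 <= 2 * `|a - b|.
Proof.
wlog ab : a b / b <= a.
  move=> W; have [/W//|/ltW/W h] := leP b a.
  by rewrite distrC -sqrrN opprB.
rewrite (ger0_norm (x := a - b)) ?subr_ge0// /ssqrt.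
have [a0|a0] := leP 0 a; have [b0|b0] := leP 0 b.
- rewrite (@ler0_sqrtr _ (- a)) ?(@ler0_sqrtr _ (- b)) ?oppr_le0// !subr0.
  have := sqr_sqrtr a0; have := sqr_sqrtr b0; have := sqrtr_ge0 a; have := sqrtr_ge0 b.
  have : Num.sqrt b <= Num.sqrt a by rewrite ler_sqrt.
  by nra.
- rewrite (@ler0_sqrtr _ (- a)) ?(@ler0_sqrtr _ (b)) ?oppr_le0// ?(ltW b0)// subr0.
  have b0' : 0 <= - b by rewrite oppr_ge0 ltW.
  have := sqr_sqrtr a0; have := sqr_sqrtr b0'.
  have := sqr_ge0 (Num.sqrt a - Num.sqrt (- b)); nra.
- lra.
- rewrite (@ler0_sqrtr _ (a) (ltW a0)) (@ler0_sqrtr _ (b) (ltW b0)) !sub0r.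
  have a0' : 0 <= - a by rewrite oppr_ge0 ltW.
  have b0' : 0 <= - b by rewrite oppr_ge0 ltW.
  have := sqr_sqrtr a0'; have := sqr_sqrtr b0'.
  have := sqrtr_ge0 (- a); have := sqrtr_ge0 (- b).
  have : Num.sqrt (- a) <= Num.sqrt (- b) by rewrite ler_sqrt// lerN2.
  by nra.
Qed.

Lemma continuous_dense f (e : R) : inL2 f -> 0 < e ->
  exists2 g, continuous g & nrm (fun x => f x - g x) <= e.
Proof.
move=> Lf e0; have /inL2E[mf sf] := Lf; have mI := @measurable_I11 R.
have iF : mu.-integrable I11 (EFin \o (fun x => f x * `|f x|)).
  apply: le_integrable sf => //.
    by apply/measurable_EFinP; apply: measurable_funM => //; exact: measurableT_comp.
  by move=> x _ /=; rewrite lee_fin normrM normr_id -normrM -expr2.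
have fI : (mu I11 < +oo)%E by rewrite /I11 lebesgue_measure_itv/= ifT ?ltry// lte_fin; lra.
have [G [cG iG]] := approximation_continuous_integrable mI fI iF.
have e2 : 0 < e ^+ 2 / 2 by rewrite divr_gt0// exprn_gt0.
move=> /fine_cvgP[fin /cvgrPdist_le /(_ _ e2)] near0.
have [n [nfin nle]] : exists n, (\int[mu]_(z in I11) `|(f z * `|f z| - G n z)%:E| \is a fin_num)%E /\
    `|0 - fine (\int[mu]_(z in I11) `|(f z * `|f z| - G n z)%:E|)%E| <= e ^+ 2 / 2.
  have [N1 _ h1] := fin; have [N2 _ h2] := near0.
  by exists (maxn N1 N2); split; [apply: h1|apply: h2]; rewrite /= ?leq_maxl ?leq_maxr.
pose g := ssqrt \o G n.
have cg : continuous g.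
  by move=> x; apply: continuous_comp; [exact: cG|exact: ssqrt_continuous].
exists g => //.
have Lg : inL2 g by apply: contI_inL2 => x _; exact: cg.
have Lfg := inL2B Lf Lg.
have e0' := ltW e0.
rewrite -(@ler_pXn2r _ 2)// ?nnegrE ?nrm_ge0// nrm2.
have iFG : mu.-integrable I11 (EFin \o (fun z => f z * `|f z| - G n z)).
  rewrite (_ : EFin \o _ = ((EFin \o (fun x => (f x * `|f x|)%R)) \- (EFin \o G n))%E); last first.
    by apply/funext.
  exact: integrableB.
have iabs : mu.-integrable I11 (EFin \o (fun z => `|f z * `|f z| - G n z|)).
  exact: integrable_norm.
apply: (@le_trans _ _ (\int[mu]_(z in I11) (2 * `|f z * `|f z| - G n z|))).
  apply: le_Rintegral => //.
  - exact: inL2M_integrable.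
  - rewrite (_ : EFin \o _ = (fun x => 2%:E * (EFin \o (fun z => `|f z * `|f z| - G n z|%R)) x)%E)//.
    exact: integrableZl.
  - move=> x _; rewrite -expr2 /g -[f x in X in X <= _]ssqrtK; exact: ssqrt_dist.
rewrite RintegralZl//; move: nle; rewrite sub0r normrN /Rintegral => h.
by have := le_trans (ler_norm _) h; lra.
Qed.

Definition smooth f := exists2 f', derI f f' & contI f'.

Lemma smooth_dense f (e : R) : inL2 f -> 0 < e ->
  exists2 v, smooth v & nrm (fun x => f x - v x) <= e.
Proof.
move=> Lf e0; have e2 : 0 < e / 4 by rewrite divr_gt0.
have [g cg fg] := continuous_dense Lf e2.
have cgI : contI g by move=> x _; exact: cg.
have [G [dG _]] := primitive cgI.
(* The mean of g over the window of half-width d around (1 - d) x; contracting the centre keeps the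
   window inside [-1, 1]. *)
pose h d x := (G ((1 - d) * x + d) - G ((1 - d) * x - d)) / (2 * d).
have /compact_near_coveringP ncI : compact (I11 : set R) by exact: segment_compact.
(* The estimate holds for z near a given point and d small; compactness makes the range of d
   uniform. *)
have small : \forall d \near 0^'+, I11 `<=` (fun x => I11 x -> `|g x - h d x| <= e / 4).
  apply: ncI => x Ix.
  have e8 : 0 < e / 8 by rewrite divr_gt0.
  have /cvgrPdist_le/(_ _ e8)[r /= r0 rP] := cg x.
  have r4 : 0 < r / 4 by rewrite divr_gt0.
  near=> z d => /= /I11P/andP[z1 z2].
  have zx : `|x - z| < r / 4 by near: z; exists (r / 4).
  have d0 : 0 < d by near: d; exact: nbhs_right_gt.
  have d1 : d <= 1 by near: d; apply: nbhs_right_le; lra.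
  have dr : d <= r / 4 by near: d; exact: nbhs_right_le.
  have a1 : -1 <= (1 - d) * z - d by nra.
  have ab : (1 - d) * z - d <= (1 - d) * z + d by lra.
  have b1 : (1 - d) * z + d <= 1 by nra.
  have [c /andP[ac cb] E] := derI_MVT dG a1 ab b1.
  have -> : h d z = g c by rewrite /h E; field; exact: lt0r_neq0.
  have xc : `|x - c| < r.
    move: zx; rewrite !ltr_norml => /andP[h1 h2]; apply/andP.
    have /andP[k1 k2] : - d <= d * z <= d.
      by rewrite -{1}[d]mulr1 -[X in _ <= _ <= X]mulr1 -mulrN !ler_pM2l ?z1.
    by split; lra.
  have h1 := rP c xc; have h2 : `|g x - g z| <= e / 8 by apply: rP; apply: lt_trans zx _; lra.
  rewrite (_ : g z - g c = (g x - g c) - (g x - g z)); last by ring.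
  by apply: le_trans (ler_normB _ _) _; lra.
have [d [d0 d1 dP]] : exists d, [/\ 0 < d, d < 1 & forall x, I11 x -> `|g x - h d x| <= e / 4].
  near (0 : R)^'+ => d; exists d; split.
  - by near: d; exact: nbhs_right_gt.
  - by near: d; exact: nbhs_right_lt.
  - by move=> x Ix; exact: (near small d).
have sub (s : bool) x : I11 x -> I11 ((1 - d) * x + (-1) ^+ s * d).
  by move=> /I11P/andP[x1 x2]; apply/I11P; case: s; rewrite ?expr0 ?expr1; apply/andP; split; nra.
pose h' x := (1 - d) / (2 * d) * (g ((1 - d) * x + d) - g ((1 - d) * x - d)).
have dh : derI (h d) h'.
  move=> x Ix.
  have /dG d1' : I11 ((1 - d) * x + d) by have := sub false x Ix; rewrite expr0 mul1r.
  have /dG d2' : I11 ((1 - d) * x - d) by have := sub true x Ix; rewrite expr1 mulN1r.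
  have q1 : is_derive x 1 (fun x => (1 - d) * x + d) (1 - d) by deriv; ring.
  have q2 : is_derive x 1 (fun x => (1 - d) * x - d) (1 - d) by deriv; ring.
  have ? := @dcomp _ G (fun x => (1 - d) * x + d) _ _ _ d1' q1.
  have ? := @dcomp _ G (fun x => (1 - d) * x - d) _ _ _ d2' q2.
  by rewrite /h /h'; deriv; field; exact: lt0r_neq0.
have ch' : contI h'.
  have cL (c : R) : continuous (fun x => g ((1 - d) * x + c)).
    move=> x; apply: (@continuous_comp _ _ _ (fun x => (1 - d) * x + c) g); last exact: cg.
    by apply: continuousD; [exact: mulrl_continuous|exact: cst_continuous].
  by apply: contIZ; apply: contIB => x _; exact: cL.
exists (h d); first by exists h'.
have chd := derI_cont dh.
have gh : nrm (fun x => g x - h d x) <= e / 2.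
  have e2' : 0 <= e / 2 by rewrite divr_ge0 ?ltW.
  rewrite -(@ler_pXn2r _ 2)// ?nnegrE ?nrm_ge0// nrm2.
  apply: le_trans (inner_le_sup (M := (e / 4) ^+ 2) (contIB cgI chd) _) _.
    move=> x Ix; rewrite -(real_normK (num_real (_ - _))) ler_pXn2r ?nnegrE ?dP//.
    by rewrite ltW.
  by have := sqr_ge0 e; nra.
rewrite (eq_nrm (g := fun x => (f x - g x) + (g x - h d x))); last by move=> x _; ring.
apply: le_trans (nrmD _ _) _.
- exact/inL2B/contI_inL2.
- exact/inL2B/contI_inL2/chd/contI_inL2.
- by lra.
Unshelve. all: by end_near. Qed.

End Density.

(** * Perturbations of orthonormal systems *)

Section Synthesis.
Context {R : realType}.
Implicit Types (x : R) (m n N : nat) (a : nat -> R).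
Local Notation mu := (@lebesgue_measure R).

(* The comparison function 4 sqrt t / (sqrt t + sqrt m) dominates the integral
   of sqrt m / ((m + t) sqrt t). *)
Lemma schur_row m N :
  \sum_(n < N) Num.sqrt m.+1%:R / (Num.sqrt n.+1%:R * (m + n).+2%:R) <= 4 :> R.
Proof.
set u := Num.sqrt m.+1%:R; have u0 : 0 < u by rewrite sqrtr_gt0 ltr0n.
pose g n : R := 4 * (Num.sqrt n%:R / (Num.sqrt n%:R + u)).
have step n : u / (Num.sqrt n.+1%:R * (m + n).+2%:R) <= g n.+1 - g n.
  rewrite /g; set s := Num.sqrt n.+1%:R; set t := Num.sqrt n%:R.
  have s0 : 0 < s by rewrite sqrtr_gt0 ltr0n.
  have t0 : 0 <= t by exact: sqrtr_ge0.
  have s2 : s ^+ 2 = n.+1%:R by rewrite sqr_sqrtr ?ler0n.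
  have t2 : t ^+ 2 = n%:R by rewrite sqr_sqrtr ?ler0n.
  have u2 : u ^+ 2 = m.+1%:R by rewrite sqr_sqrtr ?ler0n.
  have ts : t <= s by rewrite ler_sqrt ?ler_nat.
  have -> : (m + n).+2%:R = u ^+ 2 + s ^+ 2 by rewrite u2 s2 -natrD addSn addnS.
  have st : s ^+ 2 - t ^+ 2 = 1 by rewrite s2 t2 -natr1; ring.
  have su := addr_gt0 s0 u0; have tu : 0 < t + u by rewrite ltr_wpDl.
  have -> : 4 * (s / (s + u)) - 4 * (t / (t + u)) = 4 * u * (s - t) / ((s + u) * (t + u)).
    by field; rewrite !lt0r_neq0.
  have P0 : 0 < s * (u ^+ 2 + s ^+ 2) by rewrite mulr_gt0// addr_gt0// exprn_gt0.
  rewrite ler_pdivrMr// mulrAC ler_pdivlMr ?mulr_gt0//.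
  have -> : 4 * u * (s - t) * (s * (u ^+ 2 + s ^+ 2)) = u * (2 * (u ^+ 2 + s ^+ 2)) * (2 * s * (s - t)) by ring.
  have h1 : 1 <= 2 * s * (s - t) by rewrite -[leLHS]st; have := sqr_ge0 (s - t); lra.
  have h2 : (s + u) * (t + u) <= 2 * (u ^+ 2 + s ^+ 2).
    apply: (@le_trans _ _ ((s + u) * (s + u))); first by rewrite ler_pM2l// lerD2r.
    by have := sqr_ge0 (s - u); nra.
  apply: (@le_trans _ _ (u * (2 * (u ^+ 2 + s ^+ 2)))); first by rewrite ler_pM2l.
  by rewrite ler_peMr// !mulr_ge0 ?addr_ge0 ?sqr_ge0// ltW.
apply: le_trans (ler_sum _ (fun (n : 'I_N) _ => step n)) _.
rewrite -(big_mkord xpredT (fun n => g n.+1 - g n)) telescope_sumr// {2}/g sqrtr0 mul0r mulr0 subr0.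
rewrite /g ler_piMr// ler_pdivrMr ?mul1r; first by rewrite lerDl ltW.
by rewrite ltr_wpDl ?sqrtr_ge0.
Qed.

(** Schur's test for Hilbert's kernel: |a m a n| is split by the inequality of the means with
    weights sqrt (m + 1) and sqrt (n + 1), and the row bound applies to both halves by symmetry. *)
Lemma schur a N :
  \sum_(m < N) \sum_(n < N) `|a m| * `|a n| / (m + n).+2%:R <= 4 * \sum_(m < N) a m ^+ 2.
Proof.
pose k m n : R := Num.sqrt m.+1%:R / (Num.sqrt n.+1%:R * (m + n).+2%:R).
have sum_k : \sum_(m < N) \sum_(n < N) a m ^+ 2 * k m n <= 4 * \sum_(m < N) a m ^+ 2.
  rewrite mulr_sumr; apply: ler_sum => m _; rewrite -mulr_sumr mulrC.
  by apply: ler_wpM2r; [exact: sqr_ge0|exact: schur_row].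
have step m n : `|a m| * `|a n| / (m + n).+2%:R <= (a m ^+ 2 * k m n + a n ^+ 2 * k n m) / 2.
  rewrite /k (addnC n m) -(real_normK (num_real (a m))) -(real_normK (num_real (a n))).
  set u := Num.sqrt m.+1%:R; set s := Num.sqrt n.+1%:R.
  have u0 : 0 < u by rewrite sqrtr_gt0 ltr0n.
  have s0 : 0 < s by rewrite sqrtr_gt0 ltr0n.
  move: `|a m| `|a n| => p q; have D0 : 0 < (m + n).+2%:R :> R by rewrite ltr0n.
  rewrite -subr_ge0.
  have -> : (p ^+ 2 * (u / (s * (m + n).+2%:R)) + q ^+ 2 * (s / (u * (m + n).+2%:R))) / 2
     - p * q / (m + n).+2%:R = (p * u - q * s) ^+ 2 / (2 * u * s * (m + n).+2%:R).
    by field; rewrite !lt0r_neq0.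
  by rewrite divr_ge0 ?sqr_ge0// ltW// !mulr_gt0.
apply: le_trans (ler_sum _ (fun (m : 'I_N) _ => ler_sum _ (fun (n : 'I_N) _ => step m n))) _.
under eq_bigr do rewrite -mulr_suml big_split /=.
rewrite -[X in X <= _]mulr_suml big_split /= [X in _ + X]exchange_big /=.
by move: sum_k; set T := \sum_(m < N) \sum_(n < N) _; lra.
Qed.

Lemma sinh_le_cosh (c : R) : `|sinh c| <= cosh c.
Proof.
rewrite -(@ler_pXn2r _ 2) ?nnegrE ?normr_ge0 ?(ltW (cosh_gt0 _))//.
by rewrite real_normK ?num_real// cosh2_sinh2 lerDr.
Qed.

(** The overlap of two boundary layers. The integrand is at most 2 cosh ((h + k) x) / cosh (h + k),
    whose integral is 4 tanh (h + k) / (h + k). *)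
Lemma cosh_kernel (h k : R) : 0 < h -> 0 < k ->
  inner (fun x => cosh (h * x) / cosh h) (fun x => cosh (k * x) / cosh k) <= 4 / (h + k).
Proof.
move=> h0 k0; have hk := addr_gt0 h0 k0.
have ch (c : R) : 0 < cosh c by exact: cosh_gt0.
pose f x := 2 / cosh (h + k) * cosh ((h + k) * x).
have cc (c d : R) : contI (fun x => d * cosh (c * x)).
  apply: (@derI_cont _ _ (fun x => d * (c * sinh (c * x)))) => x _; by deriv; ring.
have cc' (c : R) : contI (fun x => cosh (c * x) / cosh c).
  have -> : (fun x => cosh (c * x) / cosh c) = (fun x => (cosh c)^-1 * cosh (c * x)).
    by apply/funext => x; rewrite mulrC.
  exact: cc.
have df : derI (fun x => 2 / (cosh (h + k) * (h + k)) * sinh ((h + k) * x)) f.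
  move=> x _; rewrite /f; deriv; field.
  by rewrite !lt0r_neq0.
have cf : contI f by exact: cc.
apply: (@le_trans _ _ (\int[mu]_(x in I11) f x)).
  apply: le_Rintegral; [exact: measurable_I11|exact/contI_integrable/contIM|exact: contI_integrable|].
  move=> x _; rewrite /f [(h + k) * x]mulrDl !coshD.
  have pr (c d : R) : `|sinh c * sinh d| <= cosh c * cosh d.
    by rewrite normrM ler_pM// sinh_le_cosh.
  have := pr h k; have := pr (h * x) (k * x); rewrite !ler_norml => /andP[p1 _] /andP[_ p2].
  have sx : 0 <= sinh (h * x) * sinh (k * x).
    have [x0|x0] := leP 0 x; first by rewrite mulr_ge0 ?sinh_ge0// mulr_ge0// ltW.
    rewrite -[h * x]opprK -[k * x]opprK !(sinhN (- _)) mulrNN.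
    by rewrite mulr_ge0 ?sinh_ge0// -mulrN mulr_ge0 ?oppr_ge0// ltW.
  have -> : cosh (h * x) / cosh h * (cosh (k * x) / cosh k) =
     (cosh (h * x) * cosh (k * x)) / (cosh h * cosh k) by field; rewrite !lt0r_neq0.
  have D1 : 0 < cosh h * cosh k by rewrite mulr_gt0.
  have D2 : 0 < cosh h * cosh k + sinh h * sinh k.
    by rewrite ltr_wpDr// mulr_ge0 ?sinh_ge0 ?ltW.
  have gen (A B X Y : R) : 0 < A -> 0 < A + B -> B <= A -> 0 <= X -> 0 <= Y ->
      X / A <= 2 / (A + B) * (X + Y).
    move=> A0 AB BA X0 Y0; rewrite ler_pdivrMr//.
    have -> : 2 / (A + B) * (X + Y) * A = (2 * (X + Y) * A) / (A + B).
      by field; rewrite lt0r_neq0.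
    rewrite ler_pdivlMr// -subr_ge0.
    have -> : 2 * (X + Y) * A - X * (A + B) = X * (A - B) + 2 * (Y * A) by ring.
    by rewrite addr_ge0 ?mulr_ge0 ?subr_ge0// ltW.
  by apply: gen => //; rewrite mulr_ge0// ltW.
rewrite (Rintegral_derI df cf) mulr1 mulrN1 sinhN mulrN opprK.
set T := _ + _.
have -> : T = 4 / (h + k) * (sinh (h + k) / cosh (h + k)).
  by rewrite /T; field; rewrite !lt0r_neq0.
apply: ler_piMr; first by rewrite divr_ge0// ltW.
rewrite ler_pdivrMr// mul1r -subr_ge0 -expRNE; exact: expR_ge0.
Qed.

Section Family.
Variables (f e : nat -> R -> R) (h : nat -> R) (K : R).
Hypotheses (cf : forall m, contI (f m)) (ce : forall m, contI (e m)).
Hypothesis e_orth : forall m n, inner (e m) (e n) = (m == n)%:R.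
Hypothesis fe : forall m x, I11 x -> `|f m x - e m x| <= K * (cosh (h m * x) / cosh (h m)).
Hypothesis h_ge : forall m, m.+1%:R <= h m.

Let C : R := 2 + 32 * K ^+ 2.

(** The orthonormal part contributes the sum of squares. The Gram matrix of the errors is bounded by
    4 K^2 times Hilbert's kernel, which gives 16 K^2, and |E + D|^2 <= 2 |E|^2 + 2 |D|^2 accounts
    for the constant C. *)
Lemma synthesis a N : inner (fun x => \sum_(m < N) a m * f m x) (fun x => \sum_(m < N) a m * f m x)
  <= C * \sum_(m < N) a m ^+ 2.
Proof.
have Lf m := contI_inL2 (@cf m); have Le m := contI_inL2 (@ce m).
pose d m x := f m x - e m x; have cd m : contI (d m) by exact: contIB.
have Ld m := contI_inL2 (@cd m).
pose E x := \sum_(m < N) a m * e m x; pose D x := \sum_(m < N) a m * d m x.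
have LE : inL2 E by apply: inL2_sum => m; exact: inL2Z.
have LD : inL2 D by apply: inL2_sum => m; exact: inL2Z.
have gram g : (forall m, inL2 (g m)) ->
    inner (fun x => \sum_(m < N) a m * g m x) (fun x => \sum_(m < N) a m * g m x)
    = \sum_(m < N) \sum_(n < N) a m * a n * inner (g m) (g n).
  move=> Lg; have LS : inL2 (fun x => \sum_(m < N) a m * g m x).
    by apply: inL2_sum => m; exact: inL2Z.
  rewrite inner_suml//; last by move=> m; exact: inL2Z.
  apply: eq_bigr => m _; rewrite innerZl// innerC inner_suml//; last by move=> n; exact: inL2Z.
  by rewrite mulr_sumr; apply: eq_bigr => n _; rewrite innerZl// innerC mulrA.
have EE : inner E E = \sum_(m < N) a m ^+ 2.
  rewrite gram//; apply: eq_bigr => m _; rewrite (bigD1 m)//= e_orth eqxx mulr1 -expr2.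
  rewrite big1 ?addr0// => n nm; rewrite e_orth; case: eqVneq => [mn|_]; last by rewrite mulr0.
  by rewrite (val_inj mn) eqxx in nm.
have h0 m : 0 < h m by apply: lt_le_trans (h_ge m); rewrite ltr0n.
have dd m n : `|inner (d m) (d n)| <= K ^+ 2 * (4 / (m + n).+2%:R).
  apply: le_trans (_ : K ^+ 2 * inner (fun x => cosh (h m * x) / cosh (h m)) (fun x => cosh (h n * x) / cosh (h n)) <= _).
    have cc (c : R) : contI (fun x => cosh (c * x) / cosh c).
      by apply: (@derI_cont _ _ (fun x => c * sinh (c * x) / cosh c)) => x _; deriv; field; exact/lt0r_neq0/cosh_gt0.
    rewrite /inner -RintegralZl; [|exact: measurable_I11|exact/contI_integrable/contIM].
    apply: le_trans (le_normr_Rintegral _ _) _; [exact: measurable_I11|exact/contI_integrable/contIM|].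
    apply: le_Rintegral; [exact: measurable_I11| | |].
    - have := contI_integrable (contIM (@cd m) (@cd n)); exact: integrable_norm.
    - exact/contI_integrable/contIZ/contIM.
    - move=> x Ix; rewrite normrM expr2 mulrACA; apply: ler_pM => //; exact: fe.
  apply: ler_wpM2l; first exact: sqr_ge0.
  apply: le_trans (cosh_kernel (h0 m) (h0 n)) _.
  rewrite ler_pM2l// lef_pV2 ?posrE ?addr_gt0 ?ltr0n//.
  by rewrite -addSn -addnS natrD lerD.
have DD : inner D D <= 16 * K ^+ 2 * \sum_(m < N) a m ^+ 2.
  rewrite gram//; apply: (@le_trans _ _ (\sum_(m < N) \sum_(n < N) 4 * K ^+ 2 * (`|a m| * `|a n| / (m + n).+2%:R))).
    apply: ler_sum => m _; apply: ler_sum => n _; apply: le_trans (ler_norm _) _.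
    rewrite !normrM; have := ler_wpM2l (mulr_ge0 (normr_ge0 (a m)) (normr_ge0 (a n))) (dd m n).
    by move=> H; apply: le_trans H _; rewrite le_eqVlt; apply/orP; left; apply/eqP; ring.
  under eq_bigr do rewrite -mulr_sumr.
  rewrite -mulr_sumr (_ : 16 * K ^+ 2 * _ = 4 * K ^+ 2 * (4 * \sum_(m < N) a m ^+ 2)); last by ring.
  by apply: ler_wpM2l; [rewrite mulr_ge0 ?sqr_ge0|exact: schur].
have -> : (fun x => \sum_(m < N) a m * f m x) = (fun x => E x + D x).
  by apply/funext => x; rewrite /E /D -big_split; apply: eq_bigr => m _; rewrite /d /=; ring.
have LS := inL2D LE LD; have LB := inL2B LE LD.
have := inner_ge0 (fun x => E x - D x).
rewrite innerBl ?innerBr ?innerDl ?innerDr//.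
rewrite (innerC D E) EE /C; move: DD; set S := \sum_(m < N) _; lra.
Qed.

(** The dual of the synthesis bound: the sum S of squares equals <u, F> for the synthesized F, so
    S^2 <= |u|^2 C S. *)
Lemma bessel u N : inL2 u -> \sum_(m < N) inner u (f m) ^+ 2 <= C * inner u u.
Proof.
move=> Lu; pose a m := inner u (f m); rewrite -/(a _).
set S := \sum_(m < N) _; have S0 : 0 <= S by apply: sumr_ge0 => m _; exact: sqr_ge0.
have Lf m := contI_inL2 (@cf m).
have LF : inL2 (fun x => \sum_(m < N) a m * f m x) by apply: inL2_sum => m; exact: inL2Z.
have SE : S = inner u (fun x => \sum_(m < N) a m * f m x).
  rewrite innerC inner_suml//; last by move=> m; exact: inL2Z.
  by apply: eq_bigr => m _; rewrite innerZl// [inner (f m) u]innerC /a expr2.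
have := cauchy_schwarz_sqr Lu LF; rewrite -SE => hS.
have := le_trans hS (ler_wpM2l (inner_ge0 u) (synthesis a N)); rewrite -/S => {}hS.
have [->|Sn0] := eqVneq S 0; first by rewrite mulr_ge0 ?inner_ge0// /C addr_ge0// mulr_ge0 ?sqr_ge0.
have Sp : 0 < S by rewrite lt_def Sn0.
by rewrite -(ler_pM2r Sp) -expr2; apply: le_trans hS _; rewrite le_eqVlt; apply/orP; left; apply/eqP; ring.
Qed.

End Family.
End Synthesis.

(** * Asymptotics of the eigenfunctions *)

Section Asymptotics.
Context {R : realType}.
Local Notation s3 := (Num.sqrt (3 : R)).
Implicit Types (l x a b A B : R) (m n : nat).

Lemma normM_le a b A B : `|a| <= A -> `|b| <= B -> `|a * b| <= A * B.
Proof. by move=> aA bB; rewrite normrM ler_pM. Qed.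

Lemma normD_le a b A B : `|a| <= A -> `|b| <= B -> `|a + b| <= A + B.
Proof. by move=> aA bB; apply: le_trans (ler_normD _ _) _; rewrite lerD. Qed.

Lemma normN_le a A : `|a| <= A -> `|- a| <= A.
Proof. by rewrite normrN. Qed.

Lemma normX_le a n : `|a| <= 1 -> `|a ^+ n| <= 1.
Proof. by move=> a1; rewrite normrX exprn_ile1. Qed.

Lemma norm_sin x : `|sin x| <= 1.
Proof. by rewrite ler_norml sin_geN1 sin_le1. Qed.

Lemma norm_cos x : `|cos x| <= 1.
Proof. by rewrite ler_norml cos_geN1 cos_le1. Qed.

Lemma s3_bounds : 17 / 10 <= s3 <= 7 / 4.
Proof.
have s0 := ltW (@s3_gt0 R); have s2 := @s3_sqr R.
apply/andP; split; rewrite -(@ler_pXn2r _ 2)// ?nnegrE; [lra|lra|lra|lra].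
Qed.

Lemma norm_s3 : `|s3| <= 2.
Proof. by rewrite ger0_norm ?(ltW (@s3_gt0 R))//; case/andP: s3_bounds => _; lra. Qed.

Lemma cosh_sub1 x : 0 <= x -> cosh x - 1 <= sinh x.
Proof.
move=> x0; rewrite lerBlDl -lerBlDr -expRNE -expR0 ler_expR; lra.
Qed.

Lemma mfun_approx (b : bool) l (C D K : R) x : `|C| + `|D| <= K / cosh (s3 * l / 2) ->
  `|mfun b l (1, C, D) x - (if b then cos (l * x) else sin (l * x))|
  <= K * (cosh (s3 * l / 2 * x) / cosh (s3 * l / 2)).
Proof.
move=> CD; have ch := cosh_gt0 (s3 * l / 2 * x).
have -> : mfun b l (1, C, D) x - (if b then cos (l * x) else sin (l * x)) =
  C * ((if b then cos (l * x / 2) else sin (l * x / 2)) * cosh (s3 * l / 2 * x))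
  + D * ((if b then sin (l * x / 2) else cos (l * x / 2)) * sinh (s3 * l / 2 * x)).
  by rewrite /mfun (mulrAC (s3 * l) x); case: b; rewrite /=; ring.
set c := cosh (s3 * l / 2 * x) in ch *.
apply: (@le_trans _ _ (`|C| * (1 * c) + `|D| * (1 * c))).
  apply: normD_le; apply: normM_le => //; apply: normM_le.
  - by case: b; [exact: norm_cos|exact: norm_sin].
  - by rewrite ger0_norm// ltW.
  - by case: b; [exact: norm_sin|exact: norm_cos].
  - exact: sinh_le_cosh.
by rewrite !mul1r -mulrDl [leRHS]mulrA [leRHS]mulrAC ler_pM2r.
Qed.

Section Large.
Variable l : R.
Hypothesis pl : pi <= l.

Let C7 : 7 <= cosh (s3 * l). Proof. exact: cosh_large. Qed.
Let l0 : 0 < l. Proof. exact: lt_le_trans (pi_gt0 R) pl. Qed.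
Let h0 : 0 < s3 * l / 2. Proof. by rewrite divr_gt0// mulr_gt0// s3_gt0. Qed.
Let Ch := cosh (s3 * l / 2).
Let Sh := sinh (s3 * l / 2).
Let C2 : cosh (s3 * l) = 2 * Ch ^+ 2 - 1.
Proof. by rewrite (cosh_half (s3 * l)) -/Ch -/Sh; have : Ch ^+ 2 = 1 + Sh ^+ 2 := cosh2_sinh2 _; lra. Qed.
Let Ch0 : 0 < Ch. Proof. exact: cosh_gt0. Qed.
Let Ch2 : 2 <= Ch. Proof. by rewrite -(@ler_pXn2r _ 2) ?nnegrE// ?(ltW Ch0)//; move: C7; rewrite C2; lra. Qed.
Let sn x : `|sin x| <= 1. Proof. exact: norm_sin. Qed.
Let cn x : `|cos x| <= 1. Proof. exact: norm_cos. Qed.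
Let nCh : `|Ch| <= Ch. Proof. by rewrite ger0_norm// ltW. Qed.
Let nSh : `|Sh| <= Ch. Proof. exact: sinh_le_cosh. Qed.
Let D_ge : Ch ^+ 2 / 2 <= `|s3 * sin l - sinh (s3 * l)|.
Proof.
rewrite distrC; apply: le_trans (ler_norm _).
have sl0 : 0 <= s3 * l by rewrite ltW// mulr_gt0// s3_gt0.
have := cosh_sub1 sl0; rewrite C2.
have : s3 * sin l <= 2 * 1.
  by apply: le_trans (ler_norm _) _; apply: normM_le; [exact: norm_s3|].
by move: C7; rewrite C2; lra.
Qed.

(** The source of the boundary layers: numerators of size cosh (s3 l / 2) over a denominator of the
    size of its square. *)
Let div_le (N K : R) : `|N| <= K * Ch -> `|N / (s3 * sin l - sinh (s3 * l))| <= 2 * K / Ch.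
Proof.
move=> NK; have D0 : 0 < `|s3 * sin l - sinh (s3 * l)|.
  by apply: lt_le_trans D_ge; rewrite divr_gt0// exprn_gt0.
rewrite normrM normfV ler_pdivrMr// mulrAC ler_pdivlMr//.
have K0 : 0 <= K by have := le_trans (normr_ge0 _) NK; rewrite pmulr_lge0.
apply: le_trans (ler_wpM2r (ltW Ch0) NK) _.
apply: le_trans (ler_wpM2l _ D_ge); last by rewrite mulr_ge0.
by rewrite le_eqVlt; apply/orP; left; apply/eqP; field.
Qed.

Lemma psi_cc_le : `|psi_cc l| <= 20 / Ch.
Proof.
have -> : 20 = 2 * 10 :> R by rewrite -natrM.
apply: div_le.
apply: (@le_trans _ _ (2 * 2 * 1 * 1 * Ch + 2 * (1 + 2) * 1 * Ch)); last lra.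
apply: normD_le; first by do 4 (apply: normM_le => //); [rewrite normrN ger0_norm|exact: norm_s3].
apply/normN_le; do 3 (apply: normM_le => //); first by rewrite ger0_norm.
by apply: normD_le => //; rewrite normrN ger0_norm.
Qed.

Lemma psi_ss_le : `|psi_ss l| <= 22 / Ch.
Proof.
have -> : 22 = 2 * 11 :> R by rewrite -natrM.
apply: div_le.
apply: (@le_trans _ _ ((3 * 1 + 1 + 3 * 1 * 1) * Ch + 2 * 2 * 1 * 1 * Ch)); last lra.
apply: normD_le.
  apply: normM_le => //; apply: normD_le; first apply: normD_le.
  - by apply: normM_le => //; rewrite normrN ger0_norm.
  - exact: normX_le.
  - by apply/normN_le; do 2 (apply: normM_le => //); [rewrite ger0_norm|exact: normX_le].
by do 4 (apply: normM_le => //); [rewrite ger0_norm|exact: norm_s3].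
Qed.

Lemma psi_sc_le : `|psi_sc l| <= 2 / Ch.
Proof.
rewrite /psi_sc -/Ch; apply: normM_le; last by rewrite normfV ger0_norm// ltW.
by rewrite -[leRHS]mulr1; apply: normM_le; [rewrite normrN ger0_norm|exact: normX_le].
Qed.

Lemma psi_cs_le : `|psi_cs l| <= 4 / Ch.
Proof.
rewrite /psi_cs -/Sh; have -> : 4 / Ch = 2 * (2 / Ch) by rewrite mulrA -natrM.
apply: normM_le.
  by rewrite -[leRHS]mulr1; apply: normM_le; [rewrite normrN ger0_norm|exact: normX_le].
have : Ch / 2 <= Sh by have := cosh_sub1 (ltW h0); have := Ch2; rewrite -/Ch -/Sh; lra.
have Sh0 : 0 < Sh by apply: lt_trans (sinh_gt h0).
by move=> h; rewrite normfV (ger0_norm (ltW Sh0)) -div1r ler_pdivrMr// mulrAC ler_pdivlMr//; lra.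
Qed.

(** Uniform positivity of the constants is what keeps the coefficients of the expansion bounded by
    inner products. The closed form has the limit 1, and sinh (s3 l) >= 6 already suffices. *)
Lemma c_form_ge : charF l = 0 -> 10^-1 <= c_form l.
Proof.
move=> Fl; rewrite c_formE_closed//.
have sl0 : 0 <= s3 * l by rewrite ltW// mulr_gt0// s3_gt0.
have Y6 : 6 <= sinh (s3 * l) by have := cosh_sub1 sl0; have := C7; lra.
set Y := sinh _ in Y6 *; set b := sin l; set a := cos l.
have /andP[_ s7] := s3_bounds; have s0 := @s3_gt0 R.
have sb : `|s3 * b| <= 7 / 4 * 1 by apply: normM_le; [rewrite ger0_norm// ltW|exact: norm_sin].
move: sb; rewrite mulr1 ler_norml => /andP[sb1 sb2].
have aY : 0 <= a ^+ 2 * Y by rewrite mulr_ge0 ?sqr_ge0//; lra.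
rewrite -(mulrA 3); move: (s3 * b) sb1 sb2 => t sb1 sb2.
by rewrite ler_ndivlMr; lra.
Qed.

End Large.
Definition hyp_c m : R := s3 * lambda_c m.+1 / 2.
Definition hyp_s m : R := s3 * lambda_s m.+1 / 2.
(** The frequency is the midpoint of the interval containing [lambda_c m.+1]: for large l the
    characteristic equation forces cos l to be nearly 0. *)
Definition trig_c m x : R := cos ((m%:R + 3 / 2) * pi * x).
Definition trig_s m x : R := sin (m.+1%:R * pi * x).

Lemma hyp_ge m l : m.+1%:R * pi <= l -> m.+1%:R <= s3 * l / 2.
Proof.
move=> lm; have /andP[s17 _] := s3_bounds; have p2 := pi_ge2 R.
have m0 : 0 < m.+1%:R :> R by rewrite ltr0n.
have l2 : 2 * m.+1%:R <= l by apply: le_trans lm; rewrite mulrC ler_pM2l.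
rewrite ler_pdivlMr// mulrC; apply: le_trans l2 _; rewrite ler_peMl//; last lra.
by apply: le_trans lm; rewrite mulr_ge0// ?pi_ge0// ltW.
Qed.

Lemma lambda_c_ge m : m.+1%:R * pi <= lambda_c m.+1 :> R.
Proof. by have [/andP[h _] _] := @lambda_c_root R m; exact: ltW. Qed.

Lemma pi_le_lambda m l : m.+1%:R * pi <= l -> (pi : R) <= l.
Proof. by apply: le_trans; rewrite ler_peMl ?pi_ge0// ler1n. Qed.

Lemma cos_lipschitz a b : `|cos a - cos b| <= `|a - b|.
Proof.
have -> : cos a - cos b = - (2 * (sin ((a + b) / 2) * sin ((a - b) / 2))).
  set u := (a + b) / 2; set v := (a - b) / 2.
  have -> : a = u + v by rewrite /u /v; field.
  have -> : b = u - v by rewrite /u /v; field.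
  by rewrite cosD cosB; ring.
rewrite normrN; apply: (@le_trans _ _ (2 * (1 * `|(a - b) / 2|))).
  by apply: normM_le; [rewrite ger0_norm|apply: normM_le; [exact: norm_sin|exact: norm_sin_le]].
by rewrite mul1r normrM normfV [`|2|]ger0_norm// mulrC divfK.
Qed.

(** The characteristic equation gives |cos l| <= 4 / cosh (s3 l). At distance t from the midpoint
    |cos l| = |sin t|, and |t| <= 2 |sin t| because cos >= 1/2 on [0, |t|]. *)
Lemma lambda_c_near m :
  `|lambda_c m.+1 - (m%:R + 3 / 2) * pi| <= 8 / cosh (hyp_c m) :> R.
Proof.
have [lI Fl] := @lambda_c_root R m; have pl := pi_le_lambda (lambda_c_ge m).
set l : R := lambda_c m.+1 in lI Fl pl *; set t := l - _.
have C7 := cosh_large pl; have Ch1 := cosh_ge1 (hyp_c m); have cl := norm_cos l.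
have CE : cosh (s3 * l) = 2 * cosh (hyp_c m) ^+ 2 - 1.
  by rewrite (cosh_half (s3 * l)) -/(hyp_c m) [in LHS]cosh2_sinh2 cosh2_sinh2; ring.
have clE : `|cos l| * (cosh (s3 * l) + cos l) = 2.
  have : cos l * (cosh (s3 * l) + cos l) = 2 by apply/eqP; rewrite -subr_eq0; apply/eqP.
  move: cl; rewrite ler_norml => /andP[c1 c2] E.
  have c0 : 0 <= cos l by nra.
  by rewrite (ger0_norm c0).
have cs : `|cos l| * cosh (s3 * l) <= 4.
  by move: cl clE; rewrite ler_norml => /andP[c1 c2]; have := normr_ge0 (cos l); nra.
have st : `|sin t| = `|cos l|.
  have -> : l = m.+1%:R * pi + (pi / 2 + t) by rewrite /t -natr1; field.
  by rewrite cosDmpi normrM normrX normrN1 expr1n mul1r addrC cosDpihalf normrN.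
have tI : - (pi / 2) < t < pi / 2.
  by case/andP: lI; rewrite -(natr1 m.+1) -(natr1 m) /t => l1 l2; apply/andP; split; lra.
have t2 : `|t| <= 2 * `|sin t|.
  have ct : 2^-1 <= cos `|t|.
    have cp : 0 < cos `|t|.
      by apply: cos_gt0_pihalf; case/andP: tI => t1 t2; have p0 := pi_gt0 R;
        case: (ger0P t) => ?; apply/andP; split; lra.
    have s47 : `|sin t| <= 4 / 7 by rewrite st; have := normr_ge0 (cos l); nra.
    have E := cos2sin2 `|t|.
    have sE : sin `|t| ^+ 2 = `|sin t| ^+ 2.
      by case: (ger0P t) => _; rewrite ?sinN ?sqrrN real_normK ?num_real.
    by have := normr_ge0 (sin t); nra.
  have d (s : R) : is_derive s 1 (fun s => 2 * sin s - s) (2 * cos s - 1) by deriv; ring.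
  have := ler_deriv (normr_ge0 t) d; rewrite sin0 mulr0 subr0 => h.
  have : 0 <= 2 * sin `|t| - `|t|.
    apply: h => s /andP[s0 st']; suff : cos `|t| <= cos s by lra.
    have tp : `|t| <= pi.
      by case/andP: tI => t1 t2; have p0 := pi_gt0 R; case: (ger0P t) => ?; lra.
    by apply: cos_le_pi => //; rewrite (le_trans st').
  have : sin `|t| <= `|sin t| by case: (ger0P t) => _; rewrite ?sinN ?ler_norm// -normrN ler_norm.
  lra.
rewrite ler_pdivlMr ?cosh_gt0//; rewrite st in t2.
have : cosh (hyp_c m) <= cosh (s3 * l) by rewrite CE; nra.
have := cosh_gt0 (hyp_c m); have := normr_ge0 t; have := normr_ge0 (cos l).
nra.
Qed.

(** The frequency error does not depend on x; since cosh >= 1 it fits under the same boundary layer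
    profile. *)
Lemma trig_c_near m x : I11 x -> `|cos (lambda_c m.+1 * x) - trig_c m x|
  <= 8 * (cosh (hyp_c m * x) / cosh (hyp_c m)).
Proof.
move=> /I11P/andP[x1 x2]; apply: le_trans (cos_lipschitz _ _) _.
have xn : `|x| <= 1 by rewrite ler_norml x1.
rewrite -mulrBl; apply: le_trans (normM_le (lambda_c_near m) xn) _.
rewrite mulr1 mulrA mulrAC -[leLHS]mulr1 ler_pM2l ?cosh_ge1//.
by rewrite divr_gt0// cosh_gt0.
Qed.

(* The error is a pair of boundary layers: cosh (h x) / cosh h decays like
   exp (- h (1 - |x|)). *)
Definition close_to (f e : nat -> R -> R) (h : nat -> R) : Prop :=
  forall m x, I11 x -> `|f m x - e m x| <= 80 * (cosh (h m * x) / cosh (h m)).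

(** 80 = 72 + 8: hyperbolic coefficients plus frequency error. The value 72 leaves room for the
    coefficients of phi, which combine those of psi. *)
Lemma close_c (C D : R -> R) (f : nat -> R -> R) :
  (forall m x, f m x = mfun true (lambda_c m.+1) (1, C (lambda_c m.+1), D (lambda_c m.+1)) x) ->
  (forall l, pi <= l -> `|C l| + `|D l| <= 72 / cosh (s3 * l / 2)) ->
  close_to f trig_c hyp_c.
Proof.
move=> fE CD m x Ix; rewrite fE.
have := mfun_approx true x (CD _ (pi_le_lambda (lambda_c_ge m))).
move=> h1; have h2 := trig_c_near m Ix.
have := normD_le h1 h2; rewrite addrA subrK -mulrDl -/(hyp_c m) => h.
by apply: le_trans h _; apply: ler_wpM2r; [rewrite divr_ge0// ltW ?cosh_gt0|lra].
Qed.

Lemma psi_c_close : close_to (fun m => psi_c m.+1) trig_c hyp_c.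
Proof.
apply: (@close_c (@psi_cc R) (@psi_ss R)).
  by move=> m x; apply: psi_c_formE; [exact: lambda_c_gt0|case: (@lambda_c_root R m)].
move=> l pl; have := psi_cc_le pl; have := psi_ss_le pl => h1 h2.
apply: le_trans (lerD h2 h1) _; rewrite -mulrDl ler_pM2r ?invr_gt0 ?cosh_gt0//; lra.
Qed.

Lemma phi_c_close : close_to (fun m => phi_c m.+1) trig_c hyp_c.
Proof.
apply: (@close_c (fun l => (s3 * psi_ss l - psi_cc l) / 2) (fun l => - (s3 * psi_cc l + psi_ss l) / 2)).
  by move=> m x; apply: phi_c_formE; [exact: lambda_c_gt0|case: (@lambda_c_root R m)].
move=> l pl; have h1 := psi_cc_le pl; have h2 := psi_ss_le pl.
have i2 : `|2^-1 : R| <= 2^-1 by rewrite ger0_norm.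
have b1 := normM_le (normD_le (normM_le norm_s3 h2) (normN_le h1)) i2.
have b2 := normM_le (normN_le (normD_le (normM_le norm_s3 h1) h2)) i2.
apply: le_trans (lerD b1 b2) _; have := cosh_gt0 (s3 * l / 2).
by rewrite -invr_gt0; set c := (cosh _)^-1; lra.
Qed.

Lemma close_s (C D : R -> R) (f : nat -> R -> R) :
  (forall m x, f m x = mfun false (lambda_s m.+1) (1, C (lambda_s m.+1), D (lambda_s m.+1)) x) ->
  (forall l, pi <= l -> `|C l| + `|D l| <= 72 / cosh (s3 * l / 2)) ->
  close_to f trig_s hyp_s.
Proof.
move=> fE CD m x Ix; rewrite fE.
have := mfun_approx false x (CD _ (pi_le_lambda (lexx (lambda_s m.+1)))).
rewrite -/(hyp_s m) => h; apply: le_trans h _.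
by apply: ler_wpM2r; [rewrite divr_ge0// ltW ?cosh_gt0|lra].
Qed.

Lemma psi_s_close : close_to (fun m => psi_s m.+1) trig_s hyp_s.
Proof.
apply: (@close_s (@psi_sc R) (@psi_cs R)); first by move=> m x; exact: psi_s_formE.
move=> l pl; have := psi_sc_le l; have := psi_cs_le pl => h1 h2.
apply: le_trans (lerD h2 h1) _; rewrite -mulrDl ler_pM2r ?invr_gt0 ?cosh_gt0//; lra.
Qed.

Lemma phi_s_close : close_to (fun m => phi_s m.+1) trig_s hyp_s.
Proof.
apply: (@close_s (fun l => - (psi_sc l + s3 * psi_cs l) / 2) (fun l => (s3 * psi_sc l - psi_cs l) / 2)).
  by move=> m x; exact: phi_s_formE.
move=> l pl; have h1 := psi_sc_le l; have h2 := psi_cs_le pl.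
have i2 : `|2^-1 : R| <= 2^-1 by rewrite ger0_norm.
have b1 := normM_le (normN_le (normD_le h1 (normM_le norm_s3 h2))) i2.
have b2 := normM_le (normD_le (normM_le norm_s3 h1) (normN_le h2)) i2.
apply: le_trans (lerD b1 b2) _; have := cosh_gt0 (s3 * l / 2).
by rewrite -invr_gt0; set c := (cosh _)^-1; lra.
Qed.

Lemma inner_trig (b : bool) (al be : R) : 0 < al -> 0 < be ->
  (if b then cos al = 0 /\ cos be = 0 else sin al = 0 /\ sin be = 0) ->
  inner (fun x => if b then cos (al * x) else sin (al * x))
        (fun x => if b then cos (be * x) else sin (be * x)) = (al == be)%:R.
Proof.
move=> al0 be0 ends; have cont (c : R) : contI (fun x => if b then cos (c * x) else sin (c * x)).
  apply: (@derI_cont _ _ (fun x => if b then - (c * sin (c * x)) else c * cos (c * x))) => x _.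
  by case: b {ends}; deriv; ring.
have cc := contIM (cont al) (cont be); rewrite /inner.
have [ab|ab] := eqVneq al be.
  rewrite -ab in cc *.
  have d : derI (fun x => (x + (if b then 1 else -1) * (sin (al * x) * cos (al * x)) / al) / 2)
      (fun x => (if b then cos (al * x) else sin (al * x)) * (if b then cos (al * x) else sin (al * x))).
    move=> x _; case: b {ends cont cc}; have := cos2sin2 (al * x) => c2; deriv; field: c2; exact: lt0r_neq0.
  rewrite (Rintegral_derI d cc) !mulr1 !mulrN1 sinN cosN.
  by rewrite [RHS]mulr1n; case: b ends {cont cc d} => [[-> _]|[-> _]]; rewrite !(mulr0, mul0r, oppr0, mulN1r, addr0); field.
have n0 : al ^+ 2 - be ^+ 2 != 0.
  by rewrite subr_sqr mulf_neq0 ?subr_eq0// lt0r_neq0// addr_gt0.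
have d : derI (fun x => (if b then al * (sin (al * x) * cos (be * x)) - be * (cos (al * x) * sin (be * x))
    else be * (sin (al * x) * cos (be * x)) - al * (cos (al * x) * sin (be * x))) / (al ^+ 2 - be ^+ 2))
    (fun x => (if b then cos (al * x) else sin (al * x)) * (if b then cos (be * x) else sin (be * x))).
  by move=> x _; case: b {ends cont cc}; deriv; field.
rewrite (Rintegral_derI d cc) !mulr1 !mulrN1 !sinN !cosN.
by case: b ends {cont cc d} => [[-> ->]|[-> ->]]; rewrite !(mulr0, mul0r, oppr0, subr0, addr0, mulr0n).
Qed.

Lemma trig_c_orthonormal m n : inner (trig_c m) (trig_c n) = (m == n)%:R.
Proof.
have p0 := pi_gt0 R.
have pos k : 0 < (k%:R + 3 / 2) * pi :> R by rewrite mulr_gt0// ltr_wpDl ?ler0n// divr_gt0.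
have c0 k : cos ((k%:R + 3 / 2) * pi) = 0 :> R.
  rewrite (_ : _ * pi = k.+1%:R * pi + pi / 2); last by rewrite -natr1; field.
  by rewrite cosDmpi cos_pihalf mulr0.
rewrite (inner_trig (b := true) (pos m) (pos n))// (inj_eq (mulIf (lt0r_neq0 p0))).
by rewrite (inj_eq (addIr _)) eqr_nat.
Qed.

Lemma trig_s_orthonormal m n : inner (trig_s m) (trig_s n) = (m == n)%:R.
Proof.
have p0 := pi_gt0 R.
have pos k : 0 < k.+1%:R * pi :> R by rewrite mulr_gt0// ltr0n.
have s0 k : sin (k.+1%:R * pi) = 0 :> R by rewrite -[_ * pi]addr0 sinDmpi sin0 mulr0.
by rewrite (inner_trig (b := false) (pos m) (pos n))// (inj_eq (mulIf (lt0r_neq0 p0))) eqr_nat eqSS.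
Qed.

Lemma trig_c_cont m : contI (trig_c m).
Proof.
apply: (@derI_cont _ _ (fun x => - (m%:R + 3 / 2) * pi * sin ((m%:R + 3 / 2) * pi * x))) => x _.
by rewrite /trig_c; deriv; ring.
Qed.

Lemma trig_s_cont m : contI (trig_s m).
Proof.
apply: (@derI_cont _ _ (fun x => m.+1%:R * pi * cos (m.+1%:R * pi * x))) => x _.
by rewrite /trig_s; deriv; ring.
Qed.

Lemma hyp_c_ge m : m.+1%:R <= hyp_c m.
Proof. exact/hyp_ge/lambda_c_ge. Qed.

Lemma hyp_s_ge m : m.+1%:R <= hyp_s m.
Proof. exact: hyp_ge. Qed.

Lemma const_ge i : 10^-1 <= const i :> R.
Proof.
case: i => [[|m]|k] /=; first lra.
  apply: c_form_ge; last by case: (@lambda_c_root R m).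
  exact/(pi_le_lambda (lambda_c_ge m)).
by apply: le_trans (s_form_ge k); lra.
Qed.

End Asymptotics.

(** * Convergence of the expansion *)

Section Expansion.
Context {R : realType}.
Implicit Types (u v f g : R -> R) (x e : R) (m n M N : nat) (i : mode).

Lemma smoothD f g : smooth f -> smooth g -> smooth (fun x => f x + g x).
Proof.
move=> [f' df cf'] [g' dg cg']; exists (fun x => f' x + g' x); last exact: contID.
by move=> x Ix; exact: dD (df x Ix) (dg x Ix).
Qed.

Lemma smoothZ (c : R) f : smooth f -> smooth (fun x => c * f x).
Proof.
move=> [f' df cf']; exists (fun x => c * f' x); last exact: contIZ.
by move=> x Ix; have ? := df x Ix; deriv; ring.
Qed.

Lemma smooth_sum (F : nat -> R -> R) N : (forall m, smooth (F m)) ->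
  smooth (fun x => \sum_(m < N) F m x).
Proof.
move=> sF; elim: N => [|N IH].
  under eq_fun do rewrite big_ord0.
  by exists (fun=> 0); [move=> x _; exact: dcst|exact: contI_cst].
by under eq_fun do rewrite big_ord_recr /=; exact: smoothD.
Qed.

Lemma smooth_cont f : smooth f -> contI f.
Proof. by move=> [f' df _]; exact: derI_cont df. Qed.

Lemma psi_smooth i : smooth (psi i : R -> R).
Proof.
have [ip|ip] := pselect (pos_mode i).
  have [_ cY _ _ [-> _]] := @mode_chainP R i ip.
  by exists (anti i 2); [exact: chain_derI|exact: chain_cont].
rewrite (nonpos_mode ip); exists (poly_chain 1); first exact: (@chain_derI _ poly_chain 0%N poly_chainP).
exact/chain_cont/poly_chainP.
Qed.

Lemma psi_inL2 i : inL2 (psi i : R -> R). Proof. exact/contI_inL2/psi_cont. Qed.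
Lemma phi_inL2 i : inL2 (phi i : R -> R). Proof. exact/contI_inL2/phi_cont. Qed.

Definition coef u i : R := (const i)^-1 * inner u (phi i).

Definition mode_sum (a b : nat -> R) N x : R :=
  \sum_(m < N) (a m * psi (Cmode m.+1) x + b m * psi (Smode m) x).

Lemma mode_sum_smooth a b N : smooth (mode_sum a b N).
Proof.
apply: (@smooth_sum (fun m x => a m * psi (Cmode m.+1) x + b m * psi (Smode m) x)).
by move=> m; apply: smoothD; exact/smoothZ/psi_smooth.
Qed.

Lemma partial_sumE u N : partial_sum u N = fun x => coef u (Cmode 0) * psi (Cmode 0) x
  + mode_sum (fun m => coef u (Cmode m.+1)) (fun m => coef u (Smode m)) N x.
Proof. by apply/funext => x; rewrite /partial_sum big_add1 /= big_mkord. Qed.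

Lemma partial_sum_smooth u N : smooth (partial_sum u N).
Proof.
by rewrite partial_sumE; apply: smoothD; [exact/smoothZ/psi_smooth|exact: mode_sum_smooth].
Qed.

Lemma partial_sum_inL2 u N : inL2 (partial_sum u N).
Proof. exact/contI_inL2/smooth_cont/partial_sum_smooth. Qed.

Lemma coefB u v i : inL2 u -> inL2 v -> coef (fun x => u x - v x) i = coef u i - coef v i.
Proof. by move=> Lu Lv; rewrite /coef innerBl//; [ring|exact: phi_inL2]. Qed.

Lemma partial_sumB u v N x : inL2 u -> inL2 v ->
  partial_sum (fun x => u x - v x) N x = partial_sum u N x - partial_sum v N x.
Proof.
move=> Lu Lv; rewrite !partial_sumE /mode_sum coefB//.
under eq_bigr do rewrite !coefB//.
rewrite mulrBl opprD addrACA; congr (_ + _); rewrite -sumrB; apply: eq_bigr => m _; ring.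
Qed.

Let C : R := 2 + 32 * 80 ^+ 2.
Let C_ge0 : 0 <= C. Proof. by rewrite /C; lra. Qed.

Lemma mode_sum_inL2 a b N : inL2 (mode_sum a b N).
Proof. exact/contI_inL2/smooth_cont/mode_sum_smooth. Qed.

Lemma sum_single (F : nat -> R) N k : (k < N)%N -> (forall m, m <> k -> F m = 0) ->
  \sum_(m < N) F m = F k.
Proof.
move=> kN F0; rewrite (bigD1 (Ordinal kN))//= big1 ?addr0// => j jk.
by apply: F0 => jE; case/eqP: jk; exact: val_inj.
Qed.

Lemma sum_tail (F : nat -> R) M N : (M <= N)%N ->
  \sum_(m < N) F m - \sum_(m < M) F m = \sum_(m < N) (if (m < M)%N then 0 else F m).
Proof.
move=> MN; rewrite -!(big_mkord xpredT F) -(big_mkord xpredT (fun m => if (m < M)%N then 0 else F m)).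
rewrite (big_cat_nat (n := M))//= [in RHS](big_cat_nat (n := M))//= addrAC subrr add0r.
rewrite [X in _ = X + _]big1_seq ?add0r.
  by apply: eq_big_nat => m /andP[Mm _]; rewrite ltnNge Mm.
by move=> m /=; rewrite mem_index_iota /= => mM; rewrite mM.
Qed.

Lemma mode_sum_le a b N : inner (mode_sum a b N) (mode_sum a b N)
  <= 2 * C * \sum_(m < N) (a m ^+ 2 + b m ^+ 2).
Proof.
pose A x := \sum_(m < N) a m * psi (Cmode m.+1) x.
pose B x := \sum_(m < N) b m * psi (Smode m) x.
have LA : inL2 A by apply: inL2_sum => m; exact/inL2Z/psi_inL2.
have LB : inL2 B by apply: inL2_sum => m; exact/inL2Z/psi_inL2.
have -> : mode_sum a b N = fun x => A x + B x.
  by apply/funext => x; rewrite /mode_sum big_split.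
have hA : inner A A <= C * \sum_(m < N) a m ^+ 2.
  apply: (synthesis _ trig_c_cont trig_c_orthonormal psi_c_close hyp_c_ge).
  by move=> m; exact: (@psi_cont _ (Cmode m.+1)).
have hB : inner B B <= C * \sum_(m < N) b m ^+ 2.
  apply: (synthesis _ trig_s_cont trig_s_orthonormal psi_s_close hyp_s_ge).
  by move=> m; exact: (@psi_cont _ (Smode m)).
have LS := inL2D LA LB; have LD := inL2B LA LB.
have := inner_ge0 (fun x => A x - B x).
rewrite innerBl ?innerBr ?innerDl ?innerDr// (innerC B A) big_split /= mulrDr; lra.
Qed.

Definition energy u N := \sum_(m < N) (coef u (Cmode m.+1) ^+ 2 + coef u (Smode m) ^+ 2).

(** 100 is the square of the bound 10 for the inverse constants. *)
Lemma coef_le u i : coef u i ^+ 2 <= 100 * inner u (phi i) ^+ 2.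
Proof.
rewrite /coef exprMn; apply: ler_wpM2r; first exact: sqr_ge0.
have c1 := @const_ge R i; have c0 : 0 < const i :> R by apply: lt_le_trans c1.
have -> : 100 = (10 : R) ^+ 2 by rewrite -natrX.
rewrite ler_pXn2r ?nnegrE ?invr_ge0 ?(ltW c0)//.
by rewrite -[leRHS]invrK lef_pV2 ?posrE.
Qed.

Lemma energy_le u N : inL2 u -> energy u N <= 200 * C * inner u u.
Proof.
move=> Lu; rewrite /energy big_split /=.
have hc : \sum_(m < N) inner u (phi (Cmode m.+1)) ^+ 2 <= C * inner u u.
  apply: (bessel _ trig_c_cont trig_c_orthonormal phi_c_close hyp_c_ge) => //.
  by move=> m; exact: (@phi_cont _ (Cmode m.+1)).
have hs : \sum_(m < N) inner u (phi (Smode m)) ^+ 2 <= C * inner u u.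
  apply: (bessel _ trig_s_cont trig_s_orthonormal phi_s_close hyp_s_ge) => //.
  by move=> m; exact: (@phi_cont _ (Smode m)).
have h1 : \sum_(m < N) coef u (Cmode m.+1) ^+ 2 <= 100 * \sum_(m < N) inner u (phi (Cmode m.+1)) ^+ 2.
  by rewrite mulr_sumr; apply: ler_sum => m _; exact: coef_le.
have h2 : \sum_(m < N) coef u (Smode m) ^+ 2 <= 100 * \sum_(m < N) inner u (phi (Smode m)) ^+ 2.
  by rewrite mulr_sumr; apply: ler_sum => m _; exact: coef_le.
by move: hc hs h1 h2; lra.
Qed.

Lemma partial_sum_bounded : exists2 K, 0 <= K &
  forall u N, inL2 u -> nrm (partial_sum u N) <= K * nrm u.
Proof.
pose k0 := 10 * nrm (phi (Cmode 0) : R -> R) * nrm (psi (Cmode 0) : R -> R).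
have k00 : 0 <= k0 by rewrite !mulr_ge0 ?nrm_ge0.
exists (k0 + 20 * C); first by rewrite addr_ge0// mulr_ge0.
move=> u N Lu; rewrite partial_sumE.
have LM := mode_sum_inL2 (fun m => coef u (Cmode m.+1)) (fun m => coef u (Smode m)) N.
apply: le_trans (nrmD (inL2Z _ (psi_inL2 _)) LM) _; rewrite mulrDl; apply: lerD.
  rewrite nrmZ; last exact: psi_inL2.
  rewrite /k0 (mulrAC _ (nrm (psi _))); apply: ler_wpM2r; first exact: nrm_ge0.
  rewrite /coef normrM -mulrA; apply: ler_pM => //.
    have c1 := @const_ge R (Cmode 0); have c0 : 0 < const (Cmode 0) :> R by apply: lt_le_trans c1.
    by rewrite ger0_norm ?invr_ge0 ?(ltW c0)// -[leRHS]invrK lef_pV2 ?posrE.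
  by rewrite mulrC; apply: cauchy_schwarz => //; exact: phi_inL2.
rewrite -(@ler_pXn2r _ 2) ?nnegrE ?nrm_ge0 ?mulr_ge0 ?nrm_ge0// nrm2 exprMn nrm2.
apply: le_trans (mode_sum_le _ _ _) _.
apply: le_trans (ler_wpM2l _ (energy_le N Lu)) _; first by rewrite mulr_ge0.
by rewrite le_eqVlt; apply/orP; left; apply/eqP; ring.
Qed.

(** By synthesis a tail is controlled by the growth of the energy beyond M. The energy is bounded by
    Bessel, and M brings it within d of its supremum. *)
Lemma partial_sum_cauchy u e : inL2 u -> 0 < e -> exists M, forall N, (M <= N)%N ->
  nrm (fun x => partial_sum u N x - partial_sum u M x) <= e.
Proof.
move=> Lu e0; have C1 : 0 < 2 * C + 1 by have := C_ge0; lra.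
pose d := e ^+ 2 / (2 * C + 1); have d0 : 0 < d by rewrite divr_gt0// exprn_gt0.
have hs : has_sup [set energy u N | N in setT].
  split; first by exists (energy u 0), 0%N.
  by exists (200 * C * inner u u) => _ [N _ <-]; exact: energy_le.
have [_ [M _ <-] EM] := sup_adherent d0 hs.
exists M => N MN.
have EN : energy u N <= sup [set energy u N | N in setT] by apply: sup_upper_bound => //; exists N.
pose tail (a : nat -> R) m := if (m < M)%N then 0 else a m.
have -> : (fun x => partial_sum u N x - partial_sum u M x) =
    mode_sum (tail (fun m => coef u (Cmode m.+1))) (tail (fun m => coef u (Smode m))) N.
  apply/funext => x; rewrite !partial_sumE opprD addrACA subrr add0r /mode_sum.
  rewrite (sum_tail (fun m => coef u (Cmode m.+1) * psi (Cmode m.+1) x + coef u (Smode m) * psi (Smode m) x) MN).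
  by apply: eq_bigr => m _; rewrite /tail; case: ifP => _ //; rewrite !mul0r addr0.
rewrite -(@ler_pXn2r _ 2) ?nnegrE ?nrm_ge0 ?(ltW e0)// nrm2.
apply: le_trans (mode_sum_le _ _ _) _.
have -> : \sum_(m < N) (tail (fun m => coef u (Cmode m.+1)) m ^+ 2 + tail (fun m => coef u (Smode m)) m ^+ 2)
    = energy u N - energy u M.
  rewrite /energy (sum_tail (fun m => coef u (Cmode m.+1) ^+ 2 + coef u (Smode m) ^+ 2) MN).
  by apply: eq_bigr => m _; rewrite /tail; case: ifP => _ //; rewrite expr0n addr0.
apply: (@le_trans _ _ (2 * C * d)); first by apply: ler_wpM2l; [rewrite mulr_ge0|lra].
by rewrite /d mulrA ler_pdivrMr// mulrC; apply: ler_wpM2l; [exact: sqr_ge0|lra].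
Qed.

Definition mode_index i := match i with Cmode m => m | Smode k => k.+1 end.

Lemma partial_sum_biorthogonal u N i : inL2 u -> (mode_index i <= N)%N ->
  inner (fun x => u x - partial_sum u N x) (phi i) = 0.
Proof.
move=> Lu iN; rewrite innerBl//; [|exact: partial_sum_inL2|exact: phi_inL2].
apply/eqP; rewrite subr_eq0 eq_sym; apply/eqP.
have Lp := phi_inL2 i.
have -> : inner (partial_sum u N) (phi i) = coef u (Cmode 0) * inner (psi (Cmode 0)) (phi i)
  + \sum_(m < N) (coef u (Cmode m.+1) * inner (psi (Cmode m.+1)) (phi i)
     + coef u (Smode m) * inner (psi (Smode m)) (phi i)).
  rewrite partial_sumE.
  have LM := mode_sum_inL2 (fun m => coef u (Cmode m.+1)) (fun m => coef u (Smode m)) N.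
  rewrite innerDl//; last exact/inL2Z/psi_inL2.
  rewrite innerZl//; last exact: psi_inL2.
  congr (_ + _); rewrite inner_suml//; last by move=> m; apply: inL2D; exact/inL2Z/psi_inL2.
  by apply: eq_bigr => m _; rewrite innerDl// ?innerZl//; try exact: psi_inL2; exact/inL2Z/psi_inL2.
have self : coef u i * inner (psi i) (phi i) = inner u (phi i).
  rewrite inner_psi_phi_const /coef mulrC mulVKf// gt_eqF//.
  by apply: lt_le_trans (const_ge i).
have off j : j <> i -> coef u j * inner (psi j) (phi i) = 0.
  by move=> ji; rewrite biorthogonal_offdiag// mulr0.
case: i self off {Lp} iN => [[|m]|k] self off iN.
- rewrite self big1 ?addr0// => m _.
  by rewrite (off (Cmode m.+1))// (off (Smode m))// addr0.
- rewrite (off (Cmode 0))// add0r.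
  rewrite (sum_single (F := fun j => coef u (Cmode j.+1) * inner (psi (Cmode j.+1)) (phi (Cmode m.+1))
     + coef u (Smode j) * inner (psi (Smode j)) (phi (Cmode m.+1))) iN).
    by rewrite self (off (Smode m))// addr0.
  move=> j jm; rewrite (off (Cmode j.+1)) ?(off (Smode j)) ?addr0//.
  by move=> -[jE]; exact: jm.
- rewrite (off (Cmode 0))// add0r.
  rewrite (sum_single (F := fun j => coef u (Cmode j.+1) * inner (psi (Cmode j.+1)) (phi (Smode k))
     + coef u (Smode j) * inner (psi (Smode j)) (phi (Smode k))) iN).
    by rewrite self (off (Cmode k.+1))// add0r.
  move=> j jm; rewrite (off (Cmode j.+1)) ?(off (Smode j)) ?addr0//.
  by move=> -[jE]; exact: jm.
Qed.

(** Integration by parts with phi' = - l^2 Y gives <f, phi> = l^2 <F, Y>, and l is nonzero. *)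
Lemma inner_primitive_anti F f i : derI F f -> contI f -> F 1 = 0 -> F (-1) = 0 ->
  pos_mode i -> inner f (phi i) = 0 -> inner F (anti i 0%N) = 0.
Proof.
move=> dF cf F1 FN ip; have [_ cY _ _ _] := @mode_chainP R i ip.
have cY0 := @chain_cont _ (anti i) 0%N cY.
rewrite (inner_by_parts dF (phi_derI ip) cf (contIZ cY0)) F1 FN !mul0r subrr sub0r.
rewrite innerZr; [|exact: contI_inL2|exact/contI_inL2/(derI_cont dF)].
move=> /eqP; rewrite mulNr opprK mulf_eq0 expf_eq0/= (gt_eqF (eigval_gt0 ip)) => /eqP//.
Qed.

(** The uniform limit is continuous and orthogonal to every clamped eigenfunction, hence zero by
    completeness. Composition with [clampI] defines the limit on the whole line. *)
Lemma uniform_cauchy_eq0 (F : nat -> R -> R) : (forall n, contI (F n)) ->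
  (forall e, 0 < e -> exists M, forall n x, (M <= n)%N -> I11 x -> `|F n x - F M x| <= e) ->
  (forall i, pos_mode i -> exists M, forall n, (M <= n)%N -> inner (F n) (anti i 0%N) = 0) ->
  forall e, 0 < e -> exists M, forall n x, (M <= n)%N -> I11 x -> `|F n x| <= e.
Proof.
move=> cF cauchyF ortF.
pose G x := lim (F n (clampI x) @[n --> \oo]).
have cvgF x : cvgn (fun n => F n (clampI x)).
  apply/cauchy_cvgP/cauchy_exP => e e0; have e2 : 0 < e / 2 by rewrite divr_gt0.
  have [M MP] := cauchyF _ e2; exists (F M (clampI x)); exists M => // n /= Mn.
  rewrite /ball /= distrC; apply: le_lt_trans (MP n _ Mn (clampI_I11 x)) _; lra.
have GF e : 0 < e -> exists M, forall n x, (M <= n)%N -> `|G x - F n (clampI x)| <= e.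
  move=> e0; have e4 : 0 < e / 4 by rewrite divr_gt0.
  have [M MP] := cauchyF _ e4; exists M => n x Mn.
  have /cvgrPdist_le/(_ _ e4)[N _ NP] := cvgF x.
  have h1 := NP (maxn N M) (leq_maxl _ _).
  have h2 := MP (maxn N M) _ (leq_maxr _ _) (clampI_I11 x).
  have h3 := MP n _ Mn (clampI_I11 x).
  have -> : G x - F n (clampI x) = (G x - F (maxn N M) (clampI x)) +
      ((F (maxn N M) (clampI x) - F M (clampI x)) - (F n (clampI x) - F M (clampI x))) by ring.
  apply: le_trans (ler_normD _ _) _; apply: le_trans (lerD h1 (ler_normB _ _)) _; lra.
have cG : contI G.
  move=> x _; apply/cvgrPdist_le => e e0; have e3 : 0 < e / 3 by rewrite divr_gt0.
  have [M MP] := GF _ e3.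
  have : {for x, continuous (F M \o clampI)}.
    by apply: continuous_comp; [exact: clampI_continuous|exact/cF/clampI_I11].
  move=> /cvgrPdist_le/(_ _ e3); apply: filterS => y /= h.
  have h1 := MP M x (leqnn _); have h2 := MP M y (leqnn _).
  have -> : G x - G y = (G x - F M (clampI x)) + ((F M (clampI x) - F M (clampI y)) - (G y - F M (clampI y))).
    by ring.
  apply: le_trans (ler_normD _ _) _; apply: le_trans (lerD h1 (ler_normB _ _)) _.
  by move: h h2; lra.
have G0 : forall x, I11 x -> G x = 0.
  apply: (anti_complete cG) => i ip; have [_ cY _ _ _] := @mode_chainP R i ip.
  have LY := contI_inL2 (@chain_cont _ (anti i) 0%N cY).
  have [M1 ortM] := ortF i ip.
  apply/eqP; rewrite -normr_eq0 eq_le normr_ge0 andbT; apply/ler_addgt0Pr => e e0; rewrite add0r.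
  pose k := nrm (anti i 0%N : R -> R) + 1; have k0 : 0 < k by rewrite ltr_wpDl// nrm_ge0.
  have d0 : 0 < e / (2 * k) by rewrite divr_gt0// mulr_gt0.
  have [M2 M2P] := GF _ d0; pose n := maxn M1 M2.
  have cB : contI (fun x => G x - F n x) by exact: contIB.
  have -> : inner G (anti i 0%N) = inner (fun x => G x - F n x) (anti i 0%N).
    rewrite innerBl ?(ortM n) ?leq_maxl ?subr0//; exact: contI_inL2.
  apply: le_trans (cauchy_schwarz (contI_inL2 cB) LY) _.
  have h : nrm (fun x => G x - F n x) <= e / k.
    have ek : 0 <= e / k by rewrite divr_ge0 ?ltW.
    rewrite -(@ler_pXn2r _ 2) ?nnegrE ?nrm_ge0// nrm2.
    apply: le_trans (inner_le_sup (M := (e / (2 * k)) ^+ 2) cB _) _.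
      move=> x Ix; rewrite -(real_normK (num_real (_ - _))) ler_pXn2r ?nnegrE ?(ltW d0)//.
      by have := M2P n x (leq_maxr _ _); rewrite clampI_id.
    have -> : (e / (2 * k)) ^+ 2 = (e / k) ^+ 2 / 4 by field; exact: lt0r_neq0.
    by have := sqr_ge0 (e / k); lra.
  apply: le_trans (ler_wpM2r (nrm_ge0 _) h) _.
  rewrite mulrAC ler_pdivrMr//; apply: ler_wpM2l; first exact: ltW.
  by rewrite /k lerDl.
move=> e e0; have [M MP] := GF _ e0; exists M => n x Mn Ix.
by have := MP n x Mn; rewrite clampI_id// G0// sub0r normrN.
Qed.

Lemma partial_sum_smooth_cvg u e : smooth u -> 0 < e -> exists M, forall N, (M <= N)%N ->
  nrm (fun x => u x - partial_sum u N x) <= e.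
Proof.
move=> su e0; have cu := smooth_cont su; have Lu := contI_inL2 cu.
pose r N x := u x - partial_sum u N x.
have sr N : smooth (r N).
  rewrite /r (_ : (fun x => _) = fun x => u x + -1 * partial_sum u N x); last by apply/funext => x; ring.
  by apply: smoothD => //; exact/smoothZ/partial_sum_smooth.
have cr N := smooth_cont (sr N); have Lr N := contI_inL2 (cr N).
have r_ort N i : (mode_index i <= N)%N -> inner (r N) (phi i) = 0 by exact: partial_sum_biorthogonal.
have rB N M : nrm (fun x => r N x - r M x) = nrm (fun x => partial_sum u N x - partial_sum u M x).
  rewrite (eq_nrm (g := fun x => -1 * (partial_sum u N x - partial_sum u M x))); last first.
    by move=> x _; rewrite /r; ring.
  by rewrite nrmZ ?normrN1 ?mul1r//; exact/inL2B/partial_sum_inL2/partial_sum_inL2.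
have /choice[F FP] : forall N, exists F, derI F (r N) /\ F (-1) = 0 by move=> N; exact: primitive.
have dF N : derI (F N) (r N) by case: (FP N).
have FN N : F N (-1) = 0 by case: (FP N).
(* The zero mode enters here: the remainder is orthogonal to phi_0 = 1, so its mean vanishes. *)
have F1 N : F N 1 = 0.
  have := Rintegral_derI (dF N) (cr N); rewrite FN subr0 => <-.
  have := r_ort N (Cmode 0) isT; rewrite /inner /= => <-.
  by apply: eq_Rintegral => x _; rewrite mulr1.
have cF N := derI_cont (dF N).
have Fsmall : forall e, 0 < e -> exists M, forall n x, (M <= n)%N -> I11 x -> `|F n x| <= e.
  apply: uniform_cauchy_eq0 => //.
    move=> d d0; have d2 : 0 < d / 2 by rewrite divr_gt0.
    have [M MP] := partial_sum_cauchy Lu d2; exists M => n x Mn Ix.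
    have dB : derI (fun x => F n x - F M x) (fun x => r n x - r M x).
      by move=> y Iy; exact: dD (dF n y Iy) (dN (dF M y Iy)).
    have z : F n (-1) - F M (-1) = 0 by rewrite !FN subrr.
    have := sup_bound dB (contIB (cr n) (cr M)) z Ix; rewrite -nrm2 rB => h.
    rewrite -(@ler_pXn2r _ 2) ?nnegrE ?(ltW d0)// real_normK ?num_real//.
    apply: le_trans h _; have := MP n Mn.
    by rewrite -(@ler_pXn2r _ 2) ?nnegrE ?nrm_ge0 ?(ltW d2)//; have := sqr_ge0 d; nra.
  move=> i ip; exists (mode_index i) => n iN.
  exact: inner_primitive_anti (dF n) (cr n) (F1 n) (FN n) ip (r_ort _ _ iN).
have e8 : 0 < e / 8 by rewrite divr_gt0.
have [M MP] := partial_sum_cauchy Lu e8; exists M => N MN.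
have [r' dr cr'] := sr N.
pose k := nrm r' + 1; have k0 : 0 < k by rewrite ltr_wpDl// nrm_ge0.
have d0 : 0 < e ^+ 2 / (8 * k) by rewrite divr_gt0// ?exprn_gt0// mulr_gt0.
have [M2 M2P] := Fsmall _ d0; pose K := maxn M M2.
have FK : nrm (F K) <= e ^+ 2 / (4 * k).
  have ek : 0 <= e ^+ 2 / (4 * k) by rewrite divr_ge0 ?sqr_ge0// mulr_ge0// ltW.
  rewrite -(@ler_pXn2r _ 2) ?nnegrE ?nrm_ge0// nrm2.
  apply: le_trans (inner_le_sup (M := (e ^+ 2 / (8 * k)) ^+ 2) (cF K) _) _.
    move=> x Ix; rewrite -(real_normK (num_real _)) ler_pXn2r ?nnegrE ?(ltW d0)//.
    exact: M2P (leq_maxr _ _) Ix.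
  have -> : e ^+ 2 / (8 * k) = (e ^+ 2 / (4 * k)) / 2 by field; exact: lt0r_neq0.
  by have := sqr_ge0 (e ^+ 2 / (4 * k)); lra.
(* N is fixed while K depends on it. The Cauchy property bounds the first term; in the second,
   integration by parts moves the derivative onto r_N, and F_K is uniformly small. The resulting x^2
   <= x e / 4 + e^2 / 4 forces x <= e. *)
have rr : inner (r N) (r N) = inner (r N) (fun x => r N x - r K x) - inner (F K) r'.
  rewrite innerBr// [inner (r N) (r K)]innerC (inner_by_parts (dF K) dr (cr K) cr') F1 FN; ring.
have h1 : `|inner (r N) (fun x => r N x - r K x)| <= nrm (r N) * (e / 4).
  apply: le_trans (cauchy_schwarz (Lr N) (inL2B (Lr N) (Lr K))) _; apply: ler_wpM2l; first exact: nrm_ge0.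
  rewrite rB.
  have -> : nrm (fun x => partial_sum u N x - partial_sum u K x) =
     nrm (fun x => (partial_sum u N x - partial_sum u M x) - (partial_sum u K x - partial_sum u M x)).
    by apply: eq_nrm => x _; ring.
  have LP n := partial_sum_inL2 u n.
  apply: le_trans (nrmB (inL2B (LP N) (LP M)) (inL2B (LP K) (LP M))) _.
  have := MP N MN; have := MP K (leq_maxl _ _); lra.
have h2 : `|inner (F K) r'| <= e ^+ 2 / 4.
  apply: le_trans (cauchy_schwarz (contI_inL2 (cF K)) (contI_inL2 cr')) _.
  apply: le_trans (ler_wpM2r (nrm_ge0 _) FK) _.
  have -> : e ^+ 2 / (4 * k) * nrm r' = e ^+ 2 / 4 * (nrm r' / k) by field; exact: lt0r_neq0.
  rewrite ler_piMr ?divr_ge0 ?sqr_ge0// ler_pdivrMr// mul1r /k lerDl//.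
have {rr} rr : nrm (r N) ^+ 2 <= nrm (r N) * (e / 4) + e ^+ 2 / 4.
  rewrite nrm2 rr; apply: le_trans (ler_norm _) _; apply: le_trans (ler_normB _ _) _.
  exact: lerD.
rewrite -/(r N) leNgt; apply/negP => er; move: rr er e0; clear; nra.
Qed.

(** The remainder of u - v is at most (1 + K) |u - v| for every N, so a smooth v within e / (2 (1 +
    K)) of u reduces the claim to v. *)
Lemma partial_sum_cvg u e : inL2 u -> 0 < e -> exists M, forall N, (M <= N)%N ->
  nrm (fun x => u x - partial_sum u N x) <= e.
Proof.
move=> Lu e0; have [K K0 KP] := partial_sum_bounded.
have K2 : 0 < 2 * (1 + K) by rewrite mulr_gt0// ltr_pwDl.
have [v sv uv] := smooth_dense Lu (divr_gt0 e0 K2).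
have Lv := contI_inL2 (smooth_cont sv).
have [M MP] := partial_sum_smooth_cvg sv (divr_gt0 e0 (ltr0Sn R 1)).
exists M => N MN; have LD := inL2B Lu Lv; have LP f := partial_sum_inL2 f N.
rewrite (eq_nrm (g := fun x => ((u x - v x) - partial_sum (fun x => u x - v x) N x) + (v x - partial_sum v N x))); last first.
  by move=> x _; rewrite partial_sumB//; ring.
apply: le_trans (nrmD (inL2B LD (LP _)) (inL2B Lv (LP _))) _.
have h := nrmB LD (LP (fun x => u x - v x)).
have h2 := KP _ N LD; have h3 := MP N MN.
have h4 : (1 + K) * nrm (fun x => u x - v x) <= e / 2.
  have K1 : 0 < 1 + K by rewrite ltr_pwDl.
  apply: le_trans (ler_wpM2l (ltW K1) uv) _.
  by rewrite le_eqVlt; apply/orP; left; apply/eqP; field; exact: lt0r_neq0.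
apply: le_trans (lerD (le_trans h (lerD (lexx _) h2)) h3) _.
by rewrite [leRHS]splitr lerD2r -[X in X + _]mul1r -mulrDl.
Qed.

End Expansion.

Theorem proposition3p6 (R : realType) :
  [/\ forall i : mode, eigenfunction bc_direct (eigval i) (psi i : R -> R),
      forall i : mode, eigenfunction bc_adjoint (eigval i) (phi i : R -> R),
      biorthogonal (psi : mode -> R -> R) (phi : mode -> R -> R),
      (forall m : nat, inner (psi_c m) (phi_c m) = c_const m :> R) /\
      (forall m : nat, (1 <= m)%N ->
         inner (psi_s m) (phi_s m) = s_const m :> R)
    & forall u : R -> R, inL2 u ->
        normL2 (fun x => u x - partial_sum u N x) @[N --> \oo] --> 0%E].
Proof.
split; [exact: psi_eigenfunction|exact: phi_eigenfunction| | |].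
- split=> [i|i j|i]; [split; [exact: psi_inL2|exact: phi_inL2]|exact: biorthogonal_offdiag|].
  by rewrite inner_psi_phi_const; apply/eqP; rewrite gt_eqF// (lt_le_trans _ (const_ge i)).
- split=> [m|[//|k] _]; first exact: (inner_psi_phi_const (Cmode m)).
  exact: (inner_psi_phi_const (Smode k)).
- move=> u Lu.
  under eq_fun do rewrite (normL2E (inL2B Lu (partial_sum_inL2 u _))).
  apply: cvg_EFin; first exact: nearW.
  apply/cvgrPdist_le => e e0; have [M MP] := partial_sum_cvg Lu e0.
  by exists M => // N MN; rewrite sub0r normrN ger0_norm ?nrm_ge0// MP.
Qed.
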